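(* Let $k,l$ be integers with $1\le l\le k$ and put $d=k+l$. Let $\mathcal C=[c_i^j]$ ($1\le i\le k$, $1\le j\le l$) be a $k\times l$ matrix of real numbers such that every $l\times l$ submatrix of $\mathcal C$ is nonsingular. For $1\le j\le l$ define $\Phi_j:\mathbb R^k\to\mathbb R$ by $$\Phi_j(y)=\sum_{i=1}^k c_i^j\,y_i^2 .$$ Let $G=B(0,1)$ be the open unit ball of $\mathbb R^k$ centered at the origin, and let $$S=\{(y;\Phi_1(y),\dots,\Phi_l(y)):y\in G\}\subset\mathbb R^d .$$ Then $S$ is a model surface.
   Context: $m_n$ denotes Lebesgue measure on $\mathbb R^n$, and $L^p(\mathbb R^d)$ is taken with respect to $m_d$. For integers $1\le k<d$, let $\Delta(k,d)\subset\mathbb R^2$ be the closed triangle with vertices $(0,0)$, $(1,1)$ and $\left(\frac{d}{2d-k},\frac{d-k}{2d-k}\right)$. Define $\mathcal T(k,d)$ as follows: if $k(k+3)\ge 2d$, then $\mathcal T(k,d)=\Delta(k,d)$; if $k(k+3)<2d$, then $\mathcal T(k,d)$ is the set of points $(1/p,1/q)\in\Delta(k,d)$ satisfying $\frac1p-\frac1q\le\frac{2k}{6d-k^2-5k}$. Let $S=\{(y;\Phi_1(y),\dots,\Phi_l(y)):y\in G\}\subset\mathbb R^d$, where $G$ is a nonempty open subset of $\mathbb R^k$, $l=d-k$, and the functions $\Phi_j:\mathbb R^k\to\mathbb R$ are homogeneous polynomials. Let $\mu$ be the measure on $S$ induced by $m_k$ on $G$, i.e. the push-forward of $m_k$ restricted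 to $G$ under $y\mapsto(y;\Phi_1(y),\dots,\Phi_l(y))$, regarded as a Borel measure on $\mathbb R^d$. Then $S$ is called a model surface if for every $(p,q)$ such that $(1/p,1/q)$ lies in the interior of $\mathcal T(k,d)$ there is a constant $C<\infty$ (allowed to depend on $p$, $q$ and $S$) such that $$\|\mu * f\|_{L^q(\mathbb R^d)}\le C\,\|f\|_{L^p(\mathbb R^d)}\quad\text{for all } f\in L^p(\mathbb R^d).$$ *)

(* Defs.v *)
From HB Require Import structures.
From mathcomp Require Import all_boot all_order all_algebra.
From mathcomp.multinomials Require Import -(notations) mpoly.
From mathcomp Require Import all_classical all_reals all_analysis.

Set Implicit Arguments.
Unset Strict Implicit.
Unset Printing Implicit Defensive.

Import Order.TTheory GRing.Theory Num.Theory.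
Import numFieldNormedType.Exports.

Local Open Scope classical_set_scope.
Local Open Scope ring_scope.

Definition measure_rV_display : measure_display.
Proof. exact: default_measure_display. Qed.

Section measurable_rV.
Variables (R : realType) (n : nat).

Definition rV_coord (i : 'I_n) (v : 'rV[R]_n) : measurableTypeR R := v ord0 i.

Let rV_set0 : g_sigma_preimage rV_coord set0.
Proof. exact: sigma_algebra0. Qed.

Let rV_setC A : g_sigma_preimage rV_coord A -> g_sigma_preimage rV_coord (~` A).
Proof. exact: sigma_algebraC. Qed.

Let rV_bigcup (F : _^nat) : (forall i, g_sigma_preimage rV_coord (F i)) ->
  g_sigma_preimage rV_coord (\bigcup_i (F i)).
Proof. exact: sigma_algebra_bigcup. Qed.

(* Equal to the Borel sigma-algebra: see measurable_rV_open below. *)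
HB.instance Definition _ := @isMeasurable.Build measure_rV_display
  'rV[R]_n (g_sigma_preimage rV_coord) rV_set0 rV_setC rV_bigcup.

Lemma measurable_rV_coord i : measurable_fun [set: 'rV[R]_n] (rV_coord i).
Proof.
move=> _ Y mY; rewrite setTI; apply: sub_sigma_algebra => /=.
rewrite -bigcup_seq/=; exists i => /=; first by rewrite mem_index_enum.
by exists Y => //; rewrite setTI.
Qed.

Lemma measurable_fun_rV d (T : measurableType d) (f : T -> 'rV[R]_n) :
  (forall i, measurable_fun [set: T] (rV_coord i \o f)) ->
  measurable_fun [set: T] f.
Proof.
move=> mf.
suff : g_sigma_preimage rV_coord `<=` [set A | measurable (f @^-1` A)].
  by move=> h _ A mA; rewrite setTI; exact: h.
apply: smallest_sub.
  split.
  - by rewrite /= preimage_set0.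
  - by move=> A /= mA; rewrite setTD preimage_setC; exact: measurableC.
  - by move=> F /= mF; rewrite preimage_bigcup; exact: bigcupT_measurable.
rewrite -bigcup_seq; apply: bigcup_sub => i _ A [B mB <-] /=.
by rewrite setTI -comp_preimage -[X in measurable X]setTI; exact: mf.
Qed.

End measurable_rV.

Section lebesgue_rV.
Variable R : realType.

Definition rV_cons n (p : measurableTypeR R * 'rV[R]_n) : 'rV[R]_n.+1 :=
  row_mx (const_mx p.1 : 'rV_1) p.2.

Lemma rV_cons0 n p : rV_coord ord0 (@rV_cons n p) = p.1.
Proof.
rewrite /rV_coord (_ : ord0 = lshift n (ord0 : 'I_1)); last exact/val_inj.
exact: etrans (row_mxEl _ _ _ _) (mxE _ _ _ _).
Qed.

Lemma rV_consS n p (j : 'I_n) :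
  rV_coord (lift ord0 j) (@rV_cons n p) = rV_coord j p.2.
Proof.
rewrite /rV_coord (_ : lift ord0 j = rshift 1 j); last exact/val_inj.
exact: row_mxEr.
Qed.

Lemma measurable_rV_cons n : measurable_fun setT (@rV_cons n).
Proof.
apply: measurable_fun_rV => i.
have [j ->|->] := unliftP ord0 i.
  rewrite (_ : _ \o _ = (rV_coord j) \o snd).
    by apply: measurableT_comp => //; exact: measurable_rV_coord.
  by apply/funext => p; exact: rV_consS.
rewrite (_ : _ \o _ = fst) //.
by apply/funext => p; exact: rV_cons0.
Qed.

Definition rV_uncons n (v : 'rV[R]_n.+1) : measurableTypeR R * 'rV[R]_n :=
  (rV_coord ord0 v, \row_j rV_coord (lift ord0 j) v).

Lemma rV_consK n : cancel (@rV_cons n) (@rV_uncons n).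
Proof.
move=> [x v]; rewrite /rV_uncons rV_cons0; apply: (f_equal (pair x)).
by apply/rowP => j; rewrite mxE rV_consS.
Qed.

Lemma rV_unconsK n : cancel (@rV_uncons n) (@rV_cons n).
Proof.
move=> v; apply/rowP => i; rewrite -[LHS]/(rV_coord i _).
have [j ->|->] := unliftP ord0 i; first by rewrite rV_consS /rV_coord mxE.
by rewrite rV_cons0.
Qed.

Lemma measurable_rV_uncons n : measurable_fun setT (@rV_uncons n).
Proof.
apply: measurable_fun_pair; first exact: measurable_rV_coord.
apply: measurable_fun_rV => j.
rewrite (_ : _ \o _ = rV_coord (lift ord0 j)); first exact: measurable_rV_coord.
by apply/funext => v /=; rewrite /rV_coord mxE.
Qed.

Section step.
Variables (n : nat) (m : {sigma_finite_measure set 'rV[R]_n -> \bar R}).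

Definition cons_measure : set 'rV[R]_n.+1 -> \bar R :=
  pushforward (@lebesgue_measure R \x m)%E (@rV_cons n).

Let cons_measure0 : cons_measure set0 = 0%E.
Proof. by rewrite /cons_measure /pushforward preimage_set0 measure0. Qed.

Let cons_measure_ge0 A : (0 <= cons_measure A)%E.
Proof. exact: (measure_ge0 (@lebesgue_measure R \x m)%E). Qed.

Let cons_measure_sigma_additive : semi_sigma_additive cons_measure.
Proof.
have mc := @measurable_rV_cons n.
move=> F mF tF mUF; rewrite /cons_measure /pushforward preimage_bigcup.
apply: measure_semi_sigma_additive.
- by move=> i; rewrite -[X in measurable X]setTI; exact: mc.
- apply/trivIsetP => /= i j _ _ ij; rewrite -preimage_setI.
  by move/trivIsetP : tF => /(_ _ _ _ _ ij) ->//; rewrite preimage_set0.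
- by rewrite -preimage_bigcup -[X in measurable X]setTI; exact: mc.
Qed.

HB.instance Definition _ := isMeasure.Build _ _ _ cons_measure
  cons_measure0 cons_measure_ge0 cons_measure_sigma_additive.

Let cons_measure_sigma_finite : sigma_finite setT cons_measure.
Proof.
have /sigma_finiteP[F [TF ndF Foo]] := sigma_finiteT (@lebesgue_measure R).
have /sigma_finiteP[G [TG ndG Goo]] := sigma_finiteT m.
exists (fun i => @rV_uncons n @^-1` (F i `*` G i)).
  rewrite -preimage_bigcup; apply/esym; rewrite -subTset => v _.
  have [i _ Fi] : (\bigcup_i F i) (rV_uncons v).1 by rewrite -TF.
  have [j _ Gj] : (\bigcup_i G i) (rV_uncons v).2 by rewrite -TG.
  exists (maxn i j) => //; split.
    by move: Fi; exact/subsetPset/ndF/leq_maxl.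
  by move: Gj; exact/subsetPset/ndG/leq_maxr.
move=> i; have [mFi Fioo] := Foo i; have [mGi Gioo] := Goo i; split.
  rewrite -[X in measurable X]setTI; apply: measurable_rV_uncons => //.
  exact: measurableX.
rewrite /cons_measure /pushforward -comp_preimage.
rewrite (_ : _ \o _ = id) ?preimage_id; last first.
  by apply/funext => p; exact: rV_consK.
by rewrite product_measure1E// lte_mul_pinfty// ge0_fin_numE.
Qed.

HB.instance Definition _ := Measure_isSigmaFinite.Build _ _ _ cons_measure
  cons_measure_sigma_finite.

End step.

Fixpoint lebesgue_rV n : {sigma_finite_measure set 'rV[R]_n -> \bar R} :=
  match n with
  | 0 => dirac (0 : 'rV[R]_0)
  | n'.+1 => cons_measure (lebesgue_rV n')
  end.

Lemma lebesgue_rV_box n (a b : 'I_n -> R) : (forall i, a i <= b i) ->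
  lebesgue_rV n [set v | forall i, a i <= v ord0 i <= b i] =
  (\prod_i (b i - a i))%:E.
Proof.
elim: n a b => [|n IHn] a b ab.
  rewrite big_ord0 /= diracE mem_set //.
  by move=> /= -[].
rewrite big_ord_recl EFinM -IHn //=.
have -> : (b ord0 - a ord0)%:E = @lebesgue_measure R `[a ord0, b ord0].
  rewrite lebesgue_measure_itv /= lte_fin lt_neqAle ab andbT.
  by case: eqVneq => //= ->; rewrite subrr.
set T := (X in (_ * lebesgue_rV n X)%E).
have mT : measurable T.
  have -> : T = \bigcap_(i in [set: 'I_n])
      (rV_coord i @^-1` `[a (lift ord0 i), b (lift ord0 i)]).
    apply/seteqP; split=> v /= h i; first by move=> _; rewrite /= in_itv; exact: h.
    by have := h i I; rewrite /= in_itv.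
  apply: fin_bigcap_measurable => // i _.
  by rewrite -[X in measurable X]setTI; exact: measurable_rV_coord.
rewrite -product_measure1E // /cons_measure /pushforward.
congr (_ _); apply/seteqP; split=> p /=.
  move=> abp; split; first by rewrite /= in_itv /= -(rV_cons0 p); exact: abp.
  by move=> i; have := abp (lift ord0 i); rewrite -/(rV_coord _ _) rV_consS.
rewrite in_itv /= => -[p1 p2] i; rewrite -/(rV_coord _ _).
by have [j ->|->] := unliftP ord0 i; rewrite ?rV_consS ?rV_cons0 //; exact: p2.
Qed.

End lebesgue_rV.

Section borel_rV.
Variables (R : realType) (n : nat).

Lemma open_measurable_rV (A : set 'rV[R]_n) : open A -> measurable A.
Proof.
move=> oA.
pose B (q : 'rV[rat]_n * nat) : set 'rV[R]_n :=
  ball (map_mx (@ratr R) q.1 : 'rV[R]_n) q.2.+1%:R^-1.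
have mB q : measurable (B q).
  have -> : B q = \bigcap_(i in [set: 'I_n])
      (rV_coord i @^-1` ball (ratr (q.1 ord0 i) : R) q.2.+1%:R^-1).
    apply/seteqP; split=> v /=.
      by move=> h i _; have [_ /(_ ord0 i)] := h; rewrite mxE.
    move=> h; split; first by rewrite invr_gt0.
    by move=> i j; rewrite mxE (ord1 i); exact: h j I.
  apply: fin_bigcap_measurable => // i _.
  rewrite -[X in measurable X]setTI; apply: measurable_rV_coord => //.
  by rewrite ball_itv; exact: measurable_itv.
have -> : A = \bigcup_q (if `[< B q `<=` A >] then B q else set0).
  apply/seteqP; split=> [v Av|v [q _]]; last by case: asboolP => // BA /BA.
  have [e /= e0 eA] : exists2 e : R, 0 < e & ball v e `<=` A.
    by have /nbhs_ballP[e e0 ?] := oA v Av; exists e.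
  have e20 : 0 < e / 2 by rewrite divr_gt0.
  have [N _ /(_ N (leqnn _)) /= Ne] := near_infty_natSinv_lt (PosNum e20).
  have N0 : 0 < N.+1%:R^-1 :> R by rewrite invr_gt0.
  have h i : exists q : rat, ball (ratr q : R) N.+1%:R^-1 (v ord0 i).
    have /rat_in_itvoo[q /itvP qv] :
      v ord0 i - N.+1%:R^-1 < v ord0 i + N.+1%:R^-1.
      by rewrite ltrBlDr -addrA ltrDl addr_gt0.
    by exists q; rewrite /ball /= ltr_distl ltrBlDr qv -ltrBlDr qv.
  have [q qv] := choice h.
  have Bv : B (\row_i q i, N) v.
    by split=> // i j; rewrite !mxE (ord1 i).
  exists (\row_i q i, N) => //; rewrite asboolT // => w Bw; apply: eA.
  apply: (@le_ball _ _ _ (N.+1%:R^-1 + N.+1%:R^-1)).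
    by rewrite (splitr e) lerD // ltW.
  by apply: (ball_triangle _ Bw); exact: ball_sym.
apply: countable_bigcupT_measurable => // q.
by case: ifP.
Qed.

Lemma measurable_rV_open :
  measurable = <<s [set A : set 'rV[R]_n | open A] >>.
Proof.
apply/seteqP; split; last first.
  apply: smallest_sub; first exact: sigma_algebra_measurable.
  exact: open_measurable_rV.
apply: smallest_sub; first exact: smallest_sigma_algebra.
rewrite -bigcup_seq; apply: bigcup_sub => i _ A [B mB <-].
rewrite setTI.
pose oo := <<s [set A : set 'rV[R]_n | open A] >>.
have sB : (@ocitv R).-sigma.-measurable `<=` [set C | oo (rV_coord i @^-1` C)].
  rewrite measurable_realfun.RGenOpens.measurableE; apply: smallest_sub.
    split.
    - by rewrite /= preimage_set0; exact: sigma_algebra0.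
    - by move=> C /= oC; rewrite setTD preimage_setC; exact: sigma_algebraC.
    - move=> F /= oF; rewrite preimage_bigcup; exact: sigma_algebra_bigcup.
  move=> _ [x [y ->]]; apply: sub_sigma_algebra.
  apply: open_comp; last exact: interval_open.
  by move=> v _; exact: coord_continuous.
exact: sB.
Qed.

End borel_rV.

Section triangle.
Variable R : realType.
Implicit Types k d : nat.

Definition hull3 (u v w : R * R) : set (R * R) :=
  [set z | exists a b c : R, [/\ 0 <= a, 0 <= b, 0 <= c, a + b + c = 1
    & z = (a * u.1 + b * v.1 + c * w.1, a * u.2 + b * v.2 + c * w.2)]].

Definition Delta k d : set (R * R) :=
  hull3 (0, 0) (1, 1)
    (d%:R / (2 * d%:R - k%:R), (d%:R - k%:R) / (2 * d%:R - k%:R)).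

Definition calT k d : set (R * R) :=
  if (2 * d <= k * (k + 3))%N then Delta k d
  else Delta k d `&` [set z | z.1 - z.2 <=
    2 * k%:R / (6 * d%:R - k%:R ^+ 2 - 5 * k%:R)].

End triangle.

Section model_surface.
Variables (R : realType) (k l : nat).

Definition graph_map (Phi : 'I_l -> 'rV[R]_k -> R) (y : 'rV[R]_k) :
  'rV[R]_(k + l) := row_mx y (\row_j Phi j y).

Definition graph_surface (G : set 'rV[R]_k) Phi : set 'rV[R]_(k + l) :=
  graph_map Phi @` G.

Definition surface_measure (G : set 'rV[R]_k) Phi :
    set 'rV[R]_(k + l) -> \bar R :=
  pushforward (fun A => lebesgue_rV R k (A `&` G)) (graph_map Phi).

(* Where z |-> f (x - z) is not mu-integrable, the value is +oo or -oo, so a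
   finite L^q norm of convolution mu f entails that the integral defining it
   exists for almost every x. *)
Definition convolution (mu : set 'rV[R]_(k + l) -> \bar R)
    (f : 'rV[R]_(k + l) -> R) (x : 'rV[R]_(k + l)) : \bar R :=
  (\int[mu]_z (f (x - z))%:E)%E.

Definition homogeneous_polynomial (phi : 'rV[R]_k -> R) : Prop :=
  exists (e : nat) (P : mpoly k R),
    P \is ishomog1 e mdeg /\ forall y, phi y = meval (fun i => y ord0 i) P.

(* The interior of calT lies in (0, 1) ^ 2, so both exponents are real numbers
   greater than 1. The set S determines G and the restriction to G of Phi, hence
   also surface_measure G Phi. *)
Definition model_surface (S : set 'rV[R]_(k + l)) : Prop :=
  exists (G : set 'rV[R]_k) (Phi : 'I_l -> 'rV[R]_k -> R),
    [/\ open G, G !=set0, (forall j, homogeneous_polynomial (Phi j)),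
        S = graph_surface G Phi
      & forall p q : R, (calT k (k + l))° (p^-1, q^-1) ->
          exists C : R, forall f : 'rV[R]_(k + l) -> R,
            f \in Lfun (lebesgue_rV R (k + l)) p%:E ->
            ('N[lebesgue_rV R (k + l)]_(q%:E)
                [convolution (surface_measure G Phi) f] <=
             C%:E * 'N[lebesgue_rV R (k + l)]_(p%:E) [EFin \o f])%E].

End model_surface.

(* The library norm on 'rV[R]_n, hence its ball, is that of the sup norm. *)
Definition euclidean_ball (R : realType) n (x : 'rV[R]_n) (r : R) :
  set 'rV[R]_n := [set y | Num.sqrt (\sum_i (y ord0 i - x ord0 i) ^+ 2) < r].

(* Main.v *)
(** The ball lies in the cube [-1, 1]^k, so [mu * f] is dominated by
    [2^k T_1 ... T_k |f|], where [T_i] averages translates along the parabola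
    [t |-> (t e_i; t^2 c_i)], [c_i] being the i-th row of [c].
    With [E_v] the average over the vertical segment [{u v c_i : 0 <= u <= 1}],
    telescope each factor as [T_i = T_i E_1 + sum_(j > 0) T_i (E_{2^-j} - E_{2^(1-j)})], which
    splits the operator into pieces indexed by [(j_1, ..., j_k)].
    On [L^2] such a piece has squared norm at most the product of the
    [10 (j_i + 1) 2^(-j_i)] (estimate [T_i T_i^*], i.e. the integral of a function
    over [(t - s, t^2 - s^2)]).  From [L^1] to [L^oo] its norm is [O (2^(j_i1 + ... + j_il))]
    for any [l] indices, since the corresponding rows of [c] form a
    basis of the vertical space; choosing the [l] smallest [j_i] gives the exponent
    [(l / k) (j_1 + ... + j_k)].
    Interpolating these with the trivial [L^1] and [L^oo] bounds, the pieces are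
    summable when [(1/p, 1/q)] is interior to the triangle, which yields a bound
    [C a^s] for the [L^q] norm when [|f| <= 1] and [||f||_1 <= a], for all [s] near [1/p].
    Decomposing a general [f] into dyadic level sets, with [s > 1/p] for the
    high levels and [s < 1/p] for the low ones, gives the strong type. *)

(* The averages exist in two models. Signed differences are taken on bounded, integrable real
   functions ([bmf], [bint]), where Fubini and the [L^2] pairing cause no trouble. Majorization by
   line integrals, which may be infinite, takes place on nonnegative extended-real functions
   ([nnm]). Absolute values lead from the first model to the second.

   The telescoping sum is cut at a finite level, so that it is an identity and not a limit. The
   price is the last difference, which contains [E_0 = id] and has no useful bound from [L^1] to
   [L^oo]. Pieces containing it are controlled by [L^2] decay alone; for a fixed bounded integrable
   function their total tends to 0 as the level grows.

   All operators are averages of translates, hence commute, so the vertical averages can be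
   regrouped before being estimated. The [L^oo] bound chooses its [l] rows piece by piece, which is
   why pieces are indexed by whole words of indices.

   No interpolation theorem for operators is invoked: for a fixed piece of a fixed function,
   interpolation is a pointwise inequality between powers, integrated. Positivity then replaces
   exact level-set decompositions by majorants. *)
From HB Require Import structures.
Require Import Defs.
From mathcomp Require Import all_boot all_order all_algebra.
From mathcomp.multinomials Require Import -(notations) mpoly.
From mathcomp Require Import all_classical all_reals all_analysis.
From mathcomp Require Import measurable_realfun ring lra.
Set Implicit Arguments.
Unset Strict Implicit.
Unset Printing Implicit Defensive.
Import Order.TTheory GRing.Theory Num.Theory.
Import numFieldNormedType.Exports.
Local Open Scope classical_set_scope.
Local Open Scope ring_scope.

(** * Translation invariance of Lebesgue measure on row vectors *)

Section transl.
Variable R : realType.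
Local Open Scope ereal_scope.

Lemma lebesgue_measure_shift (a : R) (A : set (measurableTypeR R)) : measurable A ->
  pushforward (@lebesgue_measure R) (fun x : measurableTypeR R => (x + a)%R : measurableTypeR R) A =
  lebesgue_measure A.
Proof.
move=> mA.
have mf : measurable_fun setT (fun x : measurableTypeR R => (x + a)%R : measurableTypeR R).
  exact: measurable_funD.
pose phi := HB.pack_for {mfun measurableTypeR R >-> measurableTypeR R}
   (fun x : measurableTypeR R => (x + a)%R : measurableTypeR R) (isMeasurableFun.Build _ _ _ _ _ mf).
apply/esym; apply: (@lebesgue_measure_unique _ (pushforward (@lebesgue_measure R) phi)) => //= _ [[x y]] _ <-.
rewrite /pushforward.
have -> : phi @^-1` [set` `]x, y]] = [set` `](x - a)%R, (y - a)%R]].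
  by apply/seteqP; split => z; rewrite /= !in_itv /= ltrBlDr lerBrDr.
rewrite !lebesgue_measure_itv/= !lte_fin ltrD2r.
by case: ifP => // _; rewrite -!EFinB; congr EFin; ring.
Qed.

Lemma integral_shift (a : R) (f : R -> \bar R) : measurable_fun setT f ->
  (forall x, 0 <= f x) ->
  \int[@lebesgue_measure R]_x f (x + a)%R = \int[@lebesgue_measure R]_x f x.
Proof.
move=> mf f0.
have mh : measurable_fun setT (fun x : measurableTypeR R => (x + a)%R : measurableTypeR R).
  exact: measurable_funD.
rewrite -[LHS](ge0_integral_pushforward mh _ measurableT (f := f))//.
by apply: eq_measure_integral => //= A mA _; exact: lebesgue_measure_shift.
Qed.

Lemma integral_rV_cons n (F : 'rV[R]_n.+1 -> \bar R) : measurable_fun setT F ->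
  (forall x, 0 <= F x) ->
  \int[lebesgue_rV R n.+1]_v F v =
  \int[@lebesgue_measure R]_x \int[lebesgue_rV R n]_v F (rV_cons (x, v)).
Proof.
move=> mF F0; have mc := @measurable_rV_cons R n.
rewrite -(fubini_tonelli1 (F \o @rV_cons R n)) //=; last first.
  exact: measurableT_comp.
exact: (ge0_integral_pushforward mc (@lebesgue_measure R \x lebesgue_rV R n) measurableT mF).
Qed.

Lemma measurable_rV_add d (T : measurableType d) n (f g : T -> 'rV[R]_n) :
  measurable_fun setT f -> measurable_fun setT g ->
  measurable_fun setT (fun x => f x + g x)%R.
Proof.
move=> mf mg; apply: measurable_fun_rV => i.
rewrite (_ : _ \o _ = fun x => (rV_coord i (f x) + rV_coord i (g x))%R); last first.
  by apply/funext => x; rewrite /rV_coord /= mxE.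
by apply: measurable_funD; apply: measurableT_comp => //; exact: measurable_rV_coord.
Qed.

Lemma measurable_rV_scale d (T : measurableType d) n (f : T -> R) (g : T -> 'rV[R]_n) :
  measurable_fun setT f -> measurable_fun setT g ->
  measurable_fun setT (fun x : T => f x *: g x)%R.
Proof.
move=> mf mg; apply: measurable_fun_rV => i.
rewrite (_ : _ \o _ = fun x => (f x * rV_coord i (g x))%R); last first.
  by apply/funext => x; rewrite /rV_coord /= mxE.
by apply: measurable_funM => //; apply: measurableT_comp => //; exact: measurable_rV_coord.
Qed.

Lemma measurable_rV_opp d (T : measurableType d) n (f : T -> 'rV[R]_n) :
  measurable_fun setT f -> measurable_fun setT (fun x => - f x)%R.
Proof.
move=> mf; rewrite (_ : (fun _ => _) = fun x => (-1 *: f x)%R); last first.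
  by apply/funext => x; rewrite scaleN1r.
exact: measurable_rV_scale.
Qed.

Lemma measurable_rV_sub d (T : measurableType d) n (f g : T -> 'rV[R]_n) :
  measurable_fun setT f -> measurable_fun setT g ->
  measurable_fun setT (fun x => f x - g x)%R.
Proof. by move=> mf mg; apply: measurable_rV_add => //; exact: measurable_rV_opp. Qed.

Lemma measurable_shift_rV n (a : 'rV[R]_n) d' (T : measurableType d') (g : 'rV[R]_n -> T) :
  measurable_fun setT g -> measurable_fun setT (fun x : 'rV[R]_n => g (x + a)%R).
Proof.
by move=> mg; apply: measurableT_comp => //; exact: measurable_rV_add.
Qed.

Lemma integral_rV_shift n (a : 'rV[R]_n) (F : 'rV[R]_n -> \bar R) :
  measurable_fun setT F -> (forall x, 0 <= F x) ->
  \int[lebesgue_rV R n]_v F (v + a)%R = \int[lebesgue_rV R n]_v F v.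
Proof.
elim: n a F => [|n IH] a F mF F0.
  by apply: eq_integral => v _; congr F; apply/rowP => -[].
have mFc : measurable_fun setT (F \o @rV_cons R n).
  by apply: measurableT_comp => //; exact: measurable_rV_cons.
pose b := rV_uncons a.
have mFa := @measurable_shift_rV _ a _ _ _ mF.
rewrite [RHS](integral_rV_cons mF F0) [LHS](integral_rV_cons mFa (fun x => F0 _)).
have E x v : (rV_cons (x, v) + a = rV_cons (x + b.1, v + b.2))%R.
  apply/rowP => i; rewrite mxE -!/(rV_coord i _).
  have [j ->|->] := unliftP ord0 i; last by rewrite !rV_cons0.
  by rewrite !rV_consS /rV_coord !mxE /rV_coord.
under eq_integral => x _.
  under eq_integral => v _ do rewrite E.
  rewrite (IH b.2 (fun v => F (rV_cons ((x + b.1)%R, v)))) //; last first.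
    exact: (measurableT_comp mFc (pair1_measurable (x + b.1)%R)).
  over.
apply: (@integral_shift b.1 (fun x => \int[lebesgue_rV R n]_v F (rV_cons (x, v)))).
  exact: (measurable_fun_fubini_tonelli_F (F \o @rV_cons R n) mFc (fun z => F0 _)).
by move=> x; apply: integral_ge0 => v _; exact: F0.
Qed.

End transl.

(** * Averages of translates of a nonnegative function *)

Section posop.
Variable R : realType.
Local Open Scope ereal_scope.
Local Notation TR := (measurableTypeR R).

Definition nnm d (T : measurableType d) (g : T -> \bar R) :=
  measurable_fun setT g /\ forall x, 0 <= g x.

Definition op n (m : {measure set TR -> \bar R}) (phi : R -> 'rV[R]_n)
  (g : 'rV[R]_n -> \bar R) (x : 'rV[R]_n) : \bar R := \int[m]_s g (x - phi s)%R.

Section op_lemmas.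
Variables (n : nat) (m m' : {sigma_finite_measure set TR -> \bar R}).
Variables (phi phi' : TR -> 'rV[R]_n).
Hypotheses (mphi : measurable_fun setT phi) (mphi' : measurable_fun setT phi').
Implicit Types g h : 'rV[R]_n -> \bar R.

Lemma nnm_subp g : nnm g -> nnm (fun z : 'rV[R]_n * TR => g (z.1 - phi z.2)%R).
Proof.
move=> [mg g0]; split => // ; apply: (measurableT_comp mg).
by apply: measurable_rV_sub => //; exact: measurableT_comp.
Qed.

Lemma nnm_comp d (T : measurableType d) (f : T -> 'rV[R]_n) g :
  measurable_fun setT f -> nnm g -> nnm (g \o f).
Proof. by move=> mf [mg g0]; split => [|x]; [exact: measurableT_comp|exact: g0]. Qed.

Lemma nnm_sub1 g x : nnm g -> nnm (fun s : TR => g (x - phi s)%R).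
Proof.
move=> [mg g0]; split => //; apply: (measurableT_comp mg).
exact: measurable_rV_sub.
Qed.

Lemma nnm_op g : nnm g -> nnm (op m phi g).
Proof.
move=> ng; split; last by move=> x; apply: integral_ge0 => s _; case: ng.
have [mF F0] := nnm_subp ng.
exact: (measurable_fun_fubini_tonelli_F _ mF F0).
Qed.

Lemma op_le g h : nnm g -> nnm h -> (forall x, g x <= h x) ->
  forall x, op m phi g x <= op m phi h x.
Proof.
move=> ng nh gh x; have [? ?] := nnm_sub1 x ng; have [? ?] := nnm_sub1 x nh.
by apply: ge0_le_integral.
Qed.

Lemma op_comm g : nnm g -> op m phi (op m' phi' g) =1 op m' phi' (op m phi g).
Proof.
move=> ng x; rewrite /op.
have mf : measurable_fun setT (fun z : TR * TR => (x - phi z.1 - phi' z.2)%R).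
  by repeat apply: measurable_rV_sub => //; exact: measurableT_comp.
have [mF F0] := nnm_comp mf ng.
rewrite (fubini_tonelli _ mF F0); apply: eq_integral => s _; apply: eq_integral => t _.
by rewrite /= addrAC.
Qed.

Lemma op_shift g a x : op m phi (fun x => g (x + a)%R) x = op m phi g (x + a)%R.
Proof. by apply: eq_integral => s _; rewrite addrAC. Qed.

Lemma opD g h : nnm g -> nnm h ->
  forall x, op m phi (fun x => g x + h x) x = op m phi g x + op m phi h x.
Proof.
move=> ng nh x; have [? ?] := nnm_sub1 x ng; have [? ?] := nnm_sub1 x nh.
by rewrite /op ge0_integralD.
Qed.

Lemma opZ g (k : R) : nnm g -> (0 <= k)%R ->
  forall x, op m phi (fun x => k%:E * g x) x = k%:E * op m phi g x.
Proof.
by move=> ng k0 x; have [? ?] := nnm_sub1 x ng; rewrite /op ge0_integralZl_EFin.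
Qed.

Lemma integral_op g : nnm g ->
  \int[lebesgue_rV R n]_x op m phi g x = m setT * \int[lebesgue_rV R n]_x g x.
Proof.
move=> ng; have [mF F0] := nnm_subp ng; have [mg g0] := ng.
rewrite /op (fubini_tonelli (m1 := lebesgue_rV R n) _ mF F0) /=.
under eq_integral => s _.
  rewrite (@integral_rV_shift _ _ (- phi s)%R) //.
  over.
by rewrite /= integral_cst // muleC.
Qed.

End op_lemmas.
End posop.

(** * Iterated averages as integrals over [R^n] *)

Section chain.
Variable R : realType.
Local Open Scope ereal_scope.
Local Notation TR := (measurableTypeR R).
Local Notation leb := (@lebesgue_measure R).

(** The weight covers both uses: the constant 1 gives integrals over full lines, and [I11] gives
    unnormalized averages along parabolas. *)
Definition wop n (w : R -> R) (phi : R -> 'rV[R]_n) (g : 'rV[R]_n -> \bar R)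
  (x : 'rV[R]_n) : \bar R := \int[leb]_s ((w s)%:E * g (x - phi s)%R).

Lemma nnm_foldr n (I : Type) (F : I -> ('rV[R]_n -> \bar R) -> 'rV[R]_n -> \bar R)
  (s : seq I) g : (forall i g, nnm g -> nnm (F i g)) -> nnm g ->
  nnm (foldr F g s).
Proof. by move=> HF ng; elim: s => //= i s IH; exact: HF. Qed.

Lemma measurable_rV_sum d (T : measurableType d) n (I : Type) (s : seq I)
    (f : I -> T -> 'rV[R]_n) : (forall i, measurable_fun setT (f i)) ->
  measurable_fun setT (fun x => \sum_(i <- s) f i x)%R.
Proof.
move=> mf; elim: s => [|i s IH].
  rewrite (_ : (fun _ => _) = cst 0%R) //.
  by apply/funext => x; rewrite big_nil.
rewrite (_ : (fun _ => _) = (fun x => f i x + \sum_(i <- s) f i x)%R).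
  exact: measurable_rV_add.
by apply/funext => x; rewrite big_cons.
Qed.

(** Tonelli, one coordinate at a time. A surface parametrized by a sum of curves in separate
    variables thus acts as a composition of one-dimensional averages. *)
Lemma integral_rV_chain n d (w : TR -> R) (phi : 'I_n -> TR -> 'rV[R]_d)
    (g : 'rV[R]_d -> \bar R) (x : 'rV[R]_d) :
  measurable_fun setT w -> (forall s, 0 <= w s)%R ->
  (forall i, measurable_fun setT (phi i)) -> nnm g ->
  \int[lebesgue_rV R n]_y
    ((\prod_i w (y ord0 i))%:E * g (x - \sum_i phi i (y ord0 i))%R) =
  foldr (fun i => wop w (phi i)) g (enum 'I_n) x.
Proof.
move=> mw w0; elim: n phi x => [|n IH] phi x mphi ng.
  rewrite enum_ord0 /=.
  transitivity (\int[lebesgue_rV R 0]_y g x).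
    by apply: eq_integral => y _; rewrite !big_ord0 mul1e subr0.
  rewrite integral_cst// -[RHS]mule1; congr (_ * _).
  by rewrite /lebesgue_rV/= diracT.
have mc i : measurable_fun setT (fun y : 'rV[R]_n.+1 => y ord0 i : TR).
  exact: measurable_rV_coord.
pose G (y : 'rV[R]_n.+1) : \bar R :=
  (\prod_i w (y ord0 i))%:E * g (x - \sum_i phi i (y ord0 i))%R.
have nG : nnm G.
  split; last first.
    by move=> y; rewrite mule_ge0 ?lee_fin ?prodr_ge0//; case: ng.
  apply: emeasurable_funM; first apply/measurable_EFinP.
    apply: measurable_prod => i _; exact: (measurableT_comp mw (mc i)).
  apply: (measurableT_comp ng.1); apply: measurable_rV_sub => //.
  by apply: measurable_rV_sum => i; exact: (measurableT_comp (mphi i) (mc i)).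
rewrite (@integral_rV_cons _ _ G nG.1 nG.2) enum_ordSl /= /wop.
apply: eq_integral => s _.
rewrite foldr_map -(IH (fun i => phi (lift ord0 i))) // -ge0_integralZl_EFin //.
- apply: eq_integral => y _.
  have c0 : rV_cons (s, y) ord0 ord0 = s := rV_cons0 (s, y).
  have cS j : rV_cons (s, y) ord0 (lift ord0 j) = y ord0 j := rV_consS (s, y) j.
  rewrite /G !big_ord_recl c0 EFinM muleA opprD addrA.
  rewrite (eq_bigr (fun i => w (y ord0 i))) => [|i _]; last by rewrite cS.
  by rewrite (eq_bigr (fun i => phi (lift ord0 i) (y ord0 i))) // => i _; rewrite cS.
- by move=> y _; rewrite mule_ge0 ?lee_fin ?prodr_ge0//; case: ng.
- have mc' i : measurable_fun setT (fun y : 'rV[R]_n => y ord0 i : TR).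
    exact: measurable_rV_coord.
  apply: emeasurable_funM; first apply/measurable_EFinP.
    apply: measurable_prod => i _; exact: (measurableT_comp mw (mc' i)).
  apply: (measurableT_comp ng.1); apply: measurable_rV_sub => //.
  by apply: measurable_rV_sum => i; exact: (measurableT_comp (mphi _) (mc' i)).
Qed.
End chain.

Opaque lebesgue_rV.

(** * Linear changes of variables, up to a constant *)

Section linear_change.
Variable R : realType.
Local Open Scope ereal_scope.
Local Notation TR := (measurableTypeR R).

Lemma nnm_le_integral d (T : measurableType d) (mu : {measure set T -> \bar R})
    (g h : T -> \bar R) : nnm g -> nnm h -> (forall x, g x <= h x) ->
  \int[mu]_x g x <= \int[mu]_x h x.
Proof.
by move=> [mg g0] [mh h0] gh; apply: ge0_le_integral.
Qed.

Definition cube n (r : R) : set 'rV[R]_n := [set v | forall i, (`|v ord0 i| <= r)%R].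

Lemma measurable_cube n r : measurable (@cube n r).
Proof.
have -> : cube r = \bigcap_(i in [set: 'I_n]) (rV_coord i @^-1` [set` `[(- r)%R, r]]).
  apply/seteqP; split=> v /= h i; first by move=> _; rewrite /= in_itv /= -ler_norml; exact: h.
  by have := h i I; rewrite /= in_itv /= -ler_norml.
apply: fin_bigcap_measurable => // i _.
by rewrite -[X in measurable X]setTI; exact: measurable_rV_coord.
Qed.

Lemma lebesgue_rV_cube n (r : R) : (0 <= r)%R ->
  lebesgue_rV R n (cube r) = ((2 * r) ^+ n)%:E.
Proof.
move=> r0; have hr (i : 'I_n) : (- r <= r)%R by rewrite ge0_cp.
have := @lebesgue_rV_box R n (fun=> - r)%R (fun=> r) hr.
rewrite prodr_const card_ord opprK -mulr2n mulr_natl.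
move=> <-; congr (lebesgue_rV R n _).
by apply/seteqP; split=> v /= h i; have := h i; rewrite ler_norml.
Qed.

Lemma measurable_mulmx n d (W : 'M[R]_(n, d)) :
  measurable_fun setT (fun u : 'rV[R]_n => u *m W : 'rV[R]_d).
Proof.
rewrite (_ : (fun _ => _) = (fun u : 'rV[R]_n => \sum_i u ord0 i *: row i W)%R).
  apply: measurable_rV_sum => i; apply: measurable_rV_scale => //.
  exact: measurable_rV_coord.
by apply/funext => u; rewrite mulmx_sum_row.
Qed.

(* Only an inequality with some constant is needed, and it follows by testing
   against the indicator of the unit cube, without the change of variables formula. *)
Lemma linear_change_le n (W : 'M[R]_n) : W \in unitmx ->
  exists2 kappa : R, (0 <= kappa)%R & forall g : 'rV[R]_n -> \bar R, nnm g -> forall x,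
    \int[lebesgue_rV R n]_u g (x - u *m W)%R <=
    kappa%:E * \int[lebesgue_rV R n]_u g u.
Proof.
move=> uW.
set lam := lebesgue_rV R n.
pose r := (\sum_i \sum_j `|invmx W i j|)%R.
have r0 : (0 <= r)%R by rewrite sumr_ge0// => i _; rewrite sumr_ge0.
have mW := measurable_mulmx W.
have mW2 : measurable_fun setT (fun z : 'rV[R]_n * 'rV[R]_n => z.2 *m W).
  exact: (measurableT_comp mW).
have Wr u : cube 1 (u *m W) -> cube r u.
  move=> h i; rewrite -(mulmxK uW u) mxE; apply: le_trans (ler_norm_sum _ _ _) _.
  apply: (@le_trans _ _ (\sum_j `|invmx W j i|)%R).
    apply: ler_sum => j _; rewrite normrM -[leRHS]mul1r ler_wpM2r //; exact: h.
  apply: ler_sum => j _; rewrite (bigD1 i) //= lerDl sumr_ge0 //.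
exists (((2 * r) ^+ n) / 2 ^+ n)%R; first by rewrite divr_ge0 ?exprn_ge0 ?mulr_ge0.
move=> g ng x; have [mg g0] := ng.
pose B (y : 'rV[R]_n) : \bar R := (\1_(cube 1) y)%:E.
have mB : measurable_fun setT B.
  by apply/measurable_EFinP; apply: measurable_indic; exact: measurable_cube.
have B0 y : 0 <= B y by rewrite lee_fin.
have mBW y : measurable_fun setT (fun u => B (y + u *m W)%R).
  by apply: (measurableT_comp mB); apply: measurable_rV_add.
have BW y : \int[lam]_u B (y + u *m W)%R <= ((2 * r) ^+ n)%:E.
  have -> : \int[lam]_u B (y + u *m W)%R = \int[lam]_u B (u *m W)%R.
    apply/esym/(etrans (esym (@integral_rV_shift _ _ (y *m invmx W)
      (fun u => B (u *m W)%R) (measurableT_comp mB mW) (fun u => B0 _)))).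
    by apply: eq_integral => u _; congr B; rewrite mulmxDl mulmxKV // addrC.
  rewrite -lebesgue_rV_cube //.
  apply: (@le_trans _ _ (\int[lam]_u (\1_(cube r) u)%:E)); last first.
    rewrite integral_indic //; [by rewrite setIT | exact: measurable_cube].
  apply: nnm_le_integral.
  - by split => [|u]; [exact: (measurableT_comp mB mW)|exact: B0].
  - split => [|u]; last by rewrite lee_fin.
    by apply/measurable_EFinP; apply: measurable_indic; exact: measurable_cube.
  move=> u; rewrite lee_fin !indicE.
  case: (boolP (_ \in cube 1)) => // /set_mem /Wr h.
  by rewrite mem_set.
pose N := \int[lam]_u g (x - u *m W)%R.
have mgW y : measurable_fun setT (fun u => g (y - u *m W)%R).
  by apply: (measurableT_comp mg); apply: measurable_rV_sub.
have NE y : \int[lam]_u g (y - u *m W)%R = N.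
  apply/esym/(etrans (esym (@integral_rV_shift _ _ ((x - y) *m invmx W)
    (fun u => g (x - u *m W)%R) (mgW x) (fun u => g0 _)))).
  apply/esym; apply: eq_integral => u _; congr g.
  by rewrite mulmxDl mulmxKV // opprD opprB [RHS]addrCA (addrCA x) subrr addr0 addrC.
have lB : \int[lam]_y B y = (2 ^+ n)%:E.
  by rewrite integral_indic //; [have := lebesgue_rV_cube n (@ler01 R); rewrite mulr1 setIT => <-//| exact: measurable_cube].
(* The double integral of [B y * g (y - u *m W)] is computed in both orders. The integral in [u] of
   the second factor is [N] for every [y]; after shifting [y], the integral of [B (y + u *m W)] in
   [u] is at most the volume of [cube r]. *)
have step1 : \int[lam]_y \int[lam]_u (B y * g (y - u *m W)%R) = N * (2 ^+ n)%:E.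
  rewrite -lB -ge0_integralZl //; last by apply: integral_ge0.
  apply: eq_integral => y _; rewrite ge0_integralZl //.
  by rewrite NE muleC.
have step2 : \int[lam]_y \int[lam]_u (B y * g (y - u *m W)%R) =
   \int[lam]_y \int[lam]_u (B (y + u *m W)%R * g y).
  rewrite (fubini_tonelli (m1 := lam) (m2 := lam)
    (fun z => B z.1 * g (z.1 - z.2 *m W)%R)) /=; last 2 first.
  - apply: emeasurable_funM; first exact: measurableT_comp.
    apply: (measurableT_comp mg); apply: measurable_rV_sub => //.
  - by move=> z; rewrite mule_ge0.
  rewrite [RHS](fubini_tonelli (m1 := lam) (m2 := lam)
    (fun z => B (z.1 + z.2 *m W)%R * g z.1)) /=; last 2 first.
  - apply: emeasurable_funM; last exact: measurableT_comp.
    apply: (measurableT_comp mB); apply: measurable_rV_add => //.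
  - by move=> z; rewrite mule_ge0.
  apply: eq_integral => u _.
  rewrite -[LHS](@integral_rV_shift _ _ (u *m W)) //.
  - by apply: eq_integral => y _; rewrite addrK.
  - by apply: emeasurable_funM => //; exact: (@measurable_shift_rV R n (- (u *m W))%R _ _ g mg).
  - by move=> y; rewrite mule_ge0.
suff H : N * (2 ^+ n)%:E <= ((2 * r) ^+ n)%:E * \int[lam]_u g u.
  by rewrite EFinM muleAC lee_pdivlMr ?exprn_gt0.
rewrite -step1 step2.
have rn0 : (0 <= (2 * r) ^+ n)%R by rewrite exprn_ge0 ?mulr_ge0.
apply: (@le_trans _ _ (\int[lam]_u (((2 * r) ^+ n)%:E * g u))); last first.
  by rewrite (ge0_integralZl_EFin lam measurableT (fun u _ => g0 u) mg rn0).

have nBg : nnm (fun z : 'rV[R]_n * 'rV[R]_n => B (z.1 + z.2 *m W)%R * g z.1).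
  split => [|z]; last by apply: mule_ge0.
  apply: emeasurable_funM; last exact: (measurableT_comp mg).
  by apply: (measurableT_comp mB); apply: measurable_rV_add.
apply: nnm_le_integral.
- split => [|y]; last by apply: integral_ge0 => u _; exact: mule_ge0.
  exact: (measurable_fun_fubini_tonelli_F _ nBg.1 nBg.2).
- by split => [|u]; [exact: measurable_funeM|exact: mule_ge0].
- move=> y; rewrite (ge0_integralZr lam measurableT (mBW y) (fun u _ => B0 _) (g0 y)).
  exact: lee_wpmul2r.
Qed.
End linear_change.

(** * Reordering compositions of commuting operators *)

Section foldr_comm.
Variables (A I : Type) (P : A -> Prop).

(** [P] is the class on which commutation is known, [nnm] in the applications, so its preservation
    is carried along. *)
Lemma foldr_commute (T : I -> A -> A) (H : A -> A) s g :
  (forall i g, P g -> P (T i g)) -> P g ->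
  (forall i g, P g -> H (T i g) = T i (H g)) -> H (foldr T g s) = foldr T (H g) s.
Proof.
move=> PT Pg HT; elim: s => //= i s IH.
by rewrite HT ?IH //; elim: s {IH} => //= *; exact: PT.
Qed.

Lemma foldr_comp_commute (T F : I -> A -> A) s g :
  (forall i g, P g -> P (T i g)) -> (forall i g, P g -> P (F i g)) -> P g ->
  (forall i j g, P g -> F i (T j g) = T j (F i g)) ->
  foldr (fun i => T i \o F i) g s = foldr T (foldr F g s) s.
Proof.
move=> PT PF Pg FT; elim: s => //= i s ->.
rewrite (@foldr_commute T (F i)) //; first by elim: s => //= *; exact: PF.
by move=> j h Ph; exact: FT.
Qed.

Lemma foldr_filter (p : pred I) (F : I -> A -> A) s g :
  (forall i g, P g -> P (F i g)) -> P g ->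
  (forall i j g, P g -> F i (F j g) = F j (F i g)) ->
  foldr F g s = foldr F (foldr F g [seq i <- s | p i]) [seq i <- s | ~~ p i].
Proof.
move=> PF Pg FF; elim: s => //= i s ->.
case: (p i) => //=.
rewrite (@foldr_commute F (F i)) //; first by elim: [seq i <- s | p i] => //= *; exact: PF.
by move=> j h Ph; exact: FF.
Qed.
End foldr_comm.

(** * Scaling on the line *)

Section scale.
Variable R : realType.
Local Open Scope ereal_scope.
Local Notation TR := (measurableTypeR R).
Local Notation leb := (@lebesgue_measure R).

Lemma integral_scale (v : R) (f : R -> \bar R) : (0 < v)%R -> measurable_fun setT f ->
  (forall x, 0 <= f x) ->
  \int[leb]_x f (v * x)%R = (v^-1)%:E * \int[leb]_x f x.
Proof.
move=> v0 mf f0.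
have mh : measurable_fun setT (fun x : TR => (v * x)%R : TR).
  exact: measurable_funM.
pose phi := HB.pack_for {mfun TR >-> TR}
   (fun x : TR => (v * x)%R : TR) (isMeasurableFun.Build _ _ _ _ _ mh).
pose vn : {nonneg R} := NngNum (ltW v0).
pose nu : {measure set TR -> \bar R} := pushforward leb phi.
pose mu : {measure set TR -> \bar R} := mscale vn (nu mh).
have E A : measurable A -> leb A = mu A.
  apply: lebesgue_measure_unique => /= _ [[x y]] _ <-.
  rewrite /mu /= /mscale /nu /= /pushforward.
  have -> : phi @^-1` [set` `]x, y]] = [set` `](v^-1 * x)%R, (v^-1 * y)%R]].
    apply/seteqP; split => z; rewrite /= !in_itv /= ltr_pdivrMl // ler_pdivlMl //.
  rewrite !lebesgue_measure_itv/= !lte_fin ltr_pM2l ?invr_gt0 //.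
  case: ifP => // _; last by rewrite mule0.
  by rewrite -EFinB -EFinM -mulrBr mulrA divff ?gt_eqF // mul1r.
have -> : \int[leb]_x f x = \int[mu]_x f x.
  by apply: eq_measure_integral => A mA _; exact: E.
rewrite /mu ge0_integral_mscale //.
rewrite [X in _ = _ * (_ * X)](ge0_integral_pushforward mh) //=.
by rewrite muleA -EFinM mulVf ?gt_eqF // mul1e.
Qed.

Lemma integral_uniform_le (a b : R) (ab : (a < b)%R) (f : R -> \bar R) :
  nnm (f : TR -> \bar R) -> \int[uniform_prob ab]_x f x <= ((b - a)^-1)%:E * \int[leb]_x f x.
Proof.
move=> [mf f0]; rewrite (integral_uniform ab mf f0).
rewrite lee_wpmul2l ?lee_fin ?invr_ge0 ?subr_ge0 ?(ltW ab) //.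
by apply: ge0_subset_integral => //.
Qed.
End scale.

(** * Averages along parabolas and vertical segments *)

Section quad.
Variables (R : realType) (k l : nat) (c : 'M[R]_(k, l)).
Local Notation TR := (measurableTypeR R).
Local Notation leb := (@lebesgue_measure R).
Local Notation X := 'rV[R]_(k + l).
Definition hvec (i : 'I_k) : X := row_mx (delta_mx 0 i) 0.
Definition vvec (i : 'I_k) : X := row_mx 0 (row i c).
Local Open Scope ereal_scope.

Lemma ltN11 : (-1 < 1 :> R)%R. Proof. lra. Qed.
Local Notation mT := (uniform_prob ltN11).
Local Notation mE := (uniform_prob (@ltr01 R)).

Definition parab (i : 'I_k) (t : R) : X := (t *: hvec i + t ^+ 2 *: vvec i)%R.
Definition vseg (i : 'I_k) (v : R) (u : R) : X := ((v * u) *: vvec i)%R.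

Lemma measurable_line (w : X) : measurable_fun setT (fun r : TR => r *: w)%R.
Proof. exact: measurable_rV_scale. Qed.

Lemma measurable_parab i : measurable_fun setT (parab i : TR -> _).
Proof.
apply: measurable_rV_add; first exact: measurable_line.
by apply: measurable_rV_scale => //; exact: measurable_funX.
Qed.

Lemma measurable_vseg i v : measurable_fun setT (vseg i v : TR -> _).
Proof. by apply: measurable_rV_scale => //; exact: measurable_funM. Qed.

Definition Tp i := op mT (parab i).
Definition Ep i v := op mE (vseg i v).
Definition Lp (w : X) := op leb (fun r => r *: w)%R.
(** The positive majorant of a difference of two vertical averages: dropping the sign makes order
    arguments available. *)
Definition Fp (v v' : 'I_k -> R) i (g : X -> \bar R) : X -> \bar R :=
  fun x => Ep i (v i) g x + Ep i (v' i) g x.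

Lemma nnmD d (T : measurableType d) (g h : T -> \bar R) : nnm g -> nnm h ->
  nnm (fun x => g x + h x).
Proof.
move=> [mg g0] [mh h0]; split => [|x]; last exact: adde_ge0.
exact: emeasurable_funD.
Qed.

Lemma nnmZ d (T : measurableType d) (a : R) (g : T -> \bar R) : (0 <= a)%R -> nnm g ->
  nnm (fun x => a%:E * g x).
Proof.
move=> a0 [mg g0]; split => [|x]; last exact: mule_ge0.
exact: measurable_funeM.
Qed.

Lemma nnm_Tp i g : nnm g -> nnm (Tp i g).
Proof. exact: (nnm_op mT (@measurable_parab i)). Qed.
Lemma nnm_Ep i v g : nnm g -> nnm (Ep i v g).
Proof. exact: (nnm_op mE (@measurable_vseg i v)). Qed.
Lemma nnm_Lp w g : nnm g -> nnm (Lp w g).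
Proof. exact: (nnm_op leb (@measurable_line w)). Qed.
Lemma nnm_Fp v v' i g : nnm g -> nnm (Fp v v' i g).
Proof. by move=> ng; apply: nnmD; exact: nnm_Ep. Qed.

Lemma Fp_Tp v v' i j g : nnm g -> Fp v v' i (Tp j g) = Tp j (Fp v v' i g).
Proof.
move=> ng; apply/funext => x; rewrite /Fp.
rewrite /Tp (opD mT (@measurable_parab j)); [|exact: nnm_Ep|exact: nnm_Ep].
by rewrite /Ep !(op_comm _ _ (@measurable_vseg _ _) (@measurable_parab _) ng).
Qed.

Lemma Fp_Fp v v' i j g : nnm g -> Fp v v' i (Fp v v' j g) = Fp v v' j (Fp v v' i g).
Proof.
move=> ng; apply/funext => x; rewrite /Fp.
have C i0 j0 a b : Ep i0 a (Ep j0 b g) x = Ep j0 b (Ep i0 a g) x.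
  exact: (op_comm mE mE (@measurable_vseg i0 a) (@measurable_vseg j0 b) ng).
have D i0 j0 a : Ep i0 a (fun x => Ep j0 (v j0) g x + Ep j0 (v' j0) g x) x =
    Ep j0 (v j0) (Ep i0 a g) x + Ep j0 (v' j0) (Ep i0 a g) x.
  exact: (etrans (opD mE (@measurable_vseg i0 a) (nnm_Ep j0 (v j0) ng)
    (nnm_Ep j0 (v' j0) ng) x) (f_equal2 _ (C _ _ _ _) (C _ _ _ _))).
rewrite (D i j) (D i j) (D j i) (D j i) (C j i) (C j i) (C j i) (C j i).
exact: addeACA.
Qed.

(** The uniform density on a segment of parameter length [v] is at most [v^-1] times the density of
    the whole line. This is the only source of the growth [2^j] in the [L^oo] bounds. *)
Lemma Ep_le i v g : (0 < v)%R -> nnm g -> forall x,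
  Ep i v g x <= (v^-1)%:E * Lp (vvec i) g x.
Proof.
move=> v0 ng x; rewrite /Ep /op.
have [mg g0] := nnm_sub1 (@measurable_line (vvec i)) x ng.
rewrite -(integral_scale v0 mg g0).
have n1 : nnm (fun s : TR => g (x - vseg i v s)%R).
  exact: (nnm_sub1 (@measurable_vseg i v)).
by apply: le_trans (integral_uniform_le (@ltr01 R) n1) _; rewrite subr0 invr1 mul1e.
Qed.

Definition vinv (g : X -> \bar R) := forall x (w : 'rV[R]_l), g (x - row_mx 0 w)%R = g x.

Lemma vinv_vvec g : vinv g -> forall x i a, g (x - a *: vvec i)%R = g x.
Proof. by move=> ig x i a; rewrite -[RHS](ig x (a *: row i c)%R) scale_row_mx scaler0. Qed.

Lemma integral_probc d (T : measurableType d) (P : probability T R) (a : \bar R) : 0 <= a ->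
  \int[P]_x a = a.
Proof. by move=> a0; rewrite -[RHS]mule1 -(@probability_setT _ _ _ P); exact: integral_cst. Qed.

Lemma Ep_vinv i v g : nnm g -> vinv g -> forall x, Ep i v g x = g x.
Proof.
move=> [mg g0] ig x; rewrite /Ep /op /vseg.
under eq_integral => s _ do rewrite (vinv_vvec ig).
by rewrite integral_probc.
Qed.

Lemma vinv_op (m : {sigma_finite_measure set TR -> \bar R}) phi g : vinv g -> vinv (op m phi g).
Proof.
by move=> ig x w; rewrite -op_shift; apply: eq_integral => s _; rewrite ig.
Qed.

Lemma Fp_vinv v v' i g : nnm g -> vinv g -> forall x, Fp v v' i g x = 2%:E * g x.
Proof.
move=> ng ig x; rewrite /Fp !Ep_vinv // -[in LHS](mul1e (g x)) -ge0_muleDl //.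
Qed.

Lemma foldr_Fp_vinv v v' s g : nnm g -> vinv g -> 
  foldr (Fp v v') g s = (fun x => (2 ^+ size s)%:E * g x).
Proof.
move=> ng ig; elim: s => [|i s IH] /=.
  by apply/funext => x; rewrite mul1e.
apply/funext => x; rewrite IH Fp_vinv.
- by rewrite muleA -EFinM -exprS.
- exact: nnmZ (exprn_ge0 _ _) ng.
- by move=> y w; rewrite ig.
Qed.

(** A vertically invariant function does not see the component [t ^+ 2] of the parabola, so only a
    horizontal average over [[-1, 1]] remains; its density [1/2] is at most 1. *)
Lemma Tp_vinv_le i g : nnm g -> vinv g -> forall x, Tp i g x <= Lp (hvec i) g x.
Proof.
move=> ng ig x; rewrite /Tp /op.
under eq_integral => s _ do rewrite opprD addrA (vinv_vvec ig).
have nl := nnm_sub1 (@measurable_line (hvec i)) x ng.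
apply: le_trans (integral_uniform_le ltN11 nl) _.
rewrite -[leRHS]mul1e; apply: lee_wpmul2r; first by apply: integral_ge0 => s _; exact: nl.2.
by rewrite lee_fin opprK invf_le1 // lerDl.
Qed.

Lemma foldr_Tp_vinv_le s g : nnm g -> vinv g -> forall x,
  foldr Tp g s x <= foldr (fun i => Lp (hvec i)) g s x.
Proof.
move=> ng ig; elim: s => [//|i s IH] x /=.
have nT : nnm (foldr Tp g s) by apply: nnm_foldr => // *; exact: nnm_Tp.
have iT : vinv (foldr Tp g s).
  by elim: (s) => //= j s' IHs; exact: vinv_op.
apply: (le_trans (Tp_vinv_le i nT iT x)).
apply: op_le => //; first exact: measurable_line.
by apply: nnm_foldr => // *; exact: nnm_Lp.
Qed.

Lemma Tp_le i g h : nnm g -> nnm h -> (forall x, g x <= h x) ->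
  forall x, Tp i g x <= Tp i h x.
Proof. exact: op_le (@measurable_parab i) _ _. Qed.

Lemma Fp_le v v' i g h : nnm g -> nnm h -> (forall x, g x <= h x) ->
  forall x, Fp v v' i g x <= Fp v v' i h x.
Proof.
move=> ng nh gh x; rewrite /Fp; apply: leeD; apply: op_le => //; exact: measurable_vseg.
Qed.

Lemma Fp_leL v v' i g (a : R) : (0 < a)%R -> (a <= v i)%R -> (a <= v' i)%R -> nnm g ->
  forall x, Fp v v' i g x <= (2 / a)%:E * Lp (vvec i) g x.
Proof.
move=> a0 av av' ng x.
have L0 := (nnm_Lp (vvec i) ng).2 x.
have H b : (a <= b)%R -> Ep i b g x <= (a^-1)%:E * Lp (vvec i) g x.
  move=> ab; apply: le_trans (Ep_le i (lt_le_trans a0 ab) ng x) _.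
  by rewrite lee_wpmul2r // lee_fin lef_pV2 // posrE // (lt_le_trans a0).
rewrite mulr_natl mulr2n EFinD ge0_muleDl ?lee_fin ?invr_ge0 ?(ltW a0) //.
by apply: leeD; exact: H.
Qed.

Lemma foldr_Fp_leL (J : Type) (f : J -> 'I_k) v v' (a : 'I_k -> R) (s : seq J) g :
  (forall j, 0 < a (f j))%R -> (forall j, a (f j) <= v (f j))%R ->
  (forall j, a (f j) <= v' (f j))%R -> nnm g -> forall x,
  foldr (Fp v v') g (map f s) x <=
  (\prod_(j <- s) (2 / a (f j)))%:E * foldr (fun j => Lp (vvec (f j))) g s x.
Proof.
move=> a0 av av' ng; elim: s => [|j s IH] x /=.
  by rewrite big_nil mul1e.
have n1 : nnm (foldr (Fp v v') g (map f s)) by apply: nnm_foldr => // *; exact: nnm_Fp.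
have n2 : nnm (foldr (fun j => Lp (vvec (f j))) g s).
  by apply: nnm_foldr => // *; exact: nnm_Lp.
have p0 : (0 <= \prod_(j <- s) (2 / a (f j)))%R.
  by apply: prodr_ge0 => i _; rewrite divr_ge0 // ltW.
apply: (le_trans (Fp_le v v' (f j) n1 (nnmZ p0 n2) IH x)).
apply: (le_trans (Fp_leL (a0 j) (av j) (av' j) (nnmZ p0 n2) x)).
rewrite /Lp opZ //; last exact: measurable_line.
by rewrite big_cons EFinM muleA.
Qed.

End quad.

(** * The bound from [L^1] to [L^oo] *)

Lemma enum_ord_split k l : enum 'I_(k + l) =
  map (@lshift k l) (enum 'I_k) ++ map (@rshift k l) (enum 'I_l).
Proof.
apply: (inj_map val_inj); apply: (etrans (val_enum_ord (k + l))).
rewrite iotaD add0n map_cat -(map_comp val (@lshift k l)) -(map_comp val (@rshift k l)).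
congr (_ ++ _); first by rewrite -(val_enum_ord k); exact: eq_map.
transitivity (map (addn k) (map val (enum 'I_l))).
  by rewrite val_enum_ord -iotaDl addn0.
by rewrite -map_comp.
Qed.

(** Both lists are strictly increasing with the same members. This identifies the selected factors
    of the full chain with a chain over ['I_l]. *)
Lemma filter_codom_homo k l (s : 'I_l -> 'I_k) : {homo s : i j / (i < j)%N} ->
  [seq i <- enum 'I_k | i \in codom s] = map s (enum 'I_l).
Proof.
move=> hs.
have so n : sorted (fun i j : 'I_n => (i < j)%N) (enum 'I_n).
  have : sorted ltn (map val (enum 'I_n)) by rewrite val_enum_ord iota_ltn_sorted.
  by rewrite sorted_map.
apply: (@irr_sorted_eq _ (fun i j : 'I_k => (i < j)%N)).
- by move=> x y z; exact: ltn_trans.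
- by move=> x; rewrite /= ltnn.
- apply: sorted_filter; first by move=> x y z; exact: ltn_trans.
  exact: so.
- rewrite sorted_map; apply: (@sub_sorted _ (fun i j : 'I_l => (i < j)%N)).
    by move=> i j; exact: hs.
  exact: so.
- move=> i; rewrite mem_filter mem_enum andbT.
  apply/codomP/mapP => [[j ->]|[j _ ->]]; exists j => //.
  by rewrite mem_enum.
Qed.

Section sup.
Variables (R : realType) (k l : nat) (c : 'M[R]_(k, l)).
Local Open Scope ereal_scope.
Local Notation TR := (measurableTypeR R).
Local Notation leb := (@lebesgue_measure R).
Local Notation X := 'rV[R]_(k + l).

Lemma wop1 n (phi : TR -> 'rV[R]_n) : wop (fun=> 1)%R phi = op leb phi.
Proof.
by apply/funext => g; apply/funext => x; apply: eq_integral => s _; rewrite mul1e.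
Qed.

Lemma chain_lines n d (f : 'I_n -> 'rV[R]_d) (g : 'rV[R]_d -> \bar R) x : nnm g ->
  foldr (fun i => op leb (fun r => r *: f i)%R) g (enum 'I_n) x =
  \int[lebesgue_rV R n]_u g (x - \sum_i u ord0 i *: f i)%R.
Proof.
move=> ng.
rewrite [RHS](_ : _ = \int[lebesgue_rV R n]_u
   ((\prod_(i < n) (fun=> 1%R) (u ord0 i))%R%:E * g (x - \sum_i u ord0 i *: f i)%R)); last first.
  by apply: eq_integral => u _; rewrite prodr_const expr1n mul1e.
rewrite (@integral_rV_chain _ _ _ (fun=> 1%R) (fun i (r : TR) => r *: f i)%R) //.
  by congr (_ x); elim: (enum 'I_n) => //= i s ->; rewrite wop1.
by move=> i; exact: measurable_rV_scale.
Qed.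

Definition sub_frame (s : 'I_l -> 'I_k) : 'M[R]_(k + l) := block_mx 1%:M 0 0 (rowsub s c).

Lemma sub_frame_unit s : rowsub s c \in unitmx -> sub_frame s \in unitmx.
Proof. by rewrite !unitmxE det_ublock det1 mul1r. Qed.

Lemma row_sub_frame_l s i : row (lshift l i) (sub_frame s) = hvec R l i.
Proof. by rewrite /sub_frame /block_mx rowKu row_row_mx row1 row0. Qed.

Lemma row_sub_frame_r s j : row (rshift k j) (sub_frame s) = vvec c (s j).
Proof. by rewrite /sub_frame /block_mx rowKd row_row_mx row0 row_rowsub. Qed.

Lemma chain_frame s g x : nnm g ->
  foldr (fun i => Lp (hvec R l i)) (foldr (fun j => Lp (vvec c (s j))) g (enum 'I_l))
    (enum 'I_k) x = \int[lebesgue_rV R (k + l)]_u g (x - u *m sub_frame s)%R.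
Proof.
move=> ng.
transitivity (\int[lebesgue_rV R (k + l)]_u g (x - \sum_i u ord0 i *: row i (sub_frame s))%R).
  transitivity (foldr (fun i => op leb (fun r => r *: row i (sub_frame s))%R) g
    (enum 'I_(k + l)) x); last exact: chain_lines.
  have -> : (fun i => Lp (hvec R l i)) =
    (fun i => op leb (fun r => r *: row (lshift l i) (sub_frame s))%R).
    by apply/funext => i; rewrite row_sub_frame_l.
  have -> : (fun j => Lp (vvec c (s j))) =
    (fun j => op leb (fun r => r *: row (rshift k j) (sub_frame s))%R).
    by apply/funext => i; rewrite row_sub_frame_r.
  by rewrite enum_ord_split foldr_cat !foldr_map.
by apply: eq_integral => u _; rewrite mulmx_sum_row.
Qed.

(** The selected rows span the vertical space, so the chain integrates [g] over a whole vertical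
    fibre; a vertical translation by [w] is absorbed by shifting [u] by
    [w *m invmx (rowsub s c)]. *)
Lemma chain_vvec_vinv s g : rowsub s c \in unitmx -> nnm g ->
  vinv (foldr (fun j => Lp (vvec c (s j))) g (enum 'I_l)).
Proof.
move=> us ng x w; rewrite !chain_lines //.
have E (u : 'rV[R]_l) : (\sum_i u ord0 i *: vvec c (s i) = row_mx 0 (u *m rowsub s c) :> X)%R.
  rewrite mulmx_sum_row (eq_bigr (fun i => row_mx 0 (u ord0 i *: row i (rowsub s c)))).
    elim/big_rec2 : _ => [|i y z _ ->]; first by rewrite row_mx0.
    by rewrite add_row_mx addr0.
  by move=> i _; rewrite scale_row_mx scaler0 row_rowsub.
have mg : measurable_fun setT (fun u : 'rV[R]_l => g (x - \sum_i u ord0 i *: vvec c (s i))%R).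
  apply: (measurableT_comp ng.1); apply: measurable_rV_sub => //.
  apply: measurable_rV_sum => i; apply: measurable_rV_scale => //.
  exact: measurable_rV_coord.
apply/esym/(etrans (esym (@integral_rV_shift _ _ (w *m invmx (rowsub s c)) _ mg (fun=> ng.2 _)))).
apply: eq_integral => u _; congr g; rewrite !E mulmxDl mulmxKV //.
rewrite -[in LHS](addr0 (0 : 'rV[R]_k)%R) -add_row_mx opprD addrA addrAC; congr (_ + _)%R.
Qed.

(* The vertical averages over [codom s] are dominated by line integrals.  These
   produce a vertically invariant function, on which the other vertical averages
   are trivial and each [Tp c i] is dominated by a horizontal line integral; what
   remains is an integral over the frame [sub_frame s]. *)
Lemma sup_bound (s : 'I_l -> 'I_k) : {homo s : i j / (i < j)%N} ->
  rowsub s c \in unitmx ->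
  exists2 kappa : R, (0 <= kappa)%R & forall a v v' : 'I_k -> R,
    (forall j, 0 < a (s j))%R -> (forall j, a (s j) <= v (s j))%R ->
    (forall j, a (s j) <= v' (s j))%R -> forall g : X -> \bar R, nnm g -> forall x,
    foldr (fun i => Tp c i \o Fp c v v' i) g (enum 'I_k) x <=
    (kappa * \prod_j (a (s j))^-1)%:E * \int[lebesgue_rV R (k + l)]_u g u.
Proof.
move=> hs us; have [k0 k00 Hk] := linear_change_le (sub_frame_unit us).
(* [2 ^+ l] comes from the two averages in each selected factor, [2 ^+ k] bounds the factors 2 of
   the at most [k] remaining ones, and [k0] is the cost of changing to the frame. *)
exists (2 ^+ k * 2 ^+ l * k0)%R; first by rewrite !mulr_ge0 // exprn_ge0.
move=> a v v' a0 av av' g ng x.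
have nT i h : nnm h -> nnm (Tp c i h) by exact: nnm_Tp.
have nF i h : nnm h -> nnm (Fp c v v' i h) by exact: nnm_Fp.
rewrite (foldr_comp_commute _ nT nF ng) => [|i j h nh]; last exact: Fp_Tp.
rewrite (foldr_filter (mem (codom s)) _ nF ng) => [|i j h nh]; last exact: Fp_Fp.
rewrite filter_codom_homo //.
set G := foldr (fun j => Lp (vvec c (s j))) g (enum 'I_l).
have nG : nnm G by apply: nnm_foldr => // *; exact: nnm_Lp.
have iG : vinv G by exact: chain_vvec_vinv.
pose A := (\prod_j (2 / a (s j)))%R.
have A0 : (0 <= A)%R by apply: prodr_ge0 => j _; rewrite divr_ge0 // ltW.
set t := [seq i <- _ | _].
have st : (size t <= k)%N by rewrite size_filter -[leqRHS](size_enum_ord k) count_size.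
have A'0 : (0 <= A * 2 ^+ size t)%R by rewrite mulr_ge0 // exprn_ge0.
have nAG := nnmZ A0 nG.
have step1 y : foldr (Fp c v v') (foldr (Fp c v v') g (map s (enum 'I_l))) t y <=
   (A * 2 ^+ size t)%:E * G y.
  have H1 z : foldr (Fp c v v') g (map s (enum 'I_l)) z <= A%:E * G z.
    apply: le_trans (@foldr_Fp_leL R k l c 'I_l s v v' a (enum 'I_l) g a0 av av' ng z) _.
    by rewrite big_enum.
  have H2 : forall z, foldr (Fp c v v') (foldr (Fp c v v') g (map s (enum 'I_l))) t z <=
     foldr (Fp c v v') (fun z => A%:E * G z) t z.
    elim: (t) => //= i t' IH z; apply: Fp_le; try exact: IH.
      by apply: nnm_foldr => //; apply: nnm_foldr.
    by apply: nnm_foldr.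
  apply: le_trans (H2 y) _; rewrite foldr_Fp_vinv //.
    by rewrite muleA -EFinM mulrC.
  by move=> z w; rewrite iG.
have nA'G := nnmZ A'0 nG.
have step2 y : foldr (Tp c) (foldr (Fp c v v') (foldr (Fp c v v') g (map s (enum 'I_l))) t)
    (enum 'I_k) y <= foldr (Tp c) (fun z => (A * 2 ^+ size t)%:E * G z) (enum 'I_k) y.
  move: y; elim: (enum 'I_k) => //= i t' IH y; apply: Tp_le; try exact: IH.
    by do !apply: nnm_foldr => //.
  by apply: nnm_foldr.
apply: le_trans (step2 x) _.
apply: (@le_trans _ _ ((A * 2 ^+ size t)%:E * foldr (Tp c) G (enum 'I_k) x)).
  have H3 : foldr (Tp c) (fun z => (A * 2 ^+ size t)%:E * G z) (enum 'I_k) =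
    (fun z => (A * 2 ^+ size t)%:E * foldr (Tp c) G (enum 'I_k) z).
    elim: (enum 'I_k) => //= i t' ->; apply/funext => y.
    apply: opZ => //; first exact: measurable_parab.
    exact: nnm_foldr.
  by rewrite H3.
apply: (@le_trans _ _ ((A * 2 ^+ size t)%:E * (k0%:E * \int[lebesgue_rV R (k + l)]_u g u))).
  apply: lee_wpmul2l; first by rewrite lee_fin.
  apply: le_trans (foldr_Tp_vinv_le c _ nG iG x) _.
  by rewrite chain_frame //; exact: Hk.
rewrite muleA -EFinM; apply: lee_wpmul2r; first by apply: integral_ge0 => u _; exact: ng.2.
rewrite lee_fin /A big_split /= prodr_const card_ord.
set P := (\prod_j _)%R.
have P0 : (0 <= P)%R by apply: prodr_ge0 => j _; rewrite invr_ge0 ltW.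
rewrite [leRHS](_ : _ = (2 ^+ l * P * 2 ^+ k * k0)%R); last by ring.
by rewrite ler_wpM2r // ler_wpM2l ?mulr_ge0 ?exprn_ge0 // ler_weXn2l // ler1n.
Qed.

End sup.

(** * The same averages on bounded real functions *)

Section bounded_prob.
Variables (R : realType) (d : measure_display) (T : measurableType d) (P : probability T R).
Implicit Types f g : T -> R.

Definition bmf f := measurable_fun setT f /\ exists M, forall x, `|f x| <= M.

Lemma integrable_bmf f : bmf f -> P.-integrable setT (EFin \o f).
Proof.
move=> [mf [M fM]]; apply: measurable_bounded_integrable => //.
  by apply: (@le_lt_trans _ _ 1%E); [exact: probability_le1 | exact: ltry].
by exists M; split; [exact: num_real | move=> x Mx y _; exact: le_trans (fM y) (ltW Mx)].
Qed.

Lemma EFin_Rintegral_bmf f : bmf f ->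
  (\int[P]_x f x)%:E = (\int[P]_x (f x)%:E)%E.
Proof.
by move=> bf; rewrite /Rintegral fineK // integrable_fin_num //; exact: integrable_bmf.
Qed.

Lemma Rintegral_probc (a : R) : \int[P]_x a = a.
Proof.
rewrite Rintegral_cst // -[RHS]mulr1; congr (_ * _).
exact: (congr1 fine (@probability_setT _ _ _ P)).
Qed.

Lemma bmfD f g : bmf f -> bmf g -> bmf (fun x => f x + g x).
Proof.
move=> [mf [M fM]] [mg [N gN]]; split; first exact: measurable_funD.
by exists (M + N) => x; apply: le_trans (ler_normD _ _) _; exact: lerD.
Qed.

Lemma bmfZ a f : bmf f -> bmf (fun x => a * f x).
Proof.
move=> [mf [M fM]]; split; first exact: measurable_funM.
by exists (`|a| * M) => x; rewrite normrM; exact: ler_wpM2l.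
Qed.

Lemma bmfc (a : R) : bmf (fun=> a).
Proof. by split => //; exists `|a|. Qed.

Lemma bmfM f g : bmf f -> bmf g -> bmf (fun x => f x * g x).
Proof.
move=> [mf [M fM]] [mg [N gN]]; split; first exact: measurable_funM.
by exists (M * N) => x; rewrite normrM; apply: ler_pM.
Qed.

(** Jensen for the square: expand the nonnegative mean of [(f x - a) ^+ 2]. *)
Lemma sqr_Rintegral_le f : bmf f -> (\int[P]_x f x) ^+ 2 <= \int[P]_x (f x ^+ 2).
Proof.
move=> bf; set a := \int[P]_x f x.
have b2 : bmf (fun x => f x ^+ 2) by exact: bmfM.
have ba := bmfZ (- (2 * a)) bf.
have bc := bmfc (a ^+ 2).
have : 0 <= \int[P]_x ((f x ^+ 2 + - (2 * a) * f x) + a ^+ 2).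
  apply: Rintegral_ge0 => x _.
  by rewrite (_ : _ + _ = (f x - a) ^+ 2) ?sqr_ge0 //; ring.
rewrite (RintegralD _ (integrable_bmf (bmfD b2 ba)) (integrable_bmf bc)) //.
rewrite (RintegralD _ (integrable_bmf b2) (integrable_bmf ba)) //.
rewrite (RintegralZl _ _ (integrable_bmf bf)) // Rintegral_probc -/a.
by rewrite (_ : _ + _ + _ = \int[P]_x (f x ^+ 2) - a ^+ 2) ?subr_ge0 //; ring.
Qed.

Lemma Rintegral_bmf_le f g : bmf f -> bmf g -> (forall x, f x <= g x) ->
  \int[P]_x f x <= \int[P]_x g x.
Proof. by move=> /integrable_bmf fi /integrable_bmf gi fg; exact: le_Rintegral. Qed.

Lemma Rintegral_norm_le f M : bmf f -> (forall x, `|f x| <= M) -> `|\int[P]_x f x| <= M.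
Proof.
move=> bf fM; rewrite -(Rintegral_probc M).
apply: le_trans (le_normr_Rintegral _ (integrable_bmf bf)) _ => //.
apply: Rintegral_bmf_le => //; last exact: bmfc.
split; first by apply: measurableT_comp => //; case: bf.
by exists M => x; rewrite normr_id.
Qed.

End bounded_prob.

Section rop.
Variables (R : realType) (n : nat).
Local Notation TR := (measurableTypeR R).
Local Notation X := 'rV[R]_n.
Variables (P : probability TR R) (phi : TR -> X).
Hypothesis mphi : measurable_fun setT phi.
Implicit Types f g h : X -> R.

Definition rop (Q : {measure set TR -> \bar R}) (psi : R -> X) f (x : X) : R :=
  \int[Q]_s f (x - psi s).

Lemma bmf_sub1 f x : bmf f -> bmf (fun s : TR => f (x - phi s)).
Proof.
move=> [mf [M fM]]; split; last by exists M.
by apply: (measurableT_comp mf); exact: measurable_rV_sub.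
Qed.

Lemma rop_EFin f x : bmf f -> (rop P phi f x)%:E = (\int[P]_s (f (x - phi s))%:E)%E.
Proof. by move=> bf; exact: (EFin_Rintegral_bmf P (bmf_sub1 x bf)). Qed.

Lemma nnm_shiftM f M : bmf f -> (forall x, `|f x| <= M) -> nnm (fun x => (f x + M)%:E).
Proof.
move=> [mf _] fM; split.
  by apply/measurable_EFinP; exact: measurable_funD.
by move=> x; rewrite lee_fin -lerBlDr sub0r; have := fM x; rewrite ler_norml => /andP[].
Qed.

(** Averages against a probability fix constants. Adding a bound [M] of [|f|] therefore transfers
    measurability and Tonelli from nonnegative functions to bounded signed ones. *)
Lemma rop_op f M x : bmf f -> (rop P phi f x + M)%:E = op P phi (fun y => (f y + M)%:E) x.
Proof.
move=> bf; have bc : bmf (fun=> M) := @bmfc _ _ _ M.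
rewrite /op -(EFin_Rintegral_bmf P (bmfD (bmf_sub1 x bf) (@bmfc _ _ TR M))).
rewrite (RintegralD _ (integrable_bmf P (bmf_sub1 x bf)) (integrable_bmf P (@bmfc _ _ TR M))) //.
by rewrite Rintegral_probc.
Qed.

Lemma rop_norm_le f M x : bmf f -> (forall x, `|f x| <= M) -> `|rop P phi f x| <= M.
Proof.
by move=> bf fM; apply: (Rintegral_norm_le P (bmf_sub1 x bf)) => s; exact: fM.
Qed.

Lemma bmf_rop f : bmf f -> bmf (rop P phi f).
Proof.
move=> bf; have [mf [M fM]] := bf; split; last first.
  by exists M => x; exact: rop_norm_le.
apply/measurable_EFinP.
rewrite (_ : _ \o _ = fun x => (op P phi (fun y => (f y + M)%:E) x - M%:E)%E).
  by apply: emeasurable_funB => //; exact: (nnm_op P mphi (nnm_shiftM bf fM)).1.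
by apply/funext => x /=; rewrite -rop_op // -EFinB addrK.
Qed.

Lemma ropD f g : bmf f -> bmf g ->
  rop P phi (fun x => f x + g x) = (fun x => rop P phi f x + rop P phi g x).
Proof.
move=> bf bg; apply/funext => x.
exact: (RintegralD _ (integrable_bmf P (bmf_sub1 x bf)) (integrable_bmf P (bmf_sub1 x bg))).
Qed.

Lemma ropZ a f : bmf f -> rop P phi (fun x => a * f x) = (fun x => a * rop P phi f x).
Proof.
move=> bf; apply/funext => x.
exact: (RintegralZl _ _ (integrable_bmf P (bmf_sub1 x bf))).
Qed.

Lemma rop_abs_le f x : bmf f ->
  (`|rop P phi f x|%:E <= op P phi (fun y => `|f y|%:E) x)%E.
Proof.
move=> bf; rewrite (EFin_normr_Rintegral _ (integrable_bmf P (bmf_sub1 x bf))) //.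
apply: le_abse_integral => //; apply/measurable_EFinP; exact: (bmf_sub1 x bf).1.
Qed.

Lemma rop_sqr_le f x : bmf f ->
  ((rop P phi f x ^+ 2)%:E <= op P phi (fun y => (f y ^+ 2)%:E) x)%E.
Proof.
move=> bf; have b1 := bmf_sub1 x bf.
rewrite /op -(EFin_Rintegral_bmf P (bmfM b1 b1)) lee_fin.
exact: sqr_Rintegral_le.
Qed.

End rop.

Section rop_comm.
Variables (R : realType) (n : nat).
Local Notation TR := (measurableTypeR R).
Variables (P Q : probability TR R) (phi psi : TR -> 'rV[R]_n).
Hypothesis mphi : measurable_fun setT phi.
Hypothesis mpsi : measurable_fun setT psi.

Lemma rop_comm f : bmf f -> rop P phi (rop Q psi f) = rop Q psi (rop P phi f).
Proof.
move=> bf; have [_ [M fM]] := bf; apply/funext => x.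
apply: (addIr M); apply: EFin_inj.
rewrite (rop_op P mphi _ _ (bmf_rop Q mpsi bf)) (rop_op Q mpsi _ _ (bmf_rop P mphi bf)).
rewrite (_ : (fun y => _) = op Q psi (fun y => (f y + M)%:E)); last first.
  by apply/funext => y; exact: rop_op.
rewrite [in RHS](_ : (fun y => _) = op P phi (fun y => (f y + M)%:E)); last first.
  by apply/funext => y; exact: rop_op.
exact: (op_comm P Q mphi mpsi (nnm_shiftM bf fM)).
Qed.
End rop_comm.

(** * Pairings of bounded integrable functions *)

Section bint.
Variables (R : realType) (n : nat).
Local Notation TR := (measurableTypeR R).
Local Notation X := 'rV[R]_n.
Local Notation lam := (lebesgue_rV R n).
Implicit Types f g h : X -> R.

Lemma measurable_shiftN (a : X) d' (T : measurableType d') (g : X -> T) :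
  measurable_fun setT g -> measurable_fun setT (fun x : X => g (x - a)).
Proof. exact: measurable_shift_rV. Qed.

Lemma integral_rV_shiftN (a : X) (F : X -> \bar R) : measurable_fun setT F ->
  (\int[lam]_x F (x - a)%R = \int[lam]_x F x)%E.
Proof.
move=> mF; rewrite integralE [RHS]integralE.
have H (G : X -> \bar R) : measurable_fun setT G -> (forall x, 0 <= G x)%E ->
    (\int[lam]_x G (x - a)%R = \int[lam]_x G x)%E.
  by move=> mG G0; exact: (@integral_rV_shift _ _ (- a) G mG G0).
apply: (f_equal2 (fun u v : \bar R => (u - v)%E)).
  rewrite -(H (F^\+)%E) //; first by apply: eq_integral => x _; rewrite !funeposE.
  exact: measurable_funepos.
rewrite -(H (F^\-)%E) //; first by apply: eq_integral => x _; rewrite !funenegE.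
exact: measurable_funeneg.
Qed.

(** Boundedness together with integrability gives square integrability, and the class is stable
    under all the averages; every pairing below is therefore finite. *)
Definition bint f := bmf f /\ (\int[lam]_x `|f x|%:E < +oo)%E.

Lemma nnm_abs f : measurable_fun setT f -> nnm (fun x => `|f x|%:E).
Proof.
move=> mf; split => [|x]; last by rewrite lee_fin.
by apply/measurable_EFinP; exact: measurableT_comp.
Qed.

Lemma nnm_sqr f : measurable_fun setT f -> nnm (fun x => (f x ^+ 2)%:E).
Proof.
move=> mf; split => [|x]; last by rewrite lee_fin sqr_ge0.
by apply/measurable_EFinP; exact: measurable_funX.
Qed.

Lemma bintD f g : bint f -> bint g -> bint (fun x => f x + g x).
Proof.
move=> [bf ff] [bg fg]; split; first exact: bmfD.
have nf := nnm_abs bf.1; have ng := nnm_abs bg.1.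
apply: (@le_lt_trans _ _ (\int[lam]_x (`|f x|%:E + `|g x|%:E))%E).
  apply: nnm_le_integral; [exact: nnm_abs (bmfD bf bg).1|exact: nnmD|].
  by move=> x; rewrite -EFinD lee_fin ler_normD.
rewrite (ge0_integralD lam measurableT (fun x _ => nf.2 x) nf.1 (fun x _ => ng.2 x) ng.1).
exact: lte_add_pinfty.
Qed.

Lemma bintM f h : bint f -> bmf h -> bint (fun x => f x * h x).
Proof.
move=> [bf ff] bh; split; first exact: bmfM.
have [_ [M hM]] := bh.
have M0 : 0 <= M by apply: le_trans (hM 0).
have nf := nnm_abs bf.1.
apply: (@le_lt_trans _ _ (\int[lam]_x (M%:E * `|f x|%:E))%E).
  apply: nnm_le_integral; [exact: nnm_abs (bmfM bf bh).1|exact: nnmZ|].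
  by move=> x; rewrite -EFinM lee_fin normrM mulrC; exact: ler_wpM2r.
rewrite (ge0_integralZl_EFin lam measurableT (fun x _ => nf.2 x) nf.1 M0).
exact: lte_mul_pinfty.
Qed.

Lemma bintZ a f : bint f -> bint (fun x => a * f x).
Proof.
move=> bf; have := bintM bf (@bmfc _ _ X a).
by congr bint; apply/funext => x; rewrite mulrC.
Qed.

Lemma bint_shift (a : X) f : bint f -> bint (fun x => f (x - a)).
Proof.
move=> [[mf [M fM]] ff]; split.
  by split; [exact: measurable_shiftN|exists M].
by rewrite (@integral_rV_shiftN a (fun x => `|f x|%:E) (nnm_abs mf).1).
Qed.

Lemma integrable_bint f : bint f -> lam.-integrable setT (EFin \o f).
Proof. by move=> [[mf _] ff]; apply/integrableP; split => //; exact/measurable_EFinP. Qed.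

Lemma EFin_Rintegral_bint f : bint f -> (\int[lam]_x f x)%:E = (\int[lam]_x (f x)%:E)%E.
Proof.
by move=> bf; rewrite /Rintegral fineK // integrable_fin_num //; exact: integrable_bint.
Qed.

Definition ip f h : R := \int[lam]_x (f x * h x).
Definition n2 f := ip f f.

Lemma n2E f : bint f -> (n2 f)%:E = (\int[lam]_x (f x ^+ 2)%:E)%E.
Proof. by move=> bf; exact: (EFin_Rintegral_bint (bintM bf bf.1)). Qed.

Lemma n2_ge0 f : 0 <= n2 f.
Proof. by apply: Rintegral_ge0 => x _; rewrite -expr2 sqr_ge0. Qed.

Lemma ipDl f g h : bint f -> bint g -> bmf h ->
  ip (fun x => f x + g x) h = ip f h + ip g h.
Proof.
move=> bf bg bh; rewrite /ip -(RintegralD _ (integrable_bint (bintM bf bh)) (integrable_bint (bintM bg bh))) //.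
by apply: eq_Rintegral => x _; rewrite mulrDl.
Qed.

Lemma ipC f h : ip f h = ip h f.
Proof. by apply: eq_Rintegral => x _; rewrite mulrC. Qed.

Lemma ipZl a f h : bint f -> bmf h -> ip (fun x => a * f x) h = a * ip f h.
Proof.
move=> bf bh; rewrite /ip -(RintegralZl _ _ (integrable_bint (bintM bf bh))) //.
by apply: eq_Rintegral => x _; rewrite mulrA.
Qed.

Lemma ip_shift f h (z w : X) : bint f -> bint h ->
  ip (fun x => f (x - z)) (fun x => h (x - w)) = ip (fun x => f (x - (z - w))) h.
Proof.
move=> bf bh; rewrite /ip /Rintegral; congr fine.
have bm := bintM (bint_shift (z - w) bf) bh.1.
rewrite -[RHS](@integral_rV_shiftN w _ ((measurable_EFinP _ _).2 bm.1.1)).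
by apply: eq_integral => x _; rewrite /= opprB addrA subrK.
Qed.

Lemma n2_shift f z : bint f -> n2 (fun x => f (x - z)) = n2 f.
Proof.
move=> bf; rewrite /n2 ip_shift // subrr.
by congr ip; apply/funext => x; rewrite subr0.
Qed.

Lemma n2_add f h a : bint f -> bint h ->
  n2 (fun x => f x + a * h x) = n2 f + 2 * a * ip f h + a ^+ 2 * n2 h.
Proof.
move=> bf bh; have bah := bintZ a bh.
have bs := (bintD bf bah).1.
rewrite /n2 (ipDl bf bah bs) (ipZl a bh bs).
rewrite (ipC f) (ipC h) (ipDl bf bah bf.1) (ipDl bf bah bh.1).
rewrite (ipZl a bh bf.1) (ipZl a bh bh.1) (ipC h f); ring.
Qed.

Lemma ip_le f h : bint f -> bint h -> `|ip f h| <= (n2 f + n2 h) / 2.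
Proof.
move=> bf bh.
have := n2_ge0 (fun x => f x + 1 * h x); have := n2_ge0 (fun x => f x + -1 * h x).
rewrite !n2_add // ler_norml; lra.
Qed.

Section with_op.
Variables (P : probability TR R) (phi : TR -> X).
Hypothesis mphi : measurable_fun setT phi.

Lemma integral_op_prob (g : X -> \bar R) : nnm g ->
  (\int[lam]_x op P phi g x = \int[lam]_x g x)%E.
Proof.
move=> ng; rewrite (integral_op P mphi ng) -[RHS]mul1e; congr (_ * _)%E.
exact: probability_setT.
Qed.

Lemma rop_L1_le f : bint f ->
  (\int[lam]_x `|rop P phi f x|%:E <= \int[lam]_x `|f x|%:E)%E.
Proof.
move=> [bf _]; rewrite -(integral_op_prob (nnm_abs bf.1)).
apply: nnm_le_integral; [exact: nnm_abs (bmf_rop P mphi bf).1|exact: nnm_op (nnm_abs bf.1)|].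
by move=> x; exact: rop_abs_le.
Qed.

Lemma bint_rop f : bint f -> bint (rop P phi f).
Proof.
move=> bf; split; first exact: bmf_rop bf.1.
exact: le_lt_trans (rop_L1_le bf) bf.2.
Qed.

Lemma n2_rop_le f : bint f -> n2 (rop P phi f) <= n2 f.
Proof.
move=> bf; rewrite -lee_fin !n2E //; last exact: bint_rop.
rewrite -(integral_op_prob (nnm_sqr bf.1.1)).
apply: nnm_le_integral.
- exact: nnm_sqr (bmf_rop P mphi bf.1).1.
- exact: nnm_op (nnm_sqr bf.1.1).
- by move=> x; apply: rop_sqr_le => //; exact: bf.1.
Qed.

(** What licenses Fubini for the signed pairing: replacing [|h|] by its bound leaves the integral of
    an average of [|f|]. *)
Lemma integrable_ip_shift f h : bint f -> bmf h ->
  (lam \x P)%E.-integrable setT (fun z : X * TR => (f (z.1 - phi z.2) * h z.1)%:E).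
Proof.
move=> bf bh; have [mh [M hM]] := bh.
have M0 : 0 <= M by apply: le_trans (hM 0).
have mF : measurable_fun setT (fun z : X * TR => f (z.1 - phi z.2) * h z.1).
  apply: measurable_funM; last by apply: (measurableT_comp mh).
  apply: (measurableT_comp bf.1.1); apply: measurable_rV_sub => //.
  exact: (measurableT_comp mphi).
apply/integrable12ltyP; first exact/measurable_EFinP.
have nf := nnm_abs bf.1.1; have no := nnm_op P mphi nf.
apply: (@le_lt_trans _ _ (\int[lam]_x (M%:E * op P phi (fun x => `|f x|%:E) x))%E).
  apply: nnm_le_integral; last 1 first.
  - move=> x; rewrite /= -(opZ P mphi nf M0).
    apply: nnm_le_integral; [| |].
    + split => [|s]; last by rewrite lee_fin.
      apply/measurable_EFinP; apply: measurableT_comp => //.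
      by apply: measurable_funM => //; exact: (bmf_sub1 mphi x bf.1).1.
    + exact: (nnm_sub1 mphi x (nnmZ M0 nf)).
    + by move=> s; rewrite /= lee_fin normrM mulrC; exact: ler_wpM2r.
  - split => [|x]; last by apply: integral_ge0 => s _; exact: abse_ge0.
    apply: (measurable_fun_fubini_tonelli_F (fun z : X * TR => `|(f (z.1 - phi z.2) * h z.1)%:E|%E)).
      by apply: measurableT_comp => //; exact/measurable_EFinP.
    by move=> z; exact: abse_ge0.
  - exact: nnmZ.
rewrite (ge0_integralZl_EFin lam measurableT (fun x _ => no.2 x) no.1 M0).
rewrite (integral_op_prob nf); apply: lte_mul_pinfty => //.
exact: bf.2.
Qed.

Lemma bmf_ip_shift f h : bint f -> bint h ->
  bmf (fun s : TR => ip (fun x => f (x - phi s)) h).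
Proof.
move=> bf bh; split; last first.
  exists ((n2 f + n2 h) / 2) => s; apply: le_trans (ip_le (bint_shift _ bf) bh) _.
  by rewrite n2_shift.
apply/measurable_EFinP.
rewrite (_ : _ \o _ = fun s => (\int[lam]_x (f (x - phi s) * h x)%:E)%E); last first.
  by apply/funext => s; exact: (EFin_Rintegral_bint (bintM (bint_shift _ bf) bh.1)).
exact: (measurable_fubini_G (integrable_ip_shift bf bh.1)).
Qed.

Lemma ip_rop f h : bint f -> bint h ->
  ip (rop P phi f) h = \int[P]_s ip (fun x => f (x - phi s)) h.
Proof.
move=> bf bh; apply: EFin_inj.
rewrite (EFin_Rintegral_bint (bintM (bint_rop bf) bh.1)).
rewrite (EFin_Rintegral_bmf P (bmf_ip_shift bf bh)).
transitivity (\int[lam]_x \int[P]_s (f (x - phi s) * h x)%:E)%E.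
  apply: eq_integral => x _; rewrite EFinM (rop_EFin P mphi x bf.1) muleC.
  rewrite -integralZl //; last exact: (integrable_bmf P (bmf_sub1 mphi x bf.1)).
  by apply: eq_integral => s _; rewrite muleC.
rewrite (Fubini (integrable_ip_shift bf bh.1)).
apply: eq_integral => s _; apply/esym.
exact: (EFin_Rintegral_bint (bintM (bint_shift _ bf) bh.1)).
Qed.

End with_op.
End bint.

(** * Vertical oscillation of an average over (t - s, t^2 - s^2) *)

Section osc.
Variables (R : realType).
Local Notation TR := (measurableTypeR R).
Local Notation leb := (@lebesgue_measure R).
Local Notation mT := (uniform_prob (ltN11 R)).

Definition I11 (t : R) : R := \1_[set` `[(-1 : R), 1]] t.

Lemma I11_ge0 t : 0 <= I11 t. Proof. by rewrite /I11. Qed.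

Lemma measurable_I11 : measurable_fun setT (I11 : TR -> R).
Proof. exact: measurable_indic. Qed.

Lemma I11E t : I11 t = (`|t| <= 1)%R%:R.
Proof. by rewrite /I11 indicE mem_setE in_itv /= ler_norml. Qed.

Lemma I11_le1 t : I11 t <= 1.
Proof. by rewrite I11E lern1; case: (_ <= _)%R. Qed.

Lemma integral_uniform11 (f : TR -> \bar R) : nnm f ->
  (\int[mT]_t f t = (2^-1)%:E * \int[leb]_t ((I11 t)%:E * f t))%E.
Proof.
move=> [mf f0]; rewrite (integral_uniform (ltN11 R) mf f0) opprK; congr (_ * _)%E.
rewrite integral_mkcond; apply: eq_integral => t _.
by rewrite /I11 patchE indicE; case: ifP => _; rewrite ?mul1e ?mul0e.
Qed.

Lemma integral_itv_indic (x r : R) : 0 <= r ->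
  (\int[leb]_t (\1_[set` `[x, (x + r)%R]] t)%:E = r%:E)%E.
Proof.
move=> r0; transitivity (lebesgue_measure ([set` `[x, (x + r)%R]] : set TR)).
  by rewrite integral_indic // setIT.
rewrite lebesgue_measure_itv /= lte_fin.
case: ltP => h; first by rewrite -EFinB addrAC subrr add0r.
by congr EFin; apply/le_anti; rewrite r0 /=; move: h; rewrite -lerBrDl subrr.
Qed.

(* A majorant of [2 ^ (1 - j) / |a|] on [2 ^ (1 - j) <= |a| <= 2] whose integral is
   of order [j / 2 ^ j]. *)
Definition errb (j : nat) (a : R) : R :=
  \sum_(i < j.+1) 2 ^+ i / 2 ^+ j * 2 * (`|a| <= 2 / 2 ^+ i)%R%:R.

Lemma errb_ge0 j a : 0 <= errb j a.
Proof. by apply: sumr_ge0 => i _; rewrite !mulr_ge0. Qed.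

Lemma errb_near j a : `|a| <= 2 / 2 ^+ j -> 2 <= errb j a.
Proof.
move=> ha; rewrite /errb big_ord_recr /= ha divff ?expf_neq0 // mul1r mulr1.
by rewrite lerDr sumr_ge0 // => i _; rewrite !mulr_ge0.
Qed.

(** Among the indices [i] with [|a| <= 2 / 2 ^+ i] the largest already has [1 / |a| <= 2 ^+ i]; the
    induction on [j] looks for it from the top. *)
Lemma errb_far j a : 2 / 2 ^+ j < `|a| -> `|a| <= 2 -> 2 / 2 ^+ j / `|a| <= errb j a.
Proof.
move=> a1 a2; rewrite /errb.
have -> : \sum_(i < j.+1) 2 ^+ i / 2 ^+ j * 2 * (`|a| <= 2 / 2 ^+ i)%R%:R =
   2 / 2 ^+ j * \sum_(i < j.+1) 2 ^+ i * (`|a| <= 2 / 2 ^+ i)%R%:R :> R.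
  by rewrite mulr_sumr; apply: eq_bigr => i _; ring.
apply: ler_wpM2l; first by rewrite divr_ge0.
elim: j a1 => [|j IH] a1; first by move: a1; rewrite expr0 divr1 ltNge a2.
rewrite big_ord_recr /=; have [h|h] := leP `|a| (2 / 2 ^+ j); last first.
  by apply: (le_trans (IH h)); rewrite lerDl mulr_ge0.
rewrite big_ord_recr /= h mulr1.
apply: (@le_trans _ _ (2 ^+ j)); last first.
  rewrite -addrA addrCA lerDl; apply: addr_ge0; last exact: mulr_ge0.
  by apply: sumr_ge0 => i _; exact: mulr_ge0.
have p0 : 0 < 2 ^+ j :> R by rewrite exprn_gt0.
have a0 : 0 < `|a| by apply: lt_trans a1; rewrite divr_gt0 // exprn_gt0.
rewrite -[leLHS]mul1r ler_pdivrMr // -ler_pdivrMl // mulr1.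
apply: le_trans (ltW a1); rewrite exprS invfM mulrA divff // mul1r //.
Qed.

Lemma integral_errb j :
  (\int[leb]_a (errb j a)%:E = (8 * j.+1%:R / 2 ^+ j)%:E)%E.
Proof.
have E (i : nat) (a : R) : (`|a| <= 2 / 2 ^+ i)%R%:R =
    \1_[set` `[- (2 / 2 ^+ i), (- (2 / 2 ^+ i) + 4 / 2 ^+ i)%R]] a :> R.
  rewrite indicE mem_setE in_itv /= ler_norml.
  by congr ((_ && (_ <= _))%:R); field; rewrite expf_neq0.
under eq_integral => a _.
  rewrite /errb -sumEFin; under eq_bigr => i _ do rewrite E EFinM.
  over.
rewrite ge0_integral_sum //=; last first.
  move=> i; apply: measurable_funeM; apply/measurable_EFinP; exact: measurable_indic.
rewrite (eq_bigr (fun=> (8 / 2 ^+ j)%:E)); last first.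
  move=> i _; rewrite ge0_integralZl_EFin //; last first.
    by apply/measurable_EFinP; exact: measurable_indic.
  rewrite integral_itv_indic ?divr_ge0 // -EFinM; congr EFin.
  by field; rewrite !expf_neq0.
rewrite sumEFin sumr_const card_ord; congr EFin.
by rewrite -mulr_natl; ring.
Qed.

End osc.

Section osc2.
Variables (R : realType).
Local Notation TR := (measurableTypeR R).
Local Notation leb := (@lebesgue_measure R).
Local Notation mT := (uniform_prob (ltN11 R)).
Variables (G : TR * TR -> \bar R) (M : R).
Hypotheses (nG : nnm G) (GM : forall z, (G z <= M%:E)%E).

Let M0 : 0 <= M.
Proof. by rewrite -lee_fin; apply: le_trans (GM (0, 0)); exact: nG.2. Qed.

(* The substitution [s = a + t] turns [(t - s, t^2 - s^2 + w)] into
   [(- a, w - (2 a t + a^2))], so that for fixed [a] adding [h] to [w] amounts to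
   translating [t] by [- h / (2 a)]. *)
Definition slicef w (a t : R) : \bar R :=
  ((I11 t * I11 (a + t))%:E * G ((- a)%R, (w - (2 * a * t + a ^+ 2))%R))%E.

Definition slice w a : \bar R := (\int[leb]_t slicef w a t)%E.

Lemma nnm_slicef2 w : nnm (fun z : TR * TR => slicef w z.1 z.2).
Proof.
split => [|z]; last by apply: mule_ge0; [rewrite lee_fin mulr_ge0 // I11_ge0|exact: nG.2].
apply: emeasurable_funM.
  apply/measurable_EFinP; apply: measurable_funM.
    by apply: (measurableT_comp (@measurable_I11 R)).
  by apply: (measurableT_comp (@measurable_I11 R)); exact: measurable_funD.
apply: (measurableT_comp nG.1); apply: measurable_fun_pair => /=.
  by apply: measurableT_comp.
apply: measurable_funB => //; apply: measurable_funD.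
  by apply: measurable_funM => //; exact: measurable_funM.
exact: measurable_funX.
Qed.

Lemma nnm_slicef w a : nnm (slicef w a : TR -> \bar R).
Proof.
have [h1 h2] := nnm_slicef2 w; split => [|t]; last exact: (h2 (a, t)).
exact: (measurableT_comp h1 (pair1_measurable (a : TR))).
Qed.

Lemma slicef_le w a t : (slicef w a t <= M%:E * (I11 t)%:E)%E.
Proof.
rewrite muleC; apply: lee_pmul; [by rewrite lee_fin mulr_ge0 // I11_ge0|exact: nG.2| |exact: GM].
by rewrite lee_fin ler_piMr ?I11_ge0 ?I11_le1.
Qed.

Lemma slice_le_const w a : (slice w a <= (M * 2)%:E)%E.
Proof.
have nI : nnm (fun t : TR => (I11 t)%:E).
  by split => [|t]; [apply/measurable_EFinP; exact: measurable_I11|rewrite lee_fin I11_ge0].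
apply: (@le_trans _ _ (\int[leb]_t (M%:E * (I11 t)%:E))%E).
  by apply: nnm_le_integral; [exact: nnm_slicef|exact: nnmZ|exact: slicef_le].
rewrite (ge0_integralZl_EFin leb measurableT (fun x _ => nI.2 x) nI.1 M0) EFinM.
apply: lee_wpmul2l; first by rewrite lee_fin.
have := @integral_itv_indic R (-1) 2 (ler0n _ 2).
by rewrite (_ : -1 + 2 = 1 :> R)%R; [move=> ->|ring].
Qed.

Lemma slice0 w a : 2 < `|a| -> slice w a = 0%E.
Proof.
move=> a2; rewrite /slice (eq_integral (fun=> 0%E)) ?integral0 // => t _.
rewrite /slicef !I11E; case: (boolP (`|t| <= 1)%R) => h1; last by rewrite mul0r mul0e.
case: (boolP (`|a + t| <= 1)%R) => h2; last by rewrite mulr0 mul0e.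
have : `|a| <= 2.
  have -> : a = (a + t) - t by ring.
  by apply: le_trans (ler_normB _ _) _; rewrite -[leRHS]/(1 + 1 : R); exact: lerD.
by rewrite leNgt a2.
Qed.

(** A translated window leaves the original one only through an interval of length [|kk|] at one of
    its ends. *)
Lemma indic_shift_le (lo hi kk t : R) :
  (\1_[set` `[lo, hi]] (t + kk) : R) <= \1_[set` `[lo, hi]] t +
    (\1_[set` `[lo - `|kk|, (lo - `|kk|) + `|kk|]] t + \1_[set` `[hi, hi + `|kk|]] t).
Proof.
rewrite !indicE !mem_setE !in_itv /= subrK.
have k1 := ler_norm kk; have k2 : - kk <= `|kk| by rewrite -normrN ler_norm.
case: (boolP (lo <= t + kk <= hi)) => [/andP[h1 h2]|_]; last by rewrite !addr_ge0.
have [h3|h3] := ltP t lo.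
  rewrite (_ : lo - `|kk| <= t <= lo) ?lerDl; last by apply/andP; split; lra.
  by rewrite addrA addrAC lerDr.
have [h4|h4] := ltP hi t.
  rewrite (_ : hi <= t <= hi + `|kk|); last by apply/andP; split; lra.
  by rewrite addrA lerDr addr_ge0.
by rewrite /= lerDl addr_ge0.
Qed.

Lemma I11_prodE a t : I11 t * I11 (a + t) =
  \1_[set` `[Num.max (-1) (-1 - a), Num.min 1 (1 - a)]] t :> R.
Proof.
rewrite !I11E indicE mem_setE in_itv /= !ler_norml ge_max le_min -natrM mulnb.
congr ((nat_of_bool _)%:R).
by rewrite lerBlDl lerBrDl; case: (-1 <= t); case: (t <= 1); case: (-1 <= a + t); case: (a + t <= 1).
Qed.

(** Translating [t] by [kk] makes the arguments of [G] agree, so only the window described by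
    [I11_prodE] moves. The two end intervals cost [2 * |kk| * M], which is [M * |w - w'| / |a|]. *)
Lemma slice_shift w w' a : a != 0 ->
  (slice w a <= slice w' a + (M * (`|w - w'| / `|a|))%:E)%E.
Proof.
move=> a0; pose kk := (w - w') / (2 * a).
have nS := nnm_slicef w a; have nS' := nnm_slicef w' a.
rewrite /slice -(integral_shift kk nS.1 nS.2).
pose lo := Num.max (-1) (-1 - a); pose hi := Num.min 1 (1 - a).
pose Z1 : TR -> R := \1_[set` `[lo - `|kk|, (lo - `|kk|) + `|kk|]].
pose Z2 : TR -> R := \1_[set` `[hi, hi + `|kk|]].
have mZ1 : measurable_fun setT Z1 by exact: measurable_indic.
have mZ2 : measurable_fun setT Z2 by exact: measurable_indic.
have nZ1 : nnm (fun t => (Z1 t)%:E).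
  by split => [|t]; [exact/measurable_EFinP|rewrite lee_fin].
have nZ2 : nnm (fun t => (Z2 t)%:E).
  by split => [|t]; [exact/measurable_EFinP|rewrite lee_fin].
have nZ := nnmZ M0 (nnmD nZ1 nZ2).
apply: (@le_trans _ _ (\int[leb]_t (slicef w' a t + M%:E * ((Z1 t)%:E + (Z2 t)%:E)))%E).
  apply: nnm_le_integral; last 1 first.
  - move=> t; rewrite /slicef.
    have -> : w - (2 * a * (t + kk) + a ^+ 2) = w' - (2 * a * t + a ^+ 2).
      by rewrite /kk; field.
    set g := G _; have g0 : (0 <= g)%E by exact: nG.2.
    have gM : (g <= M%:E)%E by exact: GM.
    rewrite !I11_prodE -/lo -/hi -EFinD.
    apply: (@le_trans _ _ ((\1_[set` `[lo, hi]] t + (Z1 t + Z2 t))%:E * g)%E).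
      by apply: lee_wpmul2r => //; rewrite lee_fin; exact: indic_shift_le.
    set c1 : R := \1_[set` `[lo, hi]] t; set z := Z1 t + Z2 t.
    have -> : ((c1 + z)%:E * g = c1%:E * g + z%:E * g)%E.
      by rewrite EFinD ge0_muleDl ?lee_fin // addr_ge0.
    by apply: leeD => //; rewrite muleC; apply: lee_wpmul2r => //; rewrite lee_fin addr_ge0.
  - split => [|t]; last exact: nS.2.
    by apply: (measurableT_comp nS.1); exact: measurable_funD.
  - exact: nnmD.
rewrite (ge0_integralD leb measurableT (fun x _ => nS'.2 x) nS'.1 (fun x _ => nZ.2 x) nZ.1).
apply: leeD => //; have nZZ := nnmD nZ1 nZ2.
rewrite (ge0_integralZl_EFin leb measurableT (fun x _ => nZZ.2 x) nZZ.1 M0).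
rewrite (ge0_integralD leb measurableT (fun x _ => nZ1.2 x) nZ1.1 (fun x _ => nZ2.2 x) nZ2.1).
rewrite !integral_itv_indic // -EFinD -EFinM lee_fin ler_wpM2l //.
rewrite /kk normrM normfV normrM (ger0_norm (ler0n _ 2)).
by rewrite le_eqVlt; apply/orP; left; apply/eqP; field; rewrite normr_eq0.
Qed.

(** Three ranges of [a]: near 0 the trivial bound [2 * M] is used, in the middle the translation
    argument, and beyond 2 the slice vanishes. *)
Lemma slice_le j w w' a : `|w - w'| <= 2 / 2 ^+ j ->
  (slice w a <= slice w' a + (M * errb j a)%:E)%E.
Proof.
move=> ww; have s0 : (0 <= slice w' a)%E.
  by apply: integral_ge0 => t _; exact: (nnm_slicef w' a).2.
have e0 := errb_ge0 j a.
have [h|h] := leP `|a| (2 / 2 ^+ j).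
  apply: (le_trans (slice_le_const w a)).
  apply: (@le_trans _ _ (M * errb j a)%:E); last by rewrite leeDr.
  by rewrite lee_fin ler_wpM2l // errb_near.
have [h2|h2] := leP `|a| 2; last first.
  by rewrite slice0 // adde_ge0 // lee_fin mulr_ge0.
have a0 : 0 < `|a| by apply: lt_trans h; rewrite divr_gt0 // exprn_gt0.
apply: (le_trans (slice_shift w w' _)); first by rewrite -normr_gt0.
apply: leeD => //; rewrite lee_fin ler_wpM2l //.
apply: le_trans (errb_far h h2); rewrite ler_wpM2r // invr_ge0 //.
Qed.

Definition osc w : \bar R := (\int[mT]_t \int[mT]_s G ((t - s)%R, (t ^+ 2 - s ^+ 2 + w)%R))%E.

(** Tonelli after the substitution [s = a + t]; [4^-1] is the product of the two uniform densities
    on [[-1, 1]]. *)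
Lemma oscE w : (osc w = (4^-1)%:E * \int[leb]_a slice w a)%E.
Proof.
pose H (z : TR * TR) : \bar R := G (z.1 - z.2, z.1 ^+ 2 - z.2 ^+ 2 + w).
have nH : nnm H.
  split => [|z]; last exact: nG.2.
  apply: (measurableT_comp nG.1); apply: measurable_fun_pair => /=.
    exact: measurable_funB.
  by apply: measurable_funD => //; apply: measurable_funB; exact: measurable_funX.
have nI : nnm (fun t : TR => (I11 t)%:E).
  by split => [|t]; [apply/measurable_EFinP; exact: measurable_I11|rewrite lee_fin I11_ge0].
have nH1 t : nnm (fun s : TR => H (t, s)).
  split => [|s]; last exact: nH.2.
  exact: (measurableT_comp nH.1 (pair1_measurable (t : TR))).
have nIH t : nnm (fun s : TR => ((I11 s)%:E * H (t, s))%E).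
  split => [|s]; last by apply: mule_ge0; [exact: nI.2|exact: nH.2].
  by apply: emeasurable_funM; [exact: nI.1|exact: (nH1 t).1].
have E1 t : (\int[mT]_s H (t, s) = (2^-1)%:E * \int[leb]_a ((I11 (a + t)%R)%:E * H (t, (a + t)%R)))%E.
  rewrite (integral_uniform11 (nH1 t)); congr (_ * _)%E.
  by rewrite -(integral_shift t (nIH t).1 (nIH t).2).
have E2 t : ((I11 t)%:E * \int[mT]_s H (t, s) = (2^-1)%:E * \int[leb]_a slicef w a t)%E.
  rewrite E1 muleCA; congr (_ * _)%E.
  have n3 : nnm (fun a : TR => ((I11 (a + t)%R)%:E * H (t, (a + t)%R))%E).
    split => [|s]; last exact: (nIH t).2.
    by apply: (measurableT_comp (nIH t).1); exact: measurable_funD.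
  rewrite -(ge0_integralZl_EFin leb measurableT (fun x _ => n3.2 x) n3.1 (I11_ge0 t)).
  apply: eq_integral => a _; rewrite muleA -EFinM /slicef /H; congr (_ * G (_, _))%E => /=.
    by ring.
  by ring.
have n4 : nnm (fun t : TR => \int[mT]_s H (t, s))%E.
  split => [|t]; last by apply: integral_ge0 => s _; exact: nH.2.
  exact: (measurable_fun_fubini_tonelli_F _ nH.1 nH.2).
have n5 := nnm_slicef2 w.
rewrite /osc [LHS](integral_uniform11 n4).
transitivity ((2^-1)%:E * \int[leb]_t ((2^-1)%:E * \int[leb]_a slicef w a t))%E.
  by apply: (f_equal (fun u => (2^-1)%:E * u)%E); apply: eq_integral => t _; exact: E2.
have n6 : nnm (fun t : TR => \int[leb]_a slicef w a t)%E.
  split => [|t]; last by apply: integral_ge0 => s _; exact: (n5.2 (s, t)).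
  exact: (measurable_fun_fubini_tonelli_G _ n5.1 n5.2).
have h0 : 0 <= 2^-1 :> R by [].
rewrite (ge0_integralZl_EFin leb measurableT (fun x _ => n6.2 x) n6.1 h0) muleA -EFinM.
have -> : 2^-1 * 2^-1 = 4^-1 :> R by field.
exact: (f_equal (fun u => (4^-1)%:E * u)%E
  (esym (fubini_tonelli (m1 := leb) (m2 := leb) _ n5.1 n5.2))).
Qed.

(** Integrate [slice_le] over [a]: the constant 2 is the 8 of [integral_errb] times the [4^-1] of
    [oscE]. *)
Lemma osc_le j w w' : `|w - w'| <= 2 / 2 ^+ j ->
  (osc w <= osc w' + (2 * M * j.+1%:R / 2 ^+ j)%:E)%E.
Proof.
move=> ww; rewrite !oscE.
have n5 v : nnm (slice v : TR -> \bar R).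
  split => [|a]; last by apply: integral_ge0 => t _; exact: (nnm_slicef v a).2.
  exact: (measurable_fun_fubini_tonelli_F _ (nnm_slicef2 v).1 (nnm_slicef2 v).2).
have ne : nnm (fun a : TR => (errb j a)%:E).
  split => [|a]; last by rewrite lee_fin errb_ge0.
  apply/measurable_EFinP; rewrite /errb.
  apply: measurable_sum => i; apply: measurable_funM => //.
  rewrite (_ : (fun _ => _) = \1_[set` `[- (2 / 2 ^+ i), 2 / 2 ^+ i]]).
    exact: measurable_indic.
  by apply/funext => a; rewrite indicE mem_setE in_itv /= ler_norml.
have nM := nnmZ M0 ne.
apply: (@le_trans _ _ ((4^-1)%:E * \int[leb]_a (slice w' a + M%:E * (errb j a)%:E))%E).
  apply: lee_wpmul2l; first by rewrite lee_fin.
  apply: nnm_le_integral => //; first exact: nnmD.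
  by move=> a; rewrite -EFinM; exact: slice_le.
rewrite (ge0_integralD leb measurableT (fun x _ => (n5 w').2 x) (n5 w').1 (fun x _ => nM.2 x) nM.1).
rewrite (ge0_integralZl_EFin leb measurableT (fun x _ => ne.2 x) ne.1 M0) integral_errb.
rewrite ge0_muleDr; last 2 first.
- by apply: integral_ge0 => a _; exact: (n5 w').2.
- by rewrite -EFinM lee_fin !mulr_ge0.
apply: leeD => //; rewrite -!EFinM lee_fin le_eqVlt; apply/orP; left; apply/eqP.
by field; rewrite expf_neq0.
Qed.

End osc2.

(** Origin of the constant 10: when [b <= 4 * a], the mean [(a + b) / 2] is at most [5/2 * a], and
    it is multiplied by 4. *)
Lemma l2_arith (R : realFieldType) (x y a b j1 q : R) : 0 <= j1 * q -> b <= 4 * a ->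
  x <= y + 4 * ((a + b) / 2) * j1 * q -> x + -1 * y <= 10 * j1 * q * a.
Proof.
move=> jq ba xy; have : b * (j1 * q) <= 4 * a * (j1 * q) by exact: ler_wpM2r.
by move: xy; nra.
Qed.

(** * The L^2 bound *)

Section l2.
Variables (R : realType) (k l : nat) (c : 'M[R]_(k, l)).
Local Notation TR := (measurableTypeR R).
Local Notation X := 'rV[R]_(k + l).
Local Notation lam := (lebesgue_rV R (k + l)).
Local Notation mT := (uniform_prob (ltN11 R)).
Local Notation mE := (uniform_prob (@ltr01 R)).

Definition rT i (f : X -> R) : X -> R := rop mT (parab c i) f.
Definition rE i v (f : X -> R) : X -> R := rop mE (vseg c i v) f.
Definition rD i v v' b (f : X -> R) : X -> R := fun x => rE i v f x + b * rE i v' f x.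

Lemma bint_rT i f : bint f -> bint (rT i f).
Proof. exact: (bint_rop mT (@measurable_parab R k l c i)). Qed.

Lemma bint_rE i v f : bint f -> bint (rE i v f).
Proof. exact: (bint_rop mE (@measurable_vseg R k l c i v)). Qed.

Lemma bint_rD i v v' b f : bint f -> bint (rD i v v' b f).
Proof. by move=> bf; apply: bintD; [|apply: bintZ]; exact: bint_rE. Qed.

Lemma measurable_ip_shift (f h : X -> R) : bint f -> bint h ->
  measurable_fun setT (fun z : X => ip (fun x => f (x - z)) h).
Proof.
move=> bf bh; apply/measurable_EFinP.
pose F (z : X * X) : \bar R := (f (z.2 - z.1) * h z.2)%:E.
have mF : measurable_fun setT F.
  apply/measurable_EFinP; apply: measurable_funM; last by apply: (measurableT_comp bh.1.1).
  by apply: (measurableT_comp bf.1.1); exact: measurable_rV_sub.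
rewrite (_ : _ \o _ = fun z => (\int[lam]_x (F^\+)%E (z, x) - \int[lam]_x (F^\-)%E (z, x))%E).
  apply: emeasurable_funB.
    exact: (measurable_fun_fubini_tonelli_F _ (measurable_funepos mF) (funepos_ge0 F)).
  exact: (measurable_fun_fubini_tonelli_F _ (measurable_funeneg mF) (funeneg_ge0 F)).
apply/funext => z.
apply: (etrans (EFin_Rintegral_bint (bintM (bint_shift z bf) bh.1))).
rewrite integralE; apply: (f_equal2 (fun u v : \bar R => (u - v)%E)).
  by apply: eq_integral => x _; rewrite !funeposE.
by apply: eq_integral => x _; rewrite !funenegE.
Qed.

(** The uniform law only sees [[0, 1]]. Adding [K] makes both integrands nonnegative, so that the
    density formula for the integral applies. *)
Lemma Rintegral_uniform01_le (F F' : TR -> R) B : bmf F -> bmf F' ->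
  (forall u, 0 <= u <= 1 -> F u <= F' u + B) ->
  \int[mE]_u F u <= \int[mE]_u F' u + B.
Proof.
move=> bF bF' FF.
have bc (a : R) : bmf (fun _ : TR => a) by exact: bmfc.
have bFB := bmfD bF' (bc B).
have [K [KF KF']] : exists K, (forall u, 0 <= F u + K) /\ (forall u, 0 <= F' u + B + K).
  have [_ [K1 H1]] := bF; have [_ [K2 H2]] := bFB.
  have K10 := le_trans (normr_ge0 _) (H1 0); have K20 := le_trans (normr_ge0 _) (H2 0).
  exists (K1 + K2); split=> u; [have := H1 u|have := H2 u]; rewrite ler_norml => /andP[h _]; lra.
suff : \int[mE]_u (F u + K) <= \int[mE]_u (F' u + B + K).
  rewrite (RintegralD _ (integrable_bmf mE bF) (integrable_bmf mE (bc K))) //.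
  rewrite (RintegralD _ (integrable_bmf mE bFB) (integrable_bmf mE (bc K))) //.
  rewrite (RintegralD _ (integrable_bmf mE bF') (integrable_bmf mE (bc B))) //.
  by rewrite !Rintegral_probc lerD2r.
have b1 := bmfD bF (bc K); have b2 := bmfD bFB (bc K).
rewrite -lee_fin (EFin_Rintegral_bmf mE b1) (EFin_Rintegral_bmf mE b2).
have m1 := (measurable_EFinP _ _).2 b1.1; have m2 := (measurable_EFinP _ _).2 b2.1.
rewrite (integral_uniform (@ltr01 R) m1) => [|u]; last by rewrite lee_fin.
rewrite (integral_uniform (@ltr01 R) m2) => [|u]; last by rewrite lee_fin.
apply: lee_wpmul2l; first by rewrite lee_fin subr0 invr1.
apply: ge0_le_integral => //.
- by move=> u _; rewrite lee_fin.
- exact: measurable_funTS.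
- exact: measurable_funTS.
- by move=> u; rewrite /= in_itv /= => hu; rewrite lee_fin lerD2r; exact: FF.
Qed.

Section one.
Variables (i : 'I_k) (f g : X -> R).
Hypotheses (bf : bint f) (bg : bint g).
Let P := parab c i.
Let mP : measurable_fun setT (P : TR -> X) := @measurable_parab R k l c i.
Let rho (z : X) : R := ip (fun x => f (x - z)) g.
Let N := (n2 f + n2 g) / 2.

Let rhoN z : `|rho z| <= N.
Proof. by apply: le_trans (ip_le (bint_shift z bf) bg) _; rewrite n2_shift. Qed.

Let brho : bmf rho.
Proof. by split; [exact: measurable_ip_shift|exists N; exact: rhoN]. Qed.

Let mPN : measurable_fun setT (fun t : TR => - P t).
Proof. exact: measurable_rV_opp. Qed.

(** At [y], the mean of [rho (y + P t - P s)] over [t] and [s]: pairing two images under [rT i]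
    averages the correlation [rho] over differences of points of the parabola. *)
Let Phi : X -> R := rop mT (fun t => - P t) (rop mT P rho).

Let bPhi : bmf Phi.
Proof. by apply: bmf_rop => //; exact: bmf_rop. Qed.

Lemma ip_rT_shift y : ip (fun x => rT i f (x - y)) (rT i g) = Phi y.
Proof.
have -> : (fun x => rT i f (x - y)) = rT i (fun x => f (x - y)).
  by apply/funext => x; apply: eq_Rintegral => t _; rewrite addrAC.
rewrite /rT (ip_rop mT mP (bint_shift y bf) (bint_rT i bg)).
apply: eq_Rintegral => t _.
have -> : (fun x => f (x - parab c i t - y)) = (fun x => f (x - (P t + y))).
  by apply/funext => x; rewrite [in RHS]opprD [in RHS]addrA.
rewrite ipC (ip_rop mT mP bg (bint_shift _ bf)).
apply: eq_Rintegral => s _; rewrite ipC opprK (addrC y).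
exact: (ip_shift _ _ bf bg).
Qed.

(** In the plane of [hvec] and [vvec], a difference of two points of the parabola has coordinates
    [t - s] and [t ^+ 2 - s ^+ 2], while [w] moves the second one. Adding [N], a bound of [|rho|],
    makes the integrand nonnegative, as [osc_le] requires. *)
Lemma Phi_osc w : (Phi (w *: vvec c i) + N)%:E =
  osc (fun z => (rho (z.1 *: hvec R l i + z.2 *: vvec c i) + N)%:E) w.
Proof.
rewrite (rop_op mT mPN _ _ (bmf_rop mT mP brho)).
apply: eq_integral => t _; rewrite (rop_op mT mP _ _ brho).
apply: eq_integral => s _; apply: (f_equal (fun z => (rho z + N)%:E)).
rewrite /P /parab /=; move: (hvec R l i) (vvec c i) => e v.
by apply/rowP => q; rewrite !mxE; ring.
Qed.

Lemma ip_rE_rT_le j v v' : 0 <= v -> v <= 2 / 2 ^+ j -> 0 <= v' -> v' <= 2 / 2 ^+ j ->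
  ip (rE i v (rT i f)) (rT i g) <= ip (rE i v' (rT i f)) (rT i g) +
    4 * N * j.+1%:R / 2 ^+ j.
Proof.
move=> v0 v1 v'0 v'1.
have E a : ip (rE i a (rT i f)) (rT i g) = \int[mE]_u Phi (vseg c i a u).
  rewrite (ip_rop mE (@measurable_vseg R k l c i a) (bint_rT i bf) (bint_rT i bg)).
  by apply: eq_Rintegral => u _; exact: ip_rT_shift.
have bV a : bmf (fun u : TR => Phi (vseg c i a u)).
  have [mF [K HK]] := bPhi; split; last by exists K.
  exact: (measurableT_comp mF (@measurable_vseg R k l c i a)).
set B := 4 * N * j.+1%:R / 2 ^+ j.
suff key : \int[mE]_u Phi (vseg c i v u) <= \int[mE]_u Phi (vseg c i v' u) + B.
  exact: (eq_ind_r (fun a => a <= _) (eq_ind_r (fun b => _ <= b + _) key (E v')) (E v)).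
apply: (Rintegral_uniform01_le (bV v) (bV v')).
move=> u /andP[u0 u1].
have aux (x y n0 b0 : R) : ((x + n0)%:E <= (y + n0)%:E + b0%:E)%E -> x <= y + b0.
  by rewrite lee_fin; lra.
apply: (aux _ _ N).
suff key : (osc (fun z => (rho (z.1 *: hvec R l i + z.2 *: vvec c i) + N)%:E) (v * u) <=
    osc (fun z => (rho (z.1 *: hvec R l i + z.2 *: vvec c i) + N)%:E) (v' * u) + B%:E)%E.
  exact: (eq_ind_r (fun a => a <= _)%E (eq_ind_r (fun b => _ <= b + _)%E key
    (Phi_osc (v' * u))) (Phi_osc (v * u))).
have -> : B = 2 * (2 * N) * j.+1%:R / 2 ^+ j by rewrite /B; ring.
have rN z : 0 <= rho z + N <= 2 * N.
  by have := rhoN z; rewrite ler_norml; lra.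
apply: osc_le.
- split => [|z]; last by rewrite lee_fin; case/andP: (rN (z.1 *: hvec R l i + z.2 *: vvec c i)).
  apply/measurable_EFinP; apply: measurable_funD => //.
  apply: (measurableT_comp brho.1); apply: measurable_rV_add.
    by apply: measurable_rV_scale => //; exact: measurable_fst.
  by apply: measurable_rV_scale => //; exact: measurable_snd.
- by move=> z; rewrite lee_fin; case/andP: (rN (z.1 *: hvec R l i + z.2 *: vvec c i)).
- rewrite -mulrBl normrM (ger0_norm u0) -[leRHS]mulr1; apply: ler_pM => //.
  by rewrite ler_norml; lra.
Qed.
End one.

Lemma rE_rT i v f : bmf f -> rE i v (rT i f) = rT i (rE i v f).
Proof. exact: (rop_comm mE mT (@measurable_vseg R k l c i v) (@measurable_parab R k l c i)). Qed.

Lemma n2_rD_le i v v' f : bint f -> n2 (rD i v v' (-1) f) <= 4 * n2 f.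
Proof.
move=> bf; have b1 := bint_rE i v bf; have b2 := bint_rE i v' bf.
have h1 : n2 (rE i v f) <= n2 f by exact: (n2_rop_le mE (@measurable_vseg R k l c i v) bf).
have h2 : n2 (rE i v' f) <= n2 f by exact: (n2_rop_le mE (@measurable_vseg R k l c i v') bf).
have H := ip_le b1 b2; move: H; rewrite /rD (n2_add (-1) b1 b2).
move: (n2 _) (n2 _) (ip _ _) (n2 _) h1 h2 => x y z t h1 h2; rewrite ler_norml; lra.
Qed.

(** With [g] the difference of the two vertical averages of [f], commutation gives
    [T g = E_v T f - E_v' T f]. Pairing this with [T g] itself reduces the squared norm to the
    oscillation of the correlation of [f] and [g] between heights at most [2 / 2 ^+ j]. *)
Lemma n2_piece_le i j v v' f : bint f ->
  0 <= v -> v <= 2 / 2 ^+ j -> 0 <= v' -> v' <= 2 / 2 ^+ j ->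
  n2 (rT i (rD i v v' (-1) f)) <= 10 * j.+1%:R / 2 ^+ j * n2 f.
Proof.
move=> bf v0 v1 v'0 v'1.
set g := rD i v v' (-1) f; have bg : bint g by exact: bint_rD.
have b1 := bint_rE i v (bint_rT i bf); have b2 := bint_rE i v' (bint_rT i bf).
have bh := bint_rT i bg.
have E : rT i g = (fun x => rE i v (rT i f) x + -1 * rE i v' (rT i f) x).
  rewrite (rE_rT i v bf.1) (rE_rT i v' bf.1) /g /rD /rT.
  rewrite (ropD mT (@measurable_parab R k l c i)); last 2 first.
  - exact: (bint_rE i v bf).1.
  - exact: (bintZ (-1) (bint_rE i v' bf)).1.
  by rewrite (ropZ mT (@measurable_parab R k l c i) _ (bint_rE i v' bf).1).
have H := ip_rE_rT_le i bf bg v0 v1 v'0 v'1.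
have h4 : n2 g <= 4 * n2 f by exact: n2_rD_le.
have q0 : 0 <= j.+1%:R / 2 ^+ j :> R by rewrite divr_ge0 // exprn_ge0.
apply: le_trans (l2_arith q0 h4 H).
rewrite /n2 {1}E (ipDl b1 (bintZ (-1) b2) bh.1) (ipZl (-1) b2 bh.1).
exact: lexx.
Qed.

Lemma n2_piece0_le i v v' f : bint f -> n2 (rT i (rD i v v' 0 f)) <= n2 f.
Proof.
move=> bf; have -> : rD i v v' 0 f = rE i v f.
  by apply/funext => x; rewrite /rD mul0r addr0.
apply: le_trans (n2_rop_le mE (@measurable_vseg R k l c i v) bf).
exact: (n2_rop_le mT (@measurable_parab R k l c i) (bint_rE i v bf)).
Qed.

End l2.

(** * Dyadic pieces *)

Section pieces.
Variables (R : realType) (k l : nat) (c : 'M[R]_(k, l)).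
Local Notation TR := (measurableTypeR R).
Local Notation X := 'rV[R]_(k + l).
Local Notation lam := (lebesgue_rV R (k + l)).
Local Notation mT := (uniform_prob (ltN11 R)).
Local Notation mE := (uniform_prob (@ltr01 R)).
Implicit Types f g : X -> R.

Lemma bmf_rT i f : bmf f -> bmf (rT c i f).
Proof. exact: (bmf_rop mT (@measurable_parab R k l c i)). Qed.
Lemma bmf_rE i v f : bmf f -> bmf (rE c i v f).
Proof. exact: (bmf_rop mE (@measurable_vseg R k l c i v)). Qed.
Lemma bmf_rD i v v' b f : bmf f -> bmf (rD c i v v' b f).
Proof. by move=> bf; apply: bmfD; [|apply: bmfZ]; exact: bmf_rE. Qed.

Lemma bmf_sum (I : Type) (r : seq I) (F : I -> X -> R) : (forall t, bmf (F t)) ->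
  bmf (fun x => \sum_(t <- r) F t x).
Proof.
move=> bF; elim: r => [|t r IH].
  rewrite (_ : (fun _ => _) = fun=> 0); first exact: bmfc.
  by apply/funext => x; rewrite big_nil.
rewrite (_ : (fun _ => _) = (fun x => F t x + \sum_(t <- r) F t x)); first exact: bmfD.
by apply/funext => x; rewrite big_cons.
Qed.

Lemma rop_sum (P : probability TR R) (phi : TR -> X) (I : Type) (r : seq I) (F : I -> X -> R) :
  measurable_fun setT phi -> (forall t, bmf (F t)) ->
  rop P phi (fun x => \sum_(t <- r) F t x) = (fun x => \sum_(t <- r) rop P phi (F t) x).
Proof.
move=> mphi bF; elim: r => [|t r IH]; apply/funext => x.
  rewrite big_nil -[RHS](Rintegral_probc P 0).
  by apply: eq_Rintegral => s _; rewrite big_nil.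
transitivity (rop P phi (F t) x + rop P phi (fun x => \sum_(t <- r) F t x) x); last first.
  by rewrite big_cons IH.
rewrite -[RHS](f_equal (fun h => h x) (ropD P mphi (bF t) (bmf_sum r bF))).
by apply: eq_Rintegral => s _; rewrite big_cons.
Qed.

(* The [j]-th difference is [E_{pv j} + pb j E_{pv' j}]: the term [j = 0] has no
   second part, and the last one, [j = J], has [pv J = 0], that is [E_0 = id], which
   makes the finite sum telescope to the identity exactly. *)
Definition pv J j : R := if j == J then 0 else (2 ^+ j)^-1.
Definition pv' j : R := 2 / 2 ^+ j.
Definition pb j : R := if j is 0 then 0 else -1.

Definition Sq J i j f : X -> R := rT c i (rD c i (pv J j) (pv' j) (pb j) f).

Lemma bmf_Sq J i j f : bmf f -> bmf (Sq J i j f).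
Proof. by move=> bf; apply: bmf_rT; exact: bmf_rD. Qed.
Lemma bint_Sq J i j f : bint f -> bint (Sq J i j f).
Proof. by move=> bf; apply: bint_rT; exact: bint_rD. Qed.

Lemma rD_sum i v v' b (I : Type) (r : seq I) (F : I -> X -> R) : (forall t, bmf (F t)) ->
  rD c i v v' b (fun x => \sum_(t <- r) F t x) = (fun x => \sum_(t <- r) rD c i v v' b (F t) x).
Proof.
move=> bF; apply/funext => x; rewrite /rD /rE.
rewrite (rop_sum mE r (@measurable_vseg R k l c i v) bF).
rewrite (rop_sum mE r (@measurable_vseg R k l c i v') bF).
by rewrite mulr_sumr -big_split.
Qed.

Lemma Sq_sum J i j (I : Type) (r : seq I) (F : I -> X -> R) : (forall t, bmf (F t)) ->
  Sq J i j (fun x => \sum_(t <- r) F t x) = (fun x => \sum_(t <- r) Sq J i j (F t) x).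
Proof.
move=> bF; rewrite /Sq rD_sum // /rT.
exact: (rop_sum mT r (@measurable_parab R k l c i) (fun t => bmf_rD _ _ _ _ (bF t))).
Qed.

Lemma rE0 i f : rE c i 0 f = f.
Proof.
apply/funext => x; rewrite -[RHS](Rintegral_probc mE).
by apply: eq_Rintegral => u _; rewrite /vseg mul0r scale0r subr0.
Qed.

(** By induction the terms up to [n <= J] sum to the average of height [2^(-n)]. Since [pv' J.+1] is
    [2^(-J)], the last term replaces the average of height [2^(-J)] by the identity. *)
Lemma sum_rD J i f x :
  \sum_(j <- iota 0 J.+2) rD c i (pv J.+1 j) (pv' j) (pb j) f x = f x.
Proof.
rewrite (_ : iota 0 J.+2 = index_iota 0 J.+2) ?/index_iota ?subn0 //.
rewrite -/(index_iota 0 J.+2).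
have E n : (n <= J)%N ->
    \sum_(0 <= j < n.+1) rD c i (pv J.+1 j) (pv' j) (pb j) f x = rE c i (2 ^+ n)^-1 f x.
  elim: n => [|n IH] nJ.
    by rewrite big_nat1 /rD /= mul0r addr0 /pv.
  rewrite big_nat_recr //= IH ?(ltnW nJ) // /rD /pv /pv' /pb ltn_eqF ?ltnS //.
  rewrite exprS invfM mulrA divff // mul1r mulN1r addrCA subrr addr0 //.
rewrite big_nat_recr //= E // /rD /pv /pv' /pb eqxx rE0.
by rewrite exprS invfM mulrA divff // mul1r mulN1r addrCA subrr addr0.
Qed.

Lemma rT_pieces J i f : bmf f ->
  rT c i f = (fun x => \sum_(j <- iota 0 J.+2) Sq J.+1 i j f x).
Proof.
move=> bf.
rewrite -[RHS](rop_sum mT _ (@measurable_parab R k l c i)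
  (fun j => bmf_rD i (pv J.+1 j) (pv' j) (pb j) bf)).
by congr (rT c i); apply/funext => x; rewrite sum_rD.
Qed.

(** Words over the letters [0, ..., J.+1]; the letter [J.+1] stands for the residual difference
    containing the identity. *)
Fixpoint allseqs J n : seq (seq nat) :=
  if n is n'.+1 then [seq j :: js | j <- iota 0 J.+2, js <- allseqs J n'] else [:: [::]].

Definition chainS J (s : seq 'I_k) (js : seq nat) f : X -> R :=
  foldr (fun p => Sq J p.1 p.2) f (zip s js).

Lemma bmf_chainS J s js f : bmf f -> bmf (chainS J s js f).
Proof.
by move=> bf; rewrite /chainS; elim: (zip s js) => //= p z; exact: bmf_Sq.
Qed.
Lemma bint_chainS J s js f : bint f -> bint (chainS J s js f).
Proof.
by move=> bf; rewrite /chainS; elim: (zip s js) => //= p z; exact: bint_Sq.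
Qed.

Lemma big_allseqs (F : seq nat -> R) J n :
  \sum_(js <- allseqs J n.+1) F js =
  \sum_(j <- iota 0 J.+2) \sum_(js <- allseqs J n) F (j :: js).
Proof.
exact: big_allpairs_dep.
Qed.

Lemma chain_pieces J s f : bmf f ->
  foldr (rT c) f s = (fun x => \sum_(js <- allseqs J (size s)) chainS J.+1 s js f x).
Proof.
move=> bf; elim: s => [|i s IH].
  by apply/funext => x; rewrite big_seq1.
have bC js : bmf (chainS J.+1 s js f) by exact: bmf_chainS.
rewrite [LHS]/= IH (rT_pieces J i (bmf_sum _ bC)).
apply/funext => x; rewrite big_allseqs.
by apply: eq_bigr => j _; rewrite (Sq_sum J.+1 i j _ bC).
Qed.

Lemma mem_allseqs J n js : js \in allseqs J n -> size js = n /\ all (fun j => j <= J.+1)%N js.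
Proof.
elim: n js => [|n IH] js; first by rewrite inE => /eqP ->.
move=> /allpairsPdep[j [js' [hj hjs ->]]] /=.
have [-> ->] := IH _ hjs.
by move: hj; rewrite mem_iota add0n => /andP[_]; rewrite ltnS => ->.
Qed.

(** Distributivity. This is why every bound on a piece is brought to the form of a product over the
    letters: the sum over all words becomes a power of one series. *)
Lemma sum_allseqs_prod J n (w : nat -> R) :
  \sum_(js <- allseqs J n) \prod_(j <- js) w j = (\sum_(j <- iota 0 J.+2) w j) ^+ n.
Proof.
elim: n => [|n IH]; first by rewrite big_seq1 big_nil.
rewrite big_allseqs exprS mulr_suml; apply: eq_bigr => j _.
by rewrite -IH mulr_sumr; apply: eq_bigr => js _; rewrite big_cons.
Qed.

Lemma zip_enum js : size js = k ->
  zip (enum 'I_k) js = map (fun i : 'I_k => (i, nth 0%N js i)) (enum 'I_k).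
Proof.
move=> sj; case: k js sj => [|k'] js sj.
  by rewrite enum_ord0; case: js sj.
apply: (@eq_from_nth _ (ord0, 0%N)) => [|n].
  by rewrite size_zip size_map sj size_enum_ord minnn.
rewrite size_zip sj size_enum_ord minnn => nk.
rewrite nth_zip ?sj ?size_enum_ord // (nth_map ord0) ?size_enum_ord //.
by rewrite (nth_enum_ord _ nk).
Qed.

End pieces.

Section piece_bounds.
Variables (R : realType) (k l : nat) (c : 'M[R]_(k, l)).
Local Notation TR := (measurableTypeR R).
Local Notation X := 'rV[R]_(k + l).
Local Notation lam := (lebesgue_rV R (k + l)).
Local Notation mT := (uniform_prob (ltN11 R)).
Local Notation mE := (uniform_prob (@ltr01 R)).
Implicit Types f h : X -> R.

Lemma pb_norm j : `|pb R j| <= 1.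
Proof. by case: j => [|j]; rewrite /pb ?normr0 // normrN normr1. Qed.

(** Passage to the nonnegative model; all cancellation is given up here, which is harmless for the
    [L^oo] estimate. *)
Lemma Sq_abs_le J i j h x : bmf h ->
  (`|Sq c J i j h x|%:E <=
   Tp c i (fun y => Ep c i (pv R J j) (fun z => `|h z|%:E) y +
                    Ep c i (pv' R j) (fun z => `|h z|%:E) y) x)%E.
Proof.
move=> bh; have bD := bmf_rD c i (pv R J j) (pv' R j) (pb R j) bh.
apply: (le_trans (rop_abs_le mT (@measurable_parab R k l c i) x bD)).
have nh : nnm (fun z => `|h z|%:E) by exact: nnm_abs bh.1.
apply: Tp_le; [exact: nnm_abs bD.1|by apply: nnmD; exact: nnm_Ep|].
move=> y.
apply: (@le_trans _ _ (`|rE c i (pv R J j) h y|%:E + `|rE c i (pv' R j) h y|%:E)%E).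
  rewrite -EFinD lee_fin; apply: (le_trans (ler_normD _ _)); rewrite lerD2l normrM.
  by rewrite ler_piMl // pb_norm.
apply: leeD.
  exact: (rop_abs_le mE (@measurable_vseg R k l c i (pv R J j)) y bh).
exact: (rop_abs_le mE (@measurable_vseg R k l c i (pv' R j)) y bh).
Qed.

Lemma Sq_norm_le J i j h B : bmf h -> (forall x, `|h x| <= B) ->
  forall x, `|Sq c J i j h x| <= 2 * B.
Proof.
move=> bh hB x; have bD := bmf_rD c i (pv R J j) (pv' R j) (pb R j) bh.
apply: (rop_norm_le mT (@measurable_parab R k l c i) x bD) => y.
apply: (le_trans (ler_normD _ _)); rewrite mulr_natl mulr2n; apply: lerD.
  exact: (rop_norm_le mE (@measurable_vseg R k l c i (pv R J j)) y bh hB).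
rewrite normrM -[leRHS]mul1r; apply: ler_pM => //; first exact: pb_norm.
exact: (rop_norm_le mE (@measurable_vseg R k l c i (pv' R j)) y bh hB).
Qed.

Lemma Sq_L1_le J i j h (A : R) : bint h -> (\int[lam]_x `|h x|%:E <= A%:E)%E ->
  (\int[lam]_x `|Sq c J i j h x|%:E <= (2 * A)%:E)%E.
Proof.
move=> bh hA; have bD := bint_rD c i (pv R J j) (pv' R j) (pb R j) bh.
apply: (le_trans (rop_L1_le mT (@measurable_parab R k l c i) bD)).
have n1 := nnm_abs (bint_rE c i (pv R J j) bh).1.1.
have n2 := nnm_abs (bint_rE c i (pv' R j) bh).1.1.
apply: (@le_trans _ _ (\int[lam]_x (`|rE c i (pv R J j) h x|%:E + `|rE c i (pv' R j) h x|%:E))%E).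
  apply: nnm_le_integral; [exact: nnm_abs bD.1.1|exact: nnmD|].
  move=> x; rewrite -EFinD lee_fin; apply: (le_trans (ler_normD _ _)).
  by rewrite lerD2l normrM ler_piMl // pb_norm.
rewrite (ge0_integralD lam measurableT (fun x _ => n1.2 x) n1.1 (fun x _ => n2.2 x) n2.1).
rewrite mulr_natl mulr2n EFinD; apply: leeD.
  exact: le_trans (rop_L1_le mE (@measurable_vseg R k l c i (pv R J j)) bh) hA.
exact: le_trans (rop_L1_le mE (@measurable_vseg R k l c i (pv' R j)) bh) hA.
Qed.

(** The [L^2] factor of one difference, for squared norms. At [j = 0] there is no cancellation, but
    the operator is a contraction and [dd 0 = 10] is generous. *)
Definition dd j : R := 10 * j.+1%:R / 2 ^+ j.

Lemma dd_ge0 j : 0 <= dd j.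
Proof. by rewrite /dd divr_ge0 ?exprn_ge0 // mulr_ge0. Qed.

Lemma Sq_n2_le J i j h : bint h -> n2 (Sq c J i j h) <= dd j * n2 h.
Proof.
move=> bh; rewrite /Sq; case: j => [|j].
  rewrite /pb; apply: (le_trans (n2_piece0_le c i _ _ bh)).
  by rewrite /dd expr0 divr1 mulr1 ler_peMl ?n2_ge0 // ler1n.
have p0 : 0 < 2 ^+ j.+1 :> R by rewrite exprn_gt0.
apply: (n2_piece_le c i bh); rewrite /pv /pv' ?lexx ?divr_ge0 ?(ltW p0) //.
  by case: ifP => // _; rewrite invr_ge0 ltW.
case: ifP => _; first by rewrite divr_ge0 // ltW.
by rewrite -[leLHS]mul1r ler_pM2r ?invr_gt0 // ler1n.
Qed.

Section chain_bounds.
Variables (f : X -> R) (a : R).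
Hypotheses (bf : bint f) (f1 : forall x, `|f x| <= 1).
Hypotheses (fa : (\int[lam]_x `|f x|%:E <= a%:E)%E) (f2a : n2 f <= a).

Lemma chainS_norm_le J s js x : `|chainS c J s js f x| <= 2 ^+ size s.
Proof.
rewrite /chainS; elim: s js x => [|i s IH] [|j js] x /=.
- exact: f1.
- exact: f1.
- by apply: le_trans (f1 x) _; rewrite exprn_ege1 // ler1n.
rewrite exprS; apply: Sq_norm_le => //; exact: (bmf_chainS c J s js bf.1).
Qed.

Lemma chainS_L1_le J s js : 0 <= a ->
  (\int[lam]_x `|chainS c J s js f x|%:E <= (2 ^+ size s * a)%:E)%E.
Proof.
move=> a0; rewrite /chainS; elim: s js => [|i s IH] [|j js] /=.
- by rewrite mul1r.
- by rewrite mul1r.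
- by apply: (le_trans fa); rewrite lee_fin ler_peMl // exprn_ege1 // ler1n.
rewrite exprS -mulrA; apply: Sq_L1_le => //; exact: (bint_chainS c J s js bf).
Qed.

Lemma chainS_n2_le J s js : size js = size s ->
  n2 (chainS c J s js f) <= (\prod_(j <- js) dd j) * a.
Proof.
rewrite /chainS; elim: s js => [|i s IH] [|j js] //= sjs.
  by rewrite big_nil mul1r.
rewrite big_cons -mulrA; apply: le_trans (Sq_n2_le J i j (bint_chainS c J s js bf)) _.
by apply: ler_wpM2l; [exact: dd_ge0|apply: IH; case: sjs].
Qed.

Lemma chainS_abs_le J js x : size js = k ->
  (`|chainS c J (enum 'I_k) js f x|%:E <=
   foldr (fun i => Tp c i \o Fp c (fun i : 'I_k => pv R J (nth 0%N js i))
     (fun i : 'I_k => pv' R (nth 0%N js i)) i) (fun x => `|f x|%:E) (enum 'I_k) x)%E.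
Proof.
move=> sj; rewrite /chainS zip_enum // foldr_map /=.
have nf : nnm (fun x => `|f x|%:E) by exact: nnm_abs bf.1.1.
elim: (enum 'I_k) x => [|i s IH] x; first exact: lexx.
set h := foldr (fun i : 'I_k => Sq c J i (nth 0%N js i)) f s in IH *.
have bh : bmf h by rewrite /h; elim: (s) => [|i' s' bs] /=; [exact: bf.1|exact: bmf_Sq].
apply: (le_trans (Sq_abs_le J i (nth 0%N js i) x bh)).
have nh : nnm (fun x => `|h x|%:E) by exact: nnm_abs bh.1.
set G := foldr _ _ s in IH *.
have nG : nnm G.
  by apply: nnm_foldr => // i' g ng; apply: nnm_Tp; exact: nnm_Fp.
rewrite /=; apply: Tp_le; [exact: (nnmD (nnm_Ep _ _ _ nh) (nnm_Ep _ _ _ nh))|exact: nnm_Fp|].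
by move=> y; apply: (Fp_le _ _ _ _ nh nG IH).
Qed.

End chain_bounds.
End piece_bounds.

(** * Interpolation *)

Section interp.
Context d (T : measurableType d) (R : realType) (mu : {measure set T -> \bar R}).

Lemma powR_AMGM (x y al be : R) : 0 <= x -> 0 <= y -> 0 < al -> 0 < be -> al + be = 1 ->
  x `^ al * y `^ be <= al * x + be * y.
Proof.
move=> x0 y0 a0 b0 ab.
have := @conjugate_powR R (x `^ al) (y `^ be) al^-1 be^-1 (powR_ge0 _ _) (powR_ge0 _ _).
rewrite !invr_gt0 !invrK => /(_ a0 b0 ab).
by rewrite -!powRrM !mulfV ?gt_eqF // !powRr1 // [x * _]mulrC [y * _]mulrC.
Qed.

(** [t ^ q] is split into [t ^ e1 * t ^ e4 * (t ^ 2) ^ al * t ^ be]. The first two factors are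
    bounded by the suprema; the last two go through weighted AM-GM after [t ^ 2] and [t] have been
    normalized by [A2] and [A1]. *)
Lemma interp_pointwise (t B1 B4 A1 A2 e1 e4 al be q : R) :
  0 <= t -> t <= B1 -> t <= B4 -> 0 < A1 -> 0 < A2 ->
  0 <= e1 -> 0 <= e4 -> 0 < al -> 0 < be -> al + be = 1 -> e1 + e4 + (2 * al + be) = q ->
  t `^ q <= B1 `^ e1 * B4 `^ e4 * A2 `^ al * A1 `^ be *
    (al / A2 * t ^+ 2 + be / A1 * t).
Proof.
move=> t0 tB1 tB4 A10 A20 e10 e40 al0 be0 ab eq_q.
have [->|tn0] := eqVneq t 0.
  rewrite powR0; last by rewrite gt_eqF // -eq_q; lra.
  by rewrite expr0n /= !mulr0 addr0 mulr0.
have B10 : 0 <= B1 by exact: le_trans tB1.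
have B40 : 0 <= B4 by exact: le_trans tB4.
have D r s : t `^ (r + s) = t `^ r * t `^ s by rewrite powRD // tn0 implybT.
rewrite -eq_q !D -!mulrA; apply: ler_pM; rewrite ?mulr_ge0 ?powR_ge0 //.
  by apply: ge0_ler_powR.
apply: ler_pM; rewrite ?mulr_ge0 ?powR_ge0 //.
  by apply: ge0_ler_powR.
rewrite powRrM powR_mulrn //.
have E (x A r : R) : 0 <= x -> 0 < A -> x `^ r = A `^ r * (x / A) `^ r.
  by move=> x0 A0; rewrite -powRM ?divr_ge0 ?(ltW A0) // mulrCA divff ?gt_eqF // mulr1.
rewrite (E (t ^+ 2) A2) ?exprn_ge0 // (E t A1 be) //.
have AC (u v x y : R) : u * x * (v * y) = u * (v * (x * y)) by ring.
rewrite AC; apply: ler_wpM2l; first exact: powR_ge0.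
apply: ler_wpM2l; first exact: powR_ge0.
have h1 : 0 <= t ^+ 2 / A2 by rewrite divr_ge0 ?exprn_ge0 // ltW.
have h2 : 0 <= t / A1 by rewrite divr_ge0 // ltW.
apply: (le_trans (powR_AMGM h1 h2 al0 be0 ab)).
by rewrite le_eqVlt; apply/orP; left; apply/eqP; ring.
Qed.

Lemma interp_integral (h : T -> R) (B1 B4 A1 A2 e1 e4 al be q : R) :
  measurable_fun setT h -> (forall x, `|h x| <= B1) -> (forall x, `|h x| <= B4) ->
  0 < A1 -> 0 < A2 -> 0 <= B1 -> 0 <= B4 ->
  (\int[mu]_x `|h x|%:E <= A1%:E)%E -> (\int[mu]_x (h x ^+ 2)%:E <= A2%:E)%E ->
  0 <= e1 -> 0 <= e4 -> 0 < al -> 0 < be -> al + be = 1 -> e1 + e4 + (2 * al + be) = q ->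
  (\int[mu]_x (`|h x| `^ q)%:E <= (B1 `^ e1 * B4 `^ e4 * A2 `^ al * A1 `^ be)%:E)%E.
Proof.
move=> mh hB1 hB4 A10 A20 B10 B40 hA1 hA2 e10 e40 al0 be0 ab eq_q.
set K := B1 `^ e1 * B4 `^ e4 * A2 `^ al * A1 `^ be.
have K0 : 0 <= K by rewrite /K !mulr_ge0 // powR_ge0.
have nabs : nnm (fun x => `|h x|%:E).
  split => [|x]; last by rewrite lee_fin.
  by apply/measurable_EFinP; exact: measurableT_comp.
have nsq : nnm (fun x => (h x ^+ 2)%:E).
  split => [|x]; last by rewrite lee_fin sqr_ge0.
  by apply/measurable_EFinP; exact: measurable_funX.
have c1 : 0 <= K * (al / A2) by rewrite mulr_ge0 // divr_ge0 // ltW.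
have c2 : 0 <= K * (be / A1) by rewrite mulr_ge0 // divr_ge0 // ltW.
have nz a (g : T -> \bar R) : 0 <= a -> nnm g -> nnm (fun x => a%:E * g x)%E.
  move=> a0 [mg g0]; split => [|x]; last exact: mule_ge0.
  exact: measurable_funeM.
have z1 := nz _ _ c1 nsq; have z2 := nz _ _ c2 nabs.
apply: (@le_trans _ _ (\int[mu]_x ((K * (al / A2))%:E * (h x ^+ 2)%:E + (K * (be / A1))%:E * `|h x|%:E))%E).
  apply: nnm_le_integral.
  - split => [|x]; last by rewrite lee_fin powR_ge0.
    apply/measurable_EFinP; apply: (measurableT_comp (@measurable_powR R q)).
    exact: measurableT_comp.
  - split => [|x]; last by apply: adde_ge0; [exact: z1.2|exact: z2.2].
    exact: emeasurable_funD z1.1 z2.1.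
  - move=> x; rewrite -!EFinM -EFinD lee_fin.
    apply: (le_trans (interp_pointwise (normr_ge0 _) (hB1 x) (hB4 x) A10 A20 e10 e40 al0 be0 ab eq_q)).
    rewrite -/K real_normK ?num_real // mulrDr !mulrA //.
rewrite (ge0_integralD mu measurableT (fun x _ => z1.2 x) z1.1 (fun x _ => z2.2 x) z2.1).
rewrite (ge0_integralZl_EFin mu measurableT (fun x _ => nsq.2 x) nsq.1 c1).
rewrite (ge0_integralZl_EFin mu measurableT (fun x _ => nabs.2 x) nabs.1 c2).
apply: (@le_trans _ _ ((K * (al / A2))%:E * A2%:E + (K * (be / A1))%:E * A1%:E)%E).
  by apply: leeD; apply: lee_wpmul2l; rewrite ?lee_fin.
rewrite -!EFinM -EFinD lee_fin.
(* The normalization pays off: each of the two terms integrates to its own weight, and the weights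
   add up to 1. *)
have -> : K * (al / A2) * A2 + K * (be / A1) * A1 = K * (al + be).
  by field; rewrite !gt_eqF.
by rewrite ab mulr1.
Qed.

(** [t1], [t2], [t3], [t4] weight the refined sup bound, the [L^2] bound, the [L^1] bound and the
    trivial sup bound. With [al = t2 / 2 * q] and [be = t3 * q], the relation for [q^-1] says
    [al + be = 1], and total weight 1 makes the exponents of [t] add up to [q]. *)
Lemma Lnorm_interp (h : T -> R) (B1 B4 A1 A2 t1 t2 t3 t4 q : R) :
  measurable_fun setT h -> (forall x, `|h x| <= B1) -> (forall x, `|h x| <= B4) ->
  0 < A1 -> 0 < A2 -> 0 <= B1 -> 0 <= B4 ->
  (\int[mu]_x `|h x|%:E <= A1%:E)%E -> (\int[mu]_x (h x ^+ 2)%:E <= A2%:E)%E ->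
  0 <= t1 -> 0 < t2 -> 0 < t3 -> 0 <= t4 -> t1 + t2 + t3 + t4 = 1 -> t2 / 2 + t3 = q^-1 ->
  ('N[mu]_q%:E[EFin \o h] <=
    (B1 `^ t1 * B4 `^ t4 * A2 `^ (t2 / 2) * A1 `^ t3)%:E)%E.
Proof.
move=> mh hB1 hB4 A10 A20 B10 B40 hA1 hA2 t10 t20 t30 t40 ts tq.
have q0 : 0 < q by rewrite -invr_gt0 -tq; lra.
set K := B1 `^ t1 * B4 `^ t4 * A2 `^ (t2 / 2) * A1 `^ t3.
have K0 : 0 <= K by rewrite /K !mulr_ge0 // powR_ge0.
have qq : q * q^-1 = 1 by rewrite mulfV // gt_eqF.
have e1 : 0 <= t1 * q by rewrite mulr_ge0 // ltW.
have e4 : 0 <= t4 * q by rewrite mulr_ge0 // ltW.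
have al0 : 0 < t2 / 2 * q by rewrite mulr_gt0 // divr_gt0.
have be0 : 0 < t3 * q by rewrite mulr_gt0.
have ab : t2 / 2 * q + t3 * q = 1 by rewrite -mulrDl tq mulrC.
have eq_q : t1 * q + t4 * q + (2 * (t2 / 2 * q) + t3 * q) = q.
  have -> : t1 * q + t4 * q + (2 * (t2 / 2 * q) + t3 * q) = (t1 + t2 + t3 + t4) * q by field.
  by rewrite ts mul1r.
have H := interp_integral mh hB1 hB4 A10 A20 B10 B40 hA1 hA2 e1 e4 al0 be0 ab eq_q.
rewrite (powRrM _ t1 q) (powRrM _ t4 q) (powRrM _ (t2 / 2) q) (powRrM _ t3 q) -!powRM ?mulr_ge0 ?powR_ge0 // -/K in H.
rewrite unlock.
apply: (@le_trans _ _ ((K `^ q)%:E `^ q^-1)%E); last first.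
  by rewrite poweR_EFin -powRrM qq powRr1.
have hr : 0 <= q^-1 by rewrite invr_ge0 ltW.
apply: (gt0_ler_poweR hr).
- by rewrite in_itv /= leey andbT; apply: integral_ge0 => x _; rewrite lee_fin powR_ge0.
- by rewrite in_itv /= leey andbT lee_fin powR_ge0.
- exact: H.
Qed.

Lemma Lnorm_sum (I : Type) (r : seq I) (F : I -> T -> R) q : 1 <= q ->
  (forall t, measurable_fun setT (F t)) ->
  ('N[mu]_q%:E[EFin \o (fun x => (\sum_(t <- r) F t x)%R)] <=
   \sum_(t <- r) 'N[mu]_q%:E[EFin \o F t])%E.
Proof.
move=> q1 mF; elim: r => [|t r IH].
  rewrite big_nil (_ : _ \o _ = cst 0%E); last by apply/funext => x /=; rewrite big_nil.
  by rewrite Lnorm0 // eqe gt_eqF // (lt_le_trans ltr01).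
rewrite big_cons.
have ms : measurable_fun setT (fun x => \sum_(t <- r) F t x) by exact: measurable_sum.
apply: (@le_trans _ _ ('N[mu]_q%:E[EFin \o F t] + 'N[mu]_q%:E[EFin \o (fun x => \sum_(t <- r) F t x)%R])%E).
  apply: le_trans (minkowski_EFin mu (mF t) ms q1).
  rewrite le_eqVlt; apply/orP; left; apply/eqP; apply: eq_Lnorm => x /=.
  by rewrite big_cons.
exact: leeD.
Qed.

End interp.

(** * Selecting the smallest indices *)

Lemma min_subset_set k (f : 'I_k -> nat) l : (l <= k)%N ->
  exists2 A : {set 'I_k}, #|A| = l & (k * \sum_(i in A) f i <= l * \sum_i f i)%N.
Proof.
move=> lk; rewrite -(subKn lk); elim: (k - l)%N => [|m [A cA HA]].
  rewrite subn0; exists [set: 'I_k]%SET; first by rewrite cardsT card_ord.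
  by rewrite (eq_bigl xpredT) // => i; rewrite inE.
(* The induction removes one element at a time from the full set; once [k <= m] the truncated
   subtraction is 0 and the empty set serves. *)
have [km|mk] := leqP k m.
  have e0 : (k - m.+1 = 0)%N by apply/eqP; rewrite subn_eq0 (leq_trans km).
  rewrite e0; exists (finset.set0 : {set 'I_k}); first by rewrite cards0.
  by rewrite big_set0 muln0.
have cA1 : #|A| = (k - m.+1).+1 by rewrite cA subnSK.
have [i0 i0A] : exists i, i \in A by apply/card_gt0P; rewrite cA1.
(* Discarding a largest value cannot raise the mean: each of the [n] remaining values is at most
   [f i]. *)
pose i := [arg max_(i > i0 in A) f i].
have [iA imax] : i \in A /\ forall j, j \in A -> (f j <= f i)%N.
  by rewrite /i; case: arg_maxnP.
set n := (k - m.+1)%N in cA1 *.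
exists (A :\ i)%SET.
  by apply/eqP; rewrite -(eqn_add2l 1) -[X in (X + _)%N]/(true : nat) -iA -cardsD1 cA1 add1n.
have := HA; rewrite cA in cA1; rewrite cA1 (big_setD1 i) //=.
set S' := (\sum_(_ in _) _)%N; set T := (\sum_i _)%N => HA'.
have avg : (S' <= n * f i)%N.
  rewrite /S'; apply: (@leq_trans (\sum_(j in (A :\ i)%SET) f i)).
    by apply: leq_sum => j; rewrite !inE => /andP[_ /imax].
  rewrite sum_nat_const leq_mul2r; apply/orP; right.
  have : #|A| = n.+1 by rewrite cA.
  by rewrite (cardsD1 i A) iA add1n => -[->].
rewrite -(leq_pmul2l (ltn0Sn n)) mulnA [(n.+1 * k)%N]mulnC -mulnA.
apply: (@leq_trans (k * (n * (f i + S')))).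
  by rewrite leq_mul2l mulSn mulnDr leq_add2r avg orbT.
by rewrite mulnCA [leqRHS]mulnCA leq_mul2l HA' orbT.
Qed.

(** The selected set is listed in increasing order, because invertibility of [rowsub s c] is assumed
    for increasing selections. *)
Lemma min_subset k (f : 'I_k -> nat) l : (l <= k)%N ->
  exists2 s : 'I_l -> 'I_k, {homo s : i j / (i < j)%N} &
    (k * \sum_(i < l) f (s i) <= l * \sum_i f i)%N.
Proof.
move=> lk; have [A cA HA] := min_subset_set f lk.
case: l lk cA HA => [|l] lk cA HA.
  have s (i : 'I_0) : 'I_k by case: i.
  exists s; first by case.
  by rewrite big_ord0 muln0.
have sz : size (enum A) = l.+1 by rewrite -cardE.
have [i0 _] : exists i, i \in A by apply/card_gt0P; rewrite cA.
exists (fun i : 'I_l.+1 => nth i0 (enum A) i).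
  have so : sorted (fun i j : 'I_k => (i < j)%N) (enum A).
    have -> : enum A = [seq i <- enum 'I_k | i \in A] by rewrite [in RHS]enumT.
    apply: sorted_filter; first by move=> x y z; exact: ltn_trans.
    have : sorted ltn (map val (enum 'I_k)) by rewrite val_enum_ord iota_ltn_sorted.
    by rewrite sorted_map.
  move=> i j ij; apply: (sorted_ltn_nth _ i0 so) => //.
  - by move=> x y z; exact: ltn_trans.
  - by rewrite inE sz.
  - by rewrite inE sz.
rewrite (_ : (\sum_(i < l.+1) _ = \sum_(i in A) f i)%N) //.
by rewrite -[RHS]big_enum /= (big_nth i0) sz big_mkord.
Qed.

(** * Series and powers *)

Section geom.
Variable R : realType.

Lemma arith_geom_bound (z : R) : 0 <= z -> z < 1 ->
  exists2 W, 0 <= W & forall J, \sum_(j <- iota 0 J) (j.+1%:R * z ^+ j) <= W.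
Proof.
move=> z0 z1; have h : 0 < 1 - z by rewrite subr_gt0.
exists ((1 - z) ^- 2); first by rewrite invr_ge0 exprn_ge0 // ltW.
move=> J; rewrite -[leRHS]mul1r ler_pdivlMr ?exprn_gt0 //.
(* The closed form of the partial sum, cleared of its denominator [(1 - z) ^+ 2]; what is subtracted
   from 1 dominates what is added. *)
have -> : (\sum_(j <- iota 0 J) (j.+1%:R * z ^+ j)) * (1 - z) ^+ 2 =
   1 - J.+1%:R * z ^+ J + J%:R * z ^+ J.+1.
  elim: J => [|J IH]; first by rewrite big_nil mul0r expr0 mulr1 mul0r subrr addr0.
  rewrite -(addn1 J) iotaD big_cat big_seq1 mulrDl IH add0n addn1.
  by rewrite !exprS -!natr1; ring.
rewrite -addrA gerDl addrC subr_le0 exprS mulrCA -natr1 mulrDl mul1r.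
apply: (@le_trans _ _ (J%:R * z ^+ J)); last by rewrite lerDl exprn_ge0.
by rewrite ler_piMl ?(ltW z1) // mulr_ge0 // exprn_ge0.
Qed.

Lemma expr_small (z e : R) : 0 <= z -> z < 1 -> 0 < e -> exists J, z ^+ J < e.
Proof.
move=> z0 z1 e0.
have zc : `|z| < 1 by rewrite ger0_norm.
have := cvg_expr zc => /cvgrPdist_lt /(_ e e0) [N _ H].
exists N; have := H N (leqnn N); rewrite sub0r normrN ger0_norm // exprn_ge0 //.
Qed.

End geom.

Section powR_aux.
Variable R : realType.

Lemma powR_prod (I : Type) (r : seq I) (F : I -> R) (p : R) : (forall i, 0 <= F i) ->
  (\prod_(i <- r) F i) `^ p = \prod_(i <- r) F i `^ p.
Proof.
move=> F0; elim: r => [|i r IH]; first by rewrite !big_nil powR1.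
by rewrite !big_cons powRM ?IH // prodr_ge0.
Qed.

Lemma powR2_nat (d : R) (j : nat) : (2 : R) `^ (d * j%:R) = (2 `^ d) ^+ j.
Proof. by rewrite powRrM powR_mulrn // powR_ge0. Qed.

Lemma powR_sum_nat (d : R) (js : seq nat) :
  \prod_(j <- js) (2 `^ d) ^+ j = (2 : R) `^ (d * (\sum_(j <- js) j)%:R).
Proof.
elim: js => [|j js IH]; first by rewrite !big_nil mulr0 powRr0.
by rewrite !big_cons IH natrD mulrDr powRD ?powR2_nat // pnatr_eq0 implybT.
Qed.

Lemma powR2N_lt1 (d : R) : 0 < d -> 0 <= (2 : R) `^ (- d) < 1.
Proof.
move=> d0; rewrite powR_ge0 powRN invf_lt1 ?powR_gt0 //=.
rewrite -[ltLHS](powRr0 2).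
have := @gt0_ltr_powR R d d0 1 2; rewrite !nnegrE powR1 powRr0; apply => //.
by rewrite ltr1n.
Qed.

Lemma dd_powR_le (eta : R) j : 0 <= eta -> eta <= 1 ->
  dd R j `^ eta <= 10 * (j.+1%:R * (2 `^ (- eta)) ^+ j).
Proof.
move=> e0 e1; have j1 : 1 <= 10 * j.+1%:R :> R.
  have : 1 <= j.+1%:R :> R by rewrite ler1n.
  lra.
have p0 : 0 < 2 ^+ j :> R by rewrite exprn_gt0.
rewrite /dd powRM ?invr_ge0 ?(ltW p0) ?(le_trans ler01) //.
rewrite mulrA; apply: ler_pM; rewrite ?powR_ge0 //; first exact: ler1_powR.
rewrite -powR2_nat mulNr powRN -powR_inv1 ?(ltW p0) // -powRrM mulN1r powRN.
by rewrite mulrC powRrM powR_mulrn.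
Qed.
End powR_aux.

(** * The [L^oo] bound of a piece with the smallest indices *)

Section sup_nonres.
Variables (R : realType) (k l : nat) (c : 'M[R]_(k, l)).
Local Notation X := 'rV[R]_(k + l).
Local Notation lam := (lebesgue_rV R (k + l)).
Hypotheses (hlk : (l <= k)%N).
Hypothesis hc : forall s : 'I_l -> 'I_k, {homo s : i j / (i < j)%N} ->
      rowsub s c \in unitmx.

Lemma sup_bound_uniform : exists2 kappa : R, 0 < kappa &
  forall (s : 'I_l -> 'I_k), {homo s : i j / (i < j)%N} ->
  forall a v v' : 'I_k -> R,
    (forall j, 0 < a (s j)) -> (forall j, a (s j) <= v (s j)) ->
    (forall j, a (s j) <= v' (s j)) -> forall g : X -> \bar R, nnm g -> forall x,
    (foldr (fun i => Tp c i \o Fp c v v' i) g (enum 'I_k) x <=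
    (kappa * \prod_j (a (s j))^-1)%:E * \int[lebesgue_rV R (k + l)]_u g u)%E.
Proof.
(* There are finitely many selections. Viewing them as finite functions allows their constants to be
   summed into one; selections that are not increasing receive 0. *)
have H (s : {ffun 'I_l -> 'I_k}) : exists kap : R, 0 <= kap /\
  ({homo s : i j / (i < j)%N} ->
  forall a v v' : 'I_k -> R,
    (forall j, 0 < a (s j)) -> (forall j, a (s j) <= v (s j)) ->
    (forall j, a (s j) <= v' (s j)) -> forall g : X -> \bar R, nnm g -> forall x,
    (foldr (fun i => Tp c i \o Fp c v v' i) g (enum 'I_k) x <=
    (kap * \prod_j (a (s j))^-1)%:E * \int[lebesgue_rV R (k + l)]_u g u)%E).
  have [hs|hs] := pselect ({homo s : i j / (i < j)%N}); last by exists 0.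
  by have [kap k0 Hk] := sup_bound hs (hc hs); exists kap.
have [kap Hkap] := choice H.
exists (1 + \sum_s kap s).
  by rewrite ltr_pwDl // sumr_ge0 // => s _; have [] := Hkap s.
move=> s hs a v v' a0 av av' g ng x.
pose s' := [ffun i => s i].
have ss : s' = s :> ('I_l -> 'I_k) by apply/funext => i; rewrite ffunE.
have [k0 Hk] := Hkap s'; rewrite ss in Hk.
apply: (le_trans (Hk hs a v v' a0 av av' g ng x)).
apply: lee_wpmul2r; first by apply: integral_ge0 => u _; exact: ng.2.
rewrite lee_fin ler_wpM2r //.
  by apply: prodr_ge0 => j _; rewrite invr_ge0 ltW.
rewrite (bigD1 s') //= addrCA lerDl addr_ge0 // sumr_ge0 // => s2 _.
by have [] := Hkap s2.
Qed.

(** The letter [J.+1] is excluded, so every vertical height is at least [2^(-j)]. The exponent [sg]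
    is kept as an integer, and the ratio [l / k] appears only as an inequality in [nat]. *)
Lemma sup_nonres : exists2 kappa : R, 0 < kappa &
  forall (f : X -> R) (a : R), bint f -> (\int[lam]_x `|f x|%:E <= a%:E)%E ->
  forall J js, size js = k -> all (fun j => j <= J)%N js ->
  exists2 sg : nat, (k * sg <= l * \sum_(j <- js) j)%N &
    forall x, `|chainS c J.+1 (enum 'I_k) js f x| <= kappa * 2 ^+ sg * a.
Proof.
have [kap k0 Hk] := sup_bound_uniform; exists kap => // f a bf fa J js sj hjs.
have [s hs Hs] := min_subset (fun i : 'I_k => nth 0%N js i) hlk.
exists (\sum_(i < l) nth 0%N js (s i))%N.
  by apply: (leq_trans Hs); rewrite (big_nth 0%N) sj big_mkord.
move=> x; rewrite -lee_fin.
apply: (le_trans (chainS_abs_le c bf J.+1 x sj)).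
pose w (i : 'I_k) : R := (2 ^+ nth 0%N js i)^-1.
have p0 n : 0 < 2 ^+ n :> R by rewrite exprn_gt0.
apply: (le_trans (Hk s hs w _ _ _ _ _ _ (nnm_abs bf.1.1) x)).
- by move=> j; rewrite /w invr_gt0.
- move=> j; rewrite /w /pv ltn_eqF // ltnS.
  by move/allP: hjs; apply; apply: mem_nth; rewrite sj.
- move=> j; rewrite /w /pv' -[leLHS]mul1r ler_pM2r ?invr_gt0 // ler1n //.
rewrite [(_ * a)%:E]EFinM; apply: lee_pmul.
- rewrite lee_fin mulr_ge0 ?(ltW k0) //; apply: prodr_ge0 => j _.
  by rewrite /w invrK ltW.
- by apply: integral_ge0 => u _; rewrite lee_fin.
- rewrite lee_fin ler_wpM2l ?(ltW k0) // /w.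
  under eq_bigr do rewrite invrK.
  by rewrite prodrXr.
- exact: fa.
Qed.
End sup_nonres.

(** * Characteristic functions, and the passage to strong type *)

Section restricted.
Variables (R : realType) (k l : nat) (c : 'M[R]_(k, l)).
Local Notation X := 'rV[R]_(k + l).
Local Notation lam := (lebesgue_rV R (k + l)).
Hypotheses (hlk : (l <= k)%N) (k0 : (0 < k)%N).
Hypothesis hc : forall s : 'I_l -> 'I_k, {homo s : i j / (i < j)%N} ->
      rowsub s c \in unitmx.
(* [r] is [1/q] and [x + r] is the exponent [s] of the restricted estimate; [eta] is
   the weight with which the [L^2] bound enters the interpolation. *)
Variables (x r eta dl : R).
Hypotheses (x0 : 0 <= x) (dl0 : 0 < dl).
Hypothesis etaE : eta = l%:R * x / k%:R + dl.
Hypotheses (er : eta < r) (es : x + r + eta <= 1) (r1 : r <= 1).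
Let kR : 0 < k%:R :> R. Proof. by rewrite ltr0n. Qed.

Let eta0 : 0 < eta.
Proof. by rewrite etaE ltr_wpDl // divr_ge0 ?mulr_ge0 // ltW. Qed.
Let eta1 : eta <= 1. Proof. by move: es er eta0 x0; lra. Qed.

Section one.
Variables (f : X -> R) (a : R).
Hypotheses (bf : bint f) (f1 : forall x, `|f x| <= 1) (a0 : 0 < a).
Hypotheses (fa : (\int[lam]_x `|f x|%:E <= a%:E)%E) (f2a : n2 f <= a).

Let K : R := 2 ^+ k.
Let K0 : 0 < K. Proof. by rewrite exprn_gt0. Qed.

(** [Lnorm_interp] with weights [x], [2 * eta], [r - eta], [1 - x - eta - r]. The refined sup bound
    [B] is left free: it depends on whether the word contains the residual letter. *)
Lemma piece_Lnorm_le J js (B : R) : size js = k -> 0 <= B ->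
  (forall y, `|chainS c J (enum 'I_k) js f y| <= B) ->
  ('N[lam]_(r^-1)%:E[EFin \o chainS c J (enum 'I_k) js f] <=
   (B `^ x * K `^ (1 - x - eta - r) * (\prod_(j <- js) dd R j * a) `^ eta * (K * a) `^ (r - eta))%:E)%E.
Proof.
move=> sj B0 hB.
have bC := bint_chainS c J (enum 'I_k) js bf.
have ddp j : 0 < dd R j by rewrite /dd divr_gt0 ?exprn_gt0 // mulr_gt0.
have D0 : 0 < \prod_(j <- js) dd R j by apply: prodr_gt0 => j _.
have A2 : 0 < \prod_(j <- js) dd R j * a by rewrite mulr_gt0.
have A1 : 0 < K * a by rewrite mulr_gt0.
have hB4 y : `|chainS c J (enum 'I_k) js f y| <= K.
  by have := chainS_norm_le c bf f1 J (enum 'I_k) js y; rewrite size_enum_ord.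
have hA1 : (\int[lam]_y `|chainS c J (enum 'I_k) js f y|%:E <= (K * a)%:E)%E.
  by have := chainS_L1_le c bf fa J (enum 'I_k) js (ltW a0); rewrite size_enum_ord.
have hA2 : (\int[lam]_y (chainS c J (enum 'I_k) js f y ^+ 2)%:E <= (\prod_(j <- js) dd R j * a)%:E)%E.
  rewrite -(n2E bC) lee_fin; apply: chainS_n2_le => //.
  by rewrite size_enum_ord.
have t2 : 0 < 2 * eta by rewrite mulr_gt0.
have t3 : 0 < r - eta by rewrite subr_gt0.
have t4 : 0 <= 1 - x - eta - r by move: es; lra.
have ts : x + 2 * eta + (r - eta) + (1 - x - eta - r) = 1 by ring.
have tq : 2 * eta / 2 + (r - eta) = r^-1^-1 by rewrite invrK; field.
have := Lnorm_interp bC.1.1 hB hB4 A1 A2 B0 (ltW K0) hA1 hA2 x0 t2 t3 t4 ts tq.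
by have -> : 2 * eta / 2 = eta by field.
Qed.

Let z : R := 2 `^ (- dl).
Let y2 : R := 2 `^ (- (eta / 2)).

(** With [S] the sum of the letters, the [L^oo] bound grows at most like [2^(l * x / k * S)] and the
    [L^2] bound decays like [2^(- eta * S)]; by the choice of [eta] the net rate is [2^(- dl * S)].
    The powers of [a] add up to [x + eta + (r - eta) = x + r]. *)
Lemma nonres_le kappa J js : size js = k -> all (fun j => j <= J)%N js -> 0 < kappa ->
  (exists2 sg : nat, (k * sg <= l * \sum_(j <- js) j)%N &
    forall y, `|chainS c J.+1 (enum 'I_k) js f y| <= kappa * 2 ^+ sg * a) ->
  ('N[lam]_(r^-1)%:E[EFin \o chainS c J.+1 (enum 'I_k) js f] <=
   (kappa `^ x * K `^ (1 - x - eta - r) * K `^ (r - eta) * a `^ (x + r) *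
     \prod_(j <- js) (10 * (j.+1%:R * z ^+ j)))%:E)%E.
Proof.
move=> sj hj kap0 [sg hsg hB].
have B0 : 0 <= kappa * 2 ^+ sg * a by rewrite !mulr_ge0 ?exprn_ge0 // ltW.
apply: (le_trans (piece_Lnorm_le sj B0 hB)); rewrite lee_fin.
set S := (\sum_(j <- js) j)%N in hsg.
have ddp j : 0 <= dd R j by exact: dd_ge0.
have D0 : 0 <= \prod_(j <- js) dd R j by apply: prodr_ge0 => j _.
have s0 : 0 <= 2 ^+ sg :> R by rewrite exprn_ge0.
have aa : a `^ (x + r) = a `^ x * a `^ eta * a `^ (r - eta).
  have Da u v : a `^ (u + v) = a `^ u * a `^ v by rewrite powRD // (gt_eqF a0) implybT.
  have -> : x + r = x + eta + (r - eta) by ring.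
  by rewrite (Da (x + eta)) (Da x).
rewrite (powRM x (mulr_ge0 (ltW kap0) s0) (ltW a0)) (powRM x (ltW kap0) s0).
rewrite (powRM eta D0 (ltW a0)) (powRM (r - eta) (ltW K0) (ltW a0)) aa.
have main : (2 ^+ sg) `^ x * (\prod_(j <- js) dd R j) `^ eta <=
    \prod_(j <- js) (10 * (j.+1%:R * z ^+ j)).
  apply: (@le_trans _ _ (2 `^ (l%:R * x / k%:R * S%:R) * \prod_(j <- js) (10 * (j.+1%:R * (2 `^ (- eta)) ^+ j)))).
    apply: ler_pM; rewrite ?powR_ge0 //.
      rewrite -powR_mulrn // -powRrM; apply: ler_powR; first by rewrite ler1n.
      have -> : l%:R * x / k%:R * S%:R = x * (l * S)%:R / k%:R by rewrite natrM; ring.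
      rewrite ler_pdivlMr //.
      have -> : sg%:R * x * k%:R = x * (k * sg)%:R by rewrite natrM; ring.
      by apply: ler_wpM2l => //; rewrite ler_nat.
    rewrite powR_prod //; apply: ler_prod => j _.
    by rewrite powR_ge0 dd_powR_le // ltW.
  rewrite -powR_sum_nat -big_split /=; apply: ler_prod => j _.
  rewrite !mulr_ge0 ?exprn_ge0 ?powR_ge0 //=.
  have zE : z = 2 `^ (l%:R * x / k%:R) * 2 `^ (- eta).
    rewrite -powRD ?pnatr_eq0 ?implybT // /z; congr (_ `^ _).
    by rewrite etaE opprD addrA subrr add0r.
  by rewrite zE exprMn le_eqVlt; apply/orP; left; apply/eqP; ring.
set P := \prod_(j <- js) _ in main *.
have -> : kappa `^ x * (2 ^+ sg) `^ x * a `^ x * K `^ (1 - x - eta - r) *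
   ((\prod_(j <- js) dd R j) `^ eta * a `^ eta) * (K `^ (r - eta) * a `^ (r - eta)) =
   (kappa `^ x * K `^ (1 - x - eta - r) * K `^ (r - eta) * (a `^ x * a `^ eta * a `^ (r - eta))) *
    ((2 ^+ sg) `^ x * (\prod_(j <- js) dd R j) `^ eta) by ring.
by apply: ler_wpM2l => //; rewrite !mulr_ge0 ?powR_ge0.
Qed.

(** Only the trivial sup bound [K] is at hand. The decay [2^(- eta * S)] is split in two halves: one
    keeps the sum over words bounded, the other yields the factor [y2 ^+ J]. The resulting power of
    [a] is not the desired one, but these pieces disappear in the limit. *)
Lemma res_le J js : size js = k -> J.+1 \in js ->
  ('N[lam]_(r^-1)%:E[EFin \o chainS c J.+1 (enum 'I_k) js f] <=
   (K `^ x * K `^ (1 - x - eta - r) * a `^ eta * (K * a) `^ (r - eta) * y2 ^+ J *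
     \prod_(j <- js) (10 * (j.+1%:R * y2 ^+ j)))%:E)%E.
Proof.
move=> sj Jjs.
have hB y : `|chainS c J.+1 (enum 'I_k) js f y| <= K.
  by have := chainS_norm_le c bf f1 J.+1 (enum 'I_k) js y; rewrite size_enum_ord.
apply: (le_trans (piece_Lnorm_le sj (ltW K0) hB)); rewrite lee_fin.
have D0 : 0 <= \prod_(j <- js) dd R j by apply: prodr_ge0 => j _; exact: dd_ge0.
rewrite (powRM eta D0 (ltW a0)).
have /andP[y20 y21] : 0 <= y2 < 1 by apply: powR2N_lt1; rewrite divr_gt0.
have main : (\prod_(j <- js) dd R j) `^ eta <=
   y2 ^+ J * \prod_(j <- js) (10 * (j.+1%:R * y2 ^+ j)).
  rewrite powR_prod => [|j]; last exact: dd_ge0.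
  apply: (@le_trans _ _ (\prod_(j <- js) (y2 ^+ j * (10 * (j.+1%:R * y2 ^+ j))))).
    apply: ler_prod => j _; rewrite powR_ge0 /=.
    apply: le_trans (dd_powR_le _ (ltW eta0) eta1) _.
    have -> : 2 `^ (- eta) = y2 * y2 :> R.
      rewrite /y2 -powRD ?pnatr_eq0 ?implybT //; congr (_ `^ _); by field.
    by rewrite exprMn le_eqVlt; apply/orP; left; apply/eqP; ring.
  rewrite big_split /=; apply: ler_wpM2r.
    by apply: prodr_ge0 => j _; rewrite !mulr_ge0 ?exprn_ge0.
  rewrite prodrXr ler_wiXn2l ?(ltW y21) //.
  by rewrite (big_rem _ Jjs) /= (leq_trans (leqnSn J)) // leq_addr.
have -> : K `^ x * K `^ (1 - x - eta - r) * ((\prod_(j <- js) dd R j) `^ eta * a `^ eta) *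
  (K * a) `^ (r - eta) = K `^ x * K `^ (1 - x - eta - r) * a `^ eta * (K * a) `^ (r - eta) *
   (\prod_(j <- js) dd R j) `^ eta by ring.
rewrite -[leRHS]mulrA; apply: ler_wpM2l => //.
by rewrite !mulr_ge0 ?powR_ge0.
Qed.
End one.

Lemma restricted_le : exists2 C : R, 0 <= C & forall (f : X -> R) (a : R),
  bint f -> (forall x, `|f x| <= 1) -> 0 < a ->
  (\int[lam]_x `|f x|%:E <= a%:E)%E -> n2 f <= a ->
  ('N[lam]_(r^-1)%:E[EFin \o foldr (rT c) f (enum 'I_k)] <= (C * a `^ (x + r))%:E)%E.
Proof.
have [kap kap0 Hk] := sup_nonres hlk hc.
pose z : R := 2 `^ (- dl); pose y2 : R := 2 `^ (- (eta / 2)).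
have /andP[z0 z1] : 0 <= z < 1 by exact: powR2N_lt1.
have /andP[y20 y21] : 0 <= y2 < 1 by apply: powR2N_lt1; rewrite divr_gt0.
have [Wz Wz0 HWz] := arith_geom_bound z0 z1.
have [Wy Wy0 HWy] := arith_geom_bound y20 y21.
set K : R := 2 ^+ k.
have K0 : 0 < K by rewrite exprn_gt0.
pose C1 := kap `^ x * K `^ (1 - x - eta - r) * K `^ (r - eta).
have C10 : 0 <= C1 by rewrite !mulr_ge0 ?powR_ge0.
exists (C1 * (10 * Wz) ^+ k); first by apply: mulr_ge0 => //; apply: exprn_ge0; exact: mulr_ge0.
move=> f a bf f1 a0 fa f2a.
pose C2 := K `^ x * K `^ (1 - x - eta - r) * a `^ eta * (K * a) `^ (r - eta).
have C20 : 0 <= C2 by rewrite !mulr_ge0 ?powR_ge0.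
have r0 : 0 < r by exact: lt_trans er.
have q1 : 1 <= r^-1 by rewrite invf_ge1.
have HJ J : ('N[lam]_(r^-1)%:E[EFin \o foldr (rT c) f (enum 'I_k)] <=
   (C1 * (10 * Wz) ^+ k * a `^ (x + r) + C2 * (10 * Wy) ^+ k * y2 ^+ J)%:E)%E.
  have CE := chain_pieces c J (enum 'I_k) bf.1; rewrite size_enum_ord in CE.
  rewrite CE.
  have mC js : measurable_fun setT (chainS c J.+1 (enum 'I_k) js f).
    exact: (bmf_chainS c J.+1 (enum 'I_k) js bf.1).1.
  apply: (le_trans (Lnorm_sum _ _ q1 mC)).
  pose wz j : R := 10 * (j.+1%:R * z ^+ j); pose wy j : R := 10 * (j.+1%:R * y2 ^+ j).
  have wz0 j : 0 <= wz j by rewrite !mulr_ge0 ?exprn_ge0.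
  have wy0 j : 0 <= wy j by rewrite !mulr_ge0 ?exprn_ge0.
  (* Each word obeys one of the two bounds, hence their sum; both sums can then run over all words
     and factor. *)
  apply: (@le_trans _ _ (\sum_(js <- allseqs J k)
     (C1 * a `^ (x + r) * \prod_(j <- js) wz j + C2 * y2 ^+ J * \prod_(j <- js) wy j)%:E)%E).
    rewrite big_seq [X in (_ <= X)%E]big_seq; apply: lee_sum => js /mem_allseqs[sj hj].
    have P1 : 0 <= \prod_(j <- js) wz j by apply: prodr_ge0 => j _.
    have P2 : 0 <= \prod_(j <- js) wy j by apply: prodr_ge0 => j _.
    have [Jjs|Jjs] := boolP (J.+1 \in js).
      apply: (le_trans (res_le bf f1 a0 fa f2a sj Jjs)).
      rewrite lee_fin; apply: ler_wpDl; last exact: lexx.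
      by apply: mulr_ge0 => //; apply: mulr_ge0 => //; exact: powR_ge0.
    have hj' : all (fun j => j <= J)%N js.
      apply/allP => j jj; have := allP hj j jj; rewrite leq_eqVlt ltnS.
      by case/orP => [/eqP je|//]; case/negP: Jjs; rewrite -je.
    apply: (le_trans (nonres_le bf f1 a0 fa f2a sj hj' kap0 (Hk f a bf fa J js sj hj'))).
    rewrite lee_fin; apply: ler_wpDr; last exact: lexx.
    by apply: mulr_ge0 => //; apply: mulr_ge0 => //; exact: exprn_ge0.
  rewrite sumEFin lee_fin big_split /= -!mulr_sumr !sum_allseqs_prod.
  apply: lerD.
    rewrite mulrAC; apply: ler_wpM2r; first exact: powR_ge0.
    apply: ler_wpM2l => //; apply: lerXn2r; rewrite ?nnegrE ?mulr_ge0 //.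
      by apply: sumr_ge0.
    by rewrite -mulr_sumr ler_wpM2l.
  rewrite mulrAC; apply: ler_wpM2r; first exact: exprn_ge0.
  apply: ler_wpM2l => //; apply: lerXn2r; rewrite ?nnegrE ?mulr_ge0 //.
    by apply: sumr_ge0.
  by rewrite -mulr_sumr ler_wpM2l.
(* The left-hand side does not depend on [J], so [J] may be taken large enough to make the residual
   part smaller than [e]. Using [1 + D] avoids a division by zero. *)
apply/lee_addgt0Pr => e e0.
pose D := C2 * (10 * Wy) ^+ k.
have D0 : 0 <= D by apply: mulr_ge0 => //; apply: exprn_ge0; exact: mulr_ge0.
have [J HJe] := expr_small y20 y21 (divr_gt0 e0 (ltr_pwDl ltr01 D0)).
apply: (le_trans (HJ J)); rewrite -EFinD lee_fin lerD2l -/D.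
apply: (@le_trans _ _ ((1 + D) * y2 ^+ J)).
  by rewrite ler_wpM2r ?exprn_ge0 // lerDr.
by rewrite mulrC -ler_pdivlMr ?ltW // ltr_pwDl.
Qed.
End restricted.

(** * Monotonicity and limits of [L^q] norms *)

Section Lnorm_more.
Context d (T : measurableType d) (R : realType) (mu : {measure set T -> \bar R}).
Variable q : R.
Hypothesis q0 : 0 < q.
Local Open Scope ereal_scope.

Let iq0 : (0 <= q^-1)%R. Proof. by rewrite invr_ge0 ltW. Qed.
Let qn0 : (q != 0)%R. Proof. by rewrite gt_eqF. Qed.

Lemma poweR_mono (x y : \bar R) (p : R) : (0 <= p)%R -> 0 <= x -> x <= y -> x `^ p <= y `^ p.
Proof.
move=> p0 x0 xy; apply: (gt0_ler_poweR p0) => //.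
- by rewrite in_itv /= x0 leey.
- by rewrite in_itv /= (le_trans x0 xy) leey.
Qed.

Lemma poweR_invK (x : \bar R) : 0 <= x -> (x `^ q) `^ q^-1 = x.
Proof. by move=> x0; rewrite -poweRrM mulfV // poweRe1. Qed.

Lemma poweR_Kinv (x : \bar R) : 0 <= x -> (x `^ q^-1) `^ q = x.
Proof. by move=> x0; rewrite -poweRrM mulVf // poweRe1. Qed.

Lemma nnm_poweR (g : T -> \bar R) : nnm g -> nnm (fun x => `|g x| `^ q).
Proof.
move=> [mg g0]; split => [|x]; last exact: poweR_ge0.
apply: (measurableT_comp (measurable_poweR q)).
exact: measurableT_comp.
Qed.

Lemma Lnorm_mono (g h : T -> \bar R) : nnm g -> nnm h -> (forall x, g x <= h x) ->
  'N[mu]_q%:E[g] <= 'N[mu]_q%:E[h].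
Proof.
move=> ng nh gh; rewrite unlock; apply: poweR_mono => //.
  by apply: integral_ge0 => x _; exact: poweR_ge0.
apply: nnm_le_integral; [exact: nnm_poweR|exact: nnm_poweR|].
move=> x; apply: poweR_mono => //; first exact: ltW.
by rewrite !gee0_abs ?(ng.2, nh.2).
Qed.

Lemma Lnorm_le_integral (g : T -> \bar R) (M : R) : (0 <= M)%R ->
  'N[mu]_q%:E[g] <= M%:E -> \int[mu]_x `|g x| `^ q <= (M `^ q)%:E.
Proof.
move=> M0; rewrite unlock => H.
have I0 : 0 <= \int[mu]_x `|g x| `^ q by apply: integral_ge0 => x _; exact: poweR_ge0.
rewrite -[leLHS](poweR_Kinv I0) -poweR_EFin; apply: poweR_mono => //; first exact: ltW.
exact: poweR_ge0.
Qed.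

Lemma integral_le_Lnorm (g : T -> \bar R) (M : R) : (0 <= M)%R ->
  \int[mu]_x `|g x| `^ q <= (M `^ q)%:E -> 'N[mu]_q%:E[g] <= M%:E.
Proof.
move=> M0 H; rewrite unlock.
have I0 : 0 <= \int[mu]_x `|g x| `^ q by apply: integral_ge0 => x _; exact: poweR_ge0.
have -> : M%:E = (M `^ q)%:E `^ q^-1 by rewrite -poweR_EFin poweR_invK.
exact: poweR_mono.
Qed.

Lemma LnormZ_EFin (b : R) (g : T -> \bar R) : (0 <= b)%R -> measurable_fun setT g ->
  'N[mu]_q%:E[(fun x => b%:E * g x)] = b%:E * 'N[mu]_q%:E[g].
Proof.
move=> b0 mg; rewrite unlock.
have na : nnm (fun x => `|g x| `^ q).
  split => [|x]; last exact: poweR_ge0.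
  by apply: (measurableT_comp (measurable_poweR q)); apply: measurableT_comp.
have E x : `|b%:E * g x| `^ q = (b `^ q)%:E * `|g x| `^ q.
  by rewrite abseM gee0_abs ?lee_fin // poweRM ?lee_fin // poweR_EFin.
under eq_integral => x _ do rewrite E.
rewrite (ge0_integralZl_EFin mu measurableT (fun x _ => na.2 x) na.1 (powR_ge0 _ _)).
rewrite poweRM ?lee_fin ?powR_ge0 //.
  by rewrite -poweR_EFin poweR_invK // lee_fin.
by apply: integral_ge0 => x _; exact: na.2.
Qed.

Lemma Lnorm_scale (b : R) (g : T -> R) : (0 <= b)%R -> measurable_fun setT g ->
  'N[mu]_q%:E[EFin \o (fun x => b * g x)%R] = b%:E * 'N[mu]_q%:E[EFin \o g].
Proof.
move=> b0 mg; have mE : measurable_fun setT (EFin \o g) by exact/measurable_EFinP.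
exact: (LnormZ_EFin b0 mE).
Qed.

(** The power [q] of the limit is at most the limit of the powers, and monotone convergence handles
    the latter. *)
Lemma Lnorm_lim_le (u : nat -> T -> \bar R) (M : R) : (0 <= M)%R ->
  (forall n, nnm (u n)) -> (forall x, nondecreasing_seq (u ^~ x)) ->
  (forall n, 'N[mu]_q%:E[u n] <= M%:E) ->
  'N[mu]_q%:E[(fun x => limn (u ^~ x))] <= M%:E.
Proof.
move=> M0 nu ndu HM; apply: integral_le_Lnorm => //.
have np n := nnm_poweR (nu n).
have ndp x : nondecreasing_seq (fun n => `|u n x| `^ q).
  move=> m n mn; apply: poweR_mono => //; first exact: ltW.
  rewrite !gee0_abs; [exact: ndu|exact: (nu n).2|exact: (nu m).2].
have cp x : cvgn (fun n => `|u n x| `^ q) by exact: ereal_nondecreasing_is_cvgn.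
have cu x : cvgn (u ^~ x) by exact: ereal_nondecreasing_is_cvgn.
have lu0 x : 0 <= limn (u ^~ x).
  by apply: lime_ge => //; apply: nearW => n; exact: (nu n).2.
have lp0 x : 0 <= limn (fun n => `|u n x| `^ q).
  by apply: lime_ge => //; apply: nearW => n; exact: (np n).2.
have le_p n x : `|u n x| `^ q <= limn (fun n => `|u n x| `^ q).
  apply: lime_ge => //; exists n => // m /= nm; exact: ndp.
have nlp : nnm (fun x => limn (fun n => `|u n x| `^ q)).
  split => //; apply: (emeasurable_fun_cvg (fun n x => `|u n x| `^ q)).
    by move=> n; exact: (np n).1.
  by move=> x _; exact: cp.
have nlu : nnm (fun x => limn (u ^~ x)).
  split => //; apply: (emeasurable_fun_cvg u); first by move=> n; exact: (nu n).1.
  by move=> x _; exact: cu.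
apply: (@le_trans _ _ (\int[mu]_x limn (fun n => `|u n x| `^ q))).
  apply: nnm_le_integral; [exact: nnm_poweR|exact: nlp|move=> x].
  rewrite gee0_abs // -[leRHS](poweR_Kinv (lp0 x)); apply: poweR_mono => //; first exact: ltW.
  apply: lime_le => //; apply: nearW => n.
  rewrite -[leLHS](poweR_invK ((nu n).2 x)); apply: poweR_mono => //; first exact: poweR_ge0.
  by have := le_p n x; rewrite gee0_abs //; exact: (nu n).2.
rewrite (monotone_convergence mu measurableT (fun n => (np n).1) (fun n x _ => (np n).2 x)
  (fun x _ => ndp x)).
apply: lime_le.
  apply: ereal_nondecreasing_is_cvgn => m n mn.
  by apply: nnm_le_integral => // x; exact: ndp.
by apply: nearW => n; exact: Lnorm_le_integral.
Qed.

End Lnorm_more.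

Lemma powR_inv_pow2 (R : realType) (a : R) n :
  (2 ^+ n)^-1 `^ a = (2 `^ (- a)) ^+ n.
Proof.
have h : 0 <= (2 : R) ^+ n by exact: exprn_ge0.
rewrite -(powR_inv1 h) -powR_mulrn // -!powRrM -[RHS]powR_mulrn ?powR_ge0 //.
by rewrite -powRrM; f_equal; ring.
Qed.

(** * From level sets to the strong type *)

Section strong.
Variables (R : realType) (k l : nat) (c : 'M[R]_(k, l)).
Local Notation TR := (measurableTypeR R).
Local Notation X := 'rV[R]_(k + l).
Local Notation lam := (lebesgue_rV R (k + l)).
Local Notation mT := (uniform_prob (ltN11 R)).

Lemma foldr_Tp_le s (g h : X -> \bar R) : nnm g -> nnm h -> (forall x, g x <= h x)%E ->
  forall x, (foldr (Tp c) g s x <= foldr (Tp c) h s x)%E.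
Proof.
move=> ng nh gh; elim: s => //= i s IH.
by apply: Tp_le => //; apply: nnm_foldr => // *; exact: nnm_Tp.
Qed.

Lemma nnm_foldr_Tp s (g : X -> \bar R) : nnm g -> nnm (foldr (Tp c) g s).
Proof. by move=> ng; apply: nnm_foldr => // *; exact: nnm_Tp. Qed.

Lemma nnm_lim (u : nat -> X -> \bar R) : (forall n, nnm (u n)) ->
  (forall x, nondecreasing_seq (u ^~ x)) -> nnm (fun x => limn (u ^~ x)).
Proof.
move=> nu ndu.
have cu x : cvgn (u ^~ x) by exact: ereal_nondecreasing_is_cvgn.
split => [|x]; last by apply: lime_ge => //; apply: nearW => n; exact: (nu n).2.
apply: (emeasurable_fun_cvg u); first by move=> n; exact: (nu n).1.
by move=> x _; exact: cu.
Qed.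

Lemma foldr_Tp_lim s (u : nat -> X -> \bar R) : (forall n, nnm (u n)) ->
  (forall x, nondecreasing_seq (u ^~ x)) ->
  foldr (Tp c) (fun x => limn (u ^~ x)) s = (fun x => limn (fun n => foldr (Tp c) (u n) s x)).
Proof.
move=> nu ndu; elim: s => [//|i s IH]; rewrite [LHS]/= IH.
have nv n := nnm_foldr_Tp s (nu n).
have ndv x : nondecreasing_seq (fun n => foldr (Tp c) (u n) s x).
  by move=> m n mn; apply: foldr_Tp_le => // y; exact: ndu.
apply/funext => x.
have ns n := nnm_sub1 (@measurable_parab R k l c i) x (nv n).
exact: (monotone_convergence mT measurableT (fun n => (ns n).1) (fun n s _ => (ns n).2 s)
  (fun s _ => ndv (x - parab c i s))).
Qed.

Lemma foldr_rT_EFin s (g : X -> R) : bmf g -> (forall x, 0 <= g x) ->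
  bmf (foldr (rT c) g s) /\ EFin \o foldr (rT c) g s = foldr (Tp c) (EFin \o g) s.
Proof.
move=> bg g0; elim: s => //= i s [bs IH]; split; first exact: bmf_rT.
rewrite -IH; apply/funext => x; exact: (rop_EFin mT (@measurable_parab R k l c i) x bs).
Qed.

Lemma foldr_rT_sum s (I : Type) (r : seq I) (F : I -> X -> R) : (forall t, bmf (F t)) ->
  foldr (rT c) (fun x => \sum_(t <- r) F t x) s =
  (fun x => \sum_(t <- r) foldr (rT c) (F t) s x).
Proof.
move=> bF; elim: s => [//|i s IH]; rewrite [LHS]/= IH.
apply: (rop_sum mT r (@measurable_parab R k l c i)) => t.
by elim: (s) => //= j s' ?; exact: bmf_rT.
Qed.

Lemma foldr_rT_scale s a (g : X -> R) : bmf g ->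
  foldr (rT c) (fun x => a * g x) s = (fun x => a * foldr (rT c) g s x).
Proof.
move=> bg; elim: s => [//|i s IH]; rewrite [LHS]/= IH.
apply: (ropZ mT (@measurable_parab R k l c i)).
by elim: (s) => //= j s' ?; exact: bmf_rT.
Qed.

(** The dyadic scales with exponents from [-n] to [n - 1], added two at a time from the centre
    outwards: the partial sums increase with [n], and high and low scales each contribute one term
    of their own geometric series. *)
Fixpoint levels n : seq R :=
  if n is m.+1 then [:: 2 ^+ m, (2 ^+ m.+1)^-1 & levels m] else [::].

Lemma levels_gt0 n t : t \in levels n -> 0 < t.
Proof.
by elim: n => //= n IH; rewrite !inE => /or3P[/eqP ->|/eqP ->|/IH //]; rewrite ?invr_gt0 exprn_gt0.
Qed.

Lemma level_exists (y : R) : 0 < y -> exists n t, t \in levels n /\ t <= y < 2 * t.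
Proof.
move=> y0; have h2 : 0 <= 2^-1 :> R by [].
have h21 : 2^-1 < 1 :> R by rewrite invf_lt1 // ltr1n.
have [y1|y1] := leP 1 y.
  have ex : exists n, y < 2 ^+ n.+1.
    have yi : 0 < y^-1 by rewrite invr_gt0.
    have [n hn] := expr_small h2 h21 yi; exists n.
    rewrite exprVn ltf_pV2 ?posrE ?exprn_gt0 // in hn.
    by apply: (lt_le_trans hn); rewrite ler_eXn2l // ltr1n.
  case: (ex_minnP ex) => n hn hmin; exists n.+1, (2 ^+ n).
  rewrite /= inE eqxx; split => //; rewrite -exprS hn andbT.
  case: n hn hmin => [|n] hn hmin //.
  by rewrite leNgt; apply/negP => /hmin; rewrite ltnn.
have ex : exists n, (2 ^+ n.+1)^-1 <= y.
  have [n hn] := expr_small h2 h21 y0; exists n.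
  apply: le_trans (ltW hn); rewrite exprVn lef_pV2 ?posrE ?exprn_gt0 //.
  by rewrite ler_eXn2l // ltr1n.
case: (ex_minnP ex) => n hn hmin; exists n.+1, (2 ^+ n.+1)^-1.
rewrite /= !inE eqxx orbT; split => //; rewrite hn /=.
rewrite exprS invfM mulrA divff // mul1r.
case: n hn hmin => [|n] hn hmin; first by rewrite expr0 invr1.
by rewrite ltNge; apply/negP => /hmin; rewrite ltnn.
Qed.

Section levelsets.
Variables (p q : R) (f : X -> R) (M : R).
Hypotheses (p0 : 0 < p) (q1 : 1 <= q) (mf : measurable_fun setT f) (M0 : 0 < M).
Hypothesis fM : ('N[lam]_p%:E[EFin \o f] <= M%:E)%E.

(** A full superlevel set and not a dyadic shell: Chebyshev gives the measure bound [t ^ (- p)]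
    directly, and only a majorant of [|f|] is needed. *)
Definition lset (t : R) : set X := [set x | M * t <= `|f x|].

Lemma measurable_lset t : measurable (lset t).
Proof.
have -> : lset t = (fun x => `|f x|) @^-1` [set` `[M * t, +oo[].
  by apply/seteqP; split => x /=; rewrite in_itv /= andbT.
rewrite -[X in measurable X]setTI.
have mn : measurable_fun setT (fun x => `|f x|) by exact: measurableT_comp.
exact: mn.
Qed.

Lemma lset_measure_le t : 0 < t -> (lam (lset t) <= (t `^ (- p))%:E)%E.
Proof.
move=> t0.
have H := Lnorm_le_integral p0 (ltW M0) fM.
have Mt : 0 < (M * t) `^ p by rewrite powR_gt0 // mulr_gt0.
have nI : nnm (fun x => (\1_(lset t) x)%:E : \bar R).
  split => [|x]; last by rewrite lee_fin.
  by apply/measurable_EFinP; apply: measurable_indic; exact: measurable_lset.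
have K : (((M * t) `^ p)%:E * lam (lset t) <= (M `^ p)%:E)%E.
  apply: le_trans H.
  have -> : lam (lset t) = (\int[lam]_x (\1_(lset t) x)%:E)%E.
    by rewrite integral_indic ?setIT //; exact: measurable_lset.
  rewrite -(ge0_integralZl_EFin lam measurableT (fun x _ => nI.2 x) nI.1 (ltW Mt)).
  apply: nnm_le_integral; first exact: (nnmZ (ltW Mt) nI).
    split => [|x]; last exact: poweR_ge0.
    apply: (measurableT_comp (measurable_poweR p)); apply: measurableT_comp => //.
    exact/measurable_EFinP.
  move=> x; rewrite /= indicE; case: (boolP (x \in lset t)) => [/set_mem h|_].
    rewrite mule1 lee_fin; apply: ge0_ler_powR; rewrite ?nnegrE ?(ltW p0) //.
    by rewrite mulr_ge0 // ltW.
  by rewrite mule0 lee_fin powR_ge0.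
have -> : t `^ (- p) = M `^ p / (M * t) `^ p.
  rewrite powRM ?(ltW M0) ?(ltW t0) // invfM mulrA divff ?mul1r ?powRN //.
  by rewrite gt_eqF // powR_gt0.
by rewrite EFinM lee_pdivlMr // muleC.
Qed.

Lemma bint_lset t : 0 < t -> bint (\1_(lset t) : X -> R) /\
  (\int[lam]_x `|\1_(lset t) x|%:E <= (t `^ (- p))%:E)%E /\
  n2 (\1_(lset t) : X -> R) <= t `^ (- p).
Proof.
move=> t0; have mI : measurable_fun setT (\1_(lset t) : X -> R).
  by apply: measurable_indic; exact: measurable_lset.
have E : (\int[lam]_x `|\1_(lset t) x|%:E = lam (lset t))%E.
  transitivity (\int[lam]_x (\1_(lset t) x)%:E)%E.
    by apply: eq_integral => x _; rewrite ger0_norm.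
  by rewrite integral_indic ?setIT //; exact: measurable_lset.
have L := lset_measure_le t0.
have bI : bint (\1_(lset t) : X -> R).
  split; first by split => //; exists 1 => x; rewrite ger0_norm // indicE; case: (_ \in _).
  by rewrite E; apply: le_lt_trans L (ltry _).
split => //; split; first by rewrite E.
rewrite -lee_fin (n2E bI); apply: le_trans L; rewrite -E.
rewrite le_eqVlt; apply/orP; left; apply/eqP; apply: eq_integral => x _.
by rewrite indicE; case: (_ \in _); rewrite ?normr1 ?normr0 ?expr1n ?expr0n.
Qed.

(** At a point where [t <= |f x| / M < 2 * t], the term of level [t] alone is [2 * M * t], hence
    dominates [|f x|]; this is the origin of the factor 2. *)
Definition hsum n (x : X) : R := \sum_(t <- levels n) (2 * M * t) * \1_(lset t) x.

Lemma hsum_term_ge0 n t x : t \in levels n -> 0 <= (2 * M * t) * \1_(lset t) x.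
Proof. by move=> /levels_gt0 t0; rewrite !mulr_ge0 ?(ltW M0) ?(ltW t0). Qed.

Lemma hsum_ge0 n x : 0 <= hsum n x.
Proof. by rewrite /hsum big_seq; apply: sumr_ge0 => t; exact: hsum_term_ge0. Qed.

Lemma hsum_nd x : nondecreasing_seq (hsum ^~ x).
Proof.
apply/nondecreasing_seqP => n; rewrite /hsum /= !big_cons addrA lerDr.
by rewrite addr_ge0 // !mulr_ge0 ?invr_ge0 ?exprn_ge0 ?(ltW M0).
Qed.

Lemma hsum_cover x : exists n, `|f x| <= hsum n x.
Proof.
have [f0|f0] := eqVneq (f x) 0; first by exists 0%N; rewrite f0 normr0 hsum_ge0.
have y0 : 0 < `|f x| / M by rewrite divr_gt0 // normr_gt0.
have [n [t [tn /andP[h1 h2]]]] := level_exists y0; exists n.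
have h3 : lset t x by rewrite /lset /= mulrC -ler_pdivlMr.
apply: (@le_trans _ _ ((2 * M * t) * \1_(lset t) x)).
  rewrite indicE mem_set // mulr1; move: h2; rewrite ltr_pdivrMr // => /ltW.
  by move=> h; apply: (le_trans h); rewrite le_eqVlt; apply/orP; left; apply/eqP; ring.
rewrite /hsum (big_rem t tn) /= lerDl big_seq; apply: sumr_ge0 => t' /mem_rem.
exact: hsum_term_ge0.
Qed.

Variables (s0 s1 C0 C1 : R).
Hypotheses (C00 : 0 <= C0) (C10 : 0 <= C1) (ps1 : p * s1 < 1).
Hypothesis RT0 : forall (f : X -> R) (a : R),
  bint f -> (forall x, `|f x| <= 1) -> 0 < a ->
  (\int[lam]_x `|f x|%:E <= a%:E)%E -> n2 f <= a ->
  ('N[lam]_q%:E[EFin \o foldr (rT c) f (enum 'I_k)] <= (C0 * a `^ s0)%:E)%E.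
Hypothesis RT1 : forall (f : X -> R) (a : R),
  bint f -> (forall x, `|f x| <= 1) -> 0 < a ->
  (\int[lam]_x `|f x|%:E <= a%:E)%E -> n2 f <= a ->
  ('N[lam]_q%:E[EFin \o foldr (rT c) f (enum 'I_k)] <= (C1 * a `^ s1)%:E)%E.

Let q0 : 0 < q. Proof. exact: lt_le_trans q1. Qed.

Lemma indic_norm_le1 (A : set X) x : `|\1_A x| <= 1 :> R.
Proof. by rewrite ger0_norm // indicE; case: (_ \in _). Qed.

(** The height [t] times the restricted bound at measure [t ^ (- p)] gives [t ^ (1 - p * s)], which
    is summable over large [t] when [s > 1/p] and over small [t] when [s < 1/p]. *)
Lemma piece_level_le t (C s : R) : 0 < t -> 0 <= C ->
  ('N[lam]_q%:E[EFin \o foldr (rT c) (\1_(lset t)) (enum 'I_k)] <= (C * (t `^ (- p)) `^ s)%:E)%E ->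
  ('N[lam]_q%:E[EFin \o foldr (rT c) (fun x => (2 * M * t * \1_(lset t) x)%R) (enum 'I_k)]
    <= (2 * M * C * t `^ (1 - p * s))%:E)%E.
Proof.
move=> t0 CC H; have [bI _] := bint_lset t0.
have bb : bmf (foldr (rT c) (\1_(lset t) : X -> R) (enum 'I_k)).
  by elim: (enum 'I_k) => //= [|i s' ?]; [exact: bI.1|exact: bmf_rT].
rewrite foldr_rT_scale //; last exact: bI.1.
have b0 : 0 <= 2 * M * t by rewrite !mulr_ge0 ?(ltW M0) ?(ltW t0).
rewrite (Lnorm_scale lam q0 b0 bb.1).
apply: (@le_trans _ _ ((2 * M * t)%:E * (C * (t `^ (- p)) `^ s)%:E)%E).
  by apply: lee_wpmul2l.
rewrite -EFinM lee_fin -powRrM mulNr.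
rewrite powRD ?(gt_eqF t0) ?implybT // powRr1 ?(ltW t0) //.
by rewrite le_eqVlt; apply/orP; left; apply/eqP; ring.
Qed.

Let z0 := 2 `^ (1 - p * s0) : R.
Let z1 := 2 `^ (- (1 - p * s1)) : R.

Lemma hsum_Lnorm_le n :
  ('N[lam]_q%:E[EFin \o foldr (rT c) (hsum n) (enum 'I_k)] <=
   (2 * M * C0 * (\sum_(j <- iota 0 n) z0 ^+ j) + 2 * M * C1 * (\sum_(j <- iota 0 n) z1 ^+ j))%:E)%E.
Proof.
have bP t : bmf (fun x => 2 * M * t * \1_(lset t) x).
  apply: bmfZ; split; last by exists 1 => x; exact: indic_norm_le1.
  by apply: measurable_indic; exact: measurable_lset.
rewrite (_ : hsum n = fun x => \sum_(t <- levels n) (2 * M * t) * \1_(lset t) x) //.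
rewrite foldr_rT_sum //.
have mP t : measurable_fun setT (foldr (rT c) (fun x => (2 * M * t * \1_(lset t) x)%R) (enum 'I_k)).
  by apply: (proj1 (_ : bmf _)); elim: (enum 'I_k) => //= i s ?; exact: bmf_rT.
apply: (le_trans (Lnorm_sum lam _ q1 mP)).
have z1le : z1 <= 1.
  rewrite -(powRr0 2) /z1; apply: ler_powR; first by rewrite ler1n.
  by rewrite oppr_le0 subr_ge0 ltW.
have z10 : 0 <= z1 by exact: powR_ge0.
elim: n => [|n IH]; first by rewrite !big_nil !mulr0 addr0.
have iS (z : R) : \sum_(j <- iota 0 n.+1) z ^+ j = \sum_(j <- iota 0 n) z ^+ j + z ^+ n.
  by rewrite -(addn1 n) iotaD big_cat big_seq1.
rewrite !iS [levels n.+1]/= !big_cons.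
have t0 : 0 < 2 ^+ n :> R by rewrite exprn_gt0.
have t1 : 0 < (2 ^+ n.+1)^-1 :> R by rewrite invr_gt0 exprn_gt0.
have [b0 [i0 n0]] := bint_lset t0; have [b1 [i1 n1]] := bint_lset t1.
have H0 := piece_level_le t0 C00 (RT0 b0 (indic_norm_le1 _) (powR_gt0 _ t0) i0 n0).
have H1 := piece_level_le t1 C10 (RT1 b1 (indic_norm_le1 _) (powR_gt0 _ t1) i1 n1).
apply: (le_trans (leeD H0 (leeD H1 IH))); rewrite -!EFinD lee_fin.
have -> : (2 ^+ n) `^ (1 - p * s0) = z0 ^+ n :> R.
  by rewrite /z0 -powR_mulrn // -powRrM mulrC powRrM powR_mulrn ?powR_ge0.
have -> : (2 ^+ n.+1)^-1 `^ (1 - p * s1) = z1 ^+ n.+1 :> R.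
  exact: powR_inv_pow2.
(* The low levels begin at [2^(-1)], so their series is one index ahead; since [z1 <= 1], moving it
   back only increases the bound. *)
have h : z1 ^+ n.+1 <= z1 ^+ n by rewrite exprS ler_piMl ?exprn_ge0.
have h' : 2 * M * C1 * z1 ^+ n.+1 <= 2 * M * C1 * z1 ^+ n.
  by apply: ler_wpM2l => //; rewrite !mulr_ge0 // ltW.
move: h'; move: (z1 ^+ n.+1) (z1 ^+ n) (z0 ^+ n) (\sum_(_ <- _) _) (\sum_(_ <- _) _).
move=> a1 a2 a3 a4 a5; rewrite !mulrDr; lra.
Qed.

Lemma strong_le W0 W1 : (forall n, \sum_(j <- iota 0 n) z0 ^+ j <= W0) ->
  (forall n, \sum_(j <- iota 0 n) z1 ^+ j <= W1) -> 0 <= W0 -> 0 <= W1 ->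
  ('N[lam]_q%:E[foldr (Tp c) (fun x => `|f x|%:E) (enum 'I_k)] <=
   ((2 * C0 * W0 + 2 * C1 * W1) * M)%:E)%E.
Proof.
move=> HW0 HW1 W00 W10.
pose u n : X -> \bar R := EFin \o hsum n.
have mh n : measurable_fun setT (hsum n).
  apply: measurable_sum => t; apply: measurable_funM => //.
  by apply: measurable_indic; exact: measurable_lset.
have nu n : nnm (u n).
  by split => [|x]; [exact/measurable_EFinP|rewrite lee_fin hsum_ge0].
have ndu x : nondecreasing_seq (u ^~ x).
  by move=> m n mn; rewrite lee_fin; exact: hsum_nd.
have nf : nnm (fun x => `|f x|%:E) by exact: nnm_abs.
have flim x : (`|f x|%:E <= limn (u ^~ x))%E.
  have [n hn] := hsum_cover x.
  apply: lime_ge; first exact: ereal_nondecreasing_is_cvgn.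
  exists n => // m /= nm; rewrite lee_fin; apply: (le_trans hn); exact: hsum_nd.
have nlim := nnm_lim nu ndu.
apply: (le_trans (Lnorm_mono lam q0 (nnm_foldr_Tp _ nf) (nnm_foldr_Tp _ nlim)
   (foldr_Tp_le _ nf nlim flim))).
rewrite foldr_Tp_lim //.
have MM : 0 <= (2 * C0 * W0 + 2 * C1 * W1) * M.
  by rewrite mulr_ge0 ?(ltW M0) // addr_ge0 // !mulr_ge0.
apply: (Lnorm_lim_le q0 (u := fun n => foldr (Tp c) (u n) (enum 'I_k)) MM).
- by move=> n; exact: nnm_foldr_Tp.
- by move=> x m n mn; apply: foldr_Tp_le => // y; exact: ndu.
move=> n.
have bh : bmf (hsum n).
  apply: bmf_sum => t; apply: bmfZ; split; last by exists 1 => x; exact: indic_norm_le1.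
  by apply: measurable_indic; exact: measurable_lset.
have [_ <-] := foldr_rT_EFin (enum 'I_k) bh (hsum_ge0 n).
apply: (le_trans (hsum_Lnorm_le n)); rewrite lee_fin.
have h0 : 2 * M * C0 * (\sum_(j <- iota 0 n) z0 ^+ j) <= 2 * M * C0 * W0.
  by apply: ler_wpM2l => //; rewrite !mulr_ge0 ?(ltW M0).
have h1 : 2 * M * C1 * (\sum_(j <- iota 0 n) z1 ^+ j) <= 2 * M * C1 * W1.
  by apply: ler_wpM2l => //; rewrite !mulr_ge0 ?(ltW M0).
by apply: (le_trans (lerD h0 h1)); rewrite le_eqVlt; apply/orP; left; apply/eqP; ring.
Qed.

End levelsets.
End strong.

(** * Comparison of integrals *)

Section measures.
Context d (T : measurableType d) (R : realType).
Local Open Scope ereal_scope.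
Import HBNNSimple.

(** The integral of a nonnegative function is a supremum over the simple functions below it, so
    monotonicity needs no measurability. It is applied to the convolution. *)
Lemma ge0_integral_subfun (mu : {measure set T -> \bar R}) (g h : T -> \bar R) :
  (forall x, 0 <= g x) -> (forall x, g x <= h x) -> \int[mu]_x g x <= \int[mu]_x h x.
Proof.
move=> g0 gh.
have h0 x : 0 <= h x by exact: le_trans (gh x).
rewrite !ge0_integralTE //; apply: ereal_sup_le => _ [s sg <-].
by exists s => // x; exact: le_trans (gh x).
Qed.

(** The complement of [D] is null for the restricted measure, so [g] may be replaced by 0 there;
    then each simple function below it is compared under the two measures. *)
Lemma integral_mrestr_le (mu : {measure set T -> \bar R}) (D : set T) (mD : measurable D)
    (g h : T -> \bar R) : nnm g -> nnm h -> (forall x, D x -> g x <= h x) ->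
  \int[mrestr mu mD]_x g x <= \int[mu]_x h x.
Proof.
move=> [mg g0] [mh h0] gh.
have N0 : mrestr mu mD (~` D) = 0 by rewrite /mrestr setICl measure0.
rewrite (ge0_negligible_integral (mu := mrestr mu mD) (measurableC mD)) // setTD setCK.
rewrite integral_mkcond !ge0_integralTE //; last by move=> x; exact: erestrict_ge0.
apply: ge_ereal_sup => _ [s sg <-].
apply: (@le_trans _ _ (sintegral mu s)); last first.
  apply: ereal_sup_ubound; exists s => // x; apply: (le_trans (sg x)).
  by rewrite patchE; case: ifPn => // /set_mem /gh.
rewrite !sintegralE; apply: lee_fsum => // r.
have [r0|r0] := ltP r 0%R.
  rewrite (_ : s @^-1` [set r] = set0) ?measure0 ?mule0 //.
  by apply/seteqP; split => x //= xr; move: r0; rewrite -xr ltNge fun_ge0.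
move=> _; apply: lee_wpmul2l; first by rewrite lee_fin.
rewrite /mrestr; apply: le_measure; rewrite ?inE //.
exact: measurableI.
Qed.
End measures.

(** * Convolution with the surface measure *)

Section conv.
Variables (R : realType) (k l : nat) (c : 'M[R]_(k, l)).
Local Notation TR := (measurableTypeR R).
Local Notation X := 'rV[R]_(k + l).
Local Notation lam := (lebesgue_rV R (k + l)).

Definition quadric (j : 'I_l) (y : 'rV[R]_k) : R := \sum_(i < k) c i j * y ord0 i ^+ 2.

(** The quadratic forms are diagonal, so the surface is a sum of [k] parabolas in separate
    variables; this is what allows [integral_rV_chain] to be used. *)
Lemma graph_map_quadric y : graph_map quadric y = \sum_i parab c i (y ord0 i).
Proof.
have pE i t : parab c i t = row_mx (t *: delta_mx 0 i) (t ^+ 2 *: row i c).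
  by rewrite /parab /hvec /vvec !scale_row_mx !scaler0 add_row_mx addr0 add0r.
apply/rowP => j; rewrite summxE /graph_map; case: (split_ordP j) => j' ->.
  rewrite row_mxEl (bigD1 j') //= big1 => [|i ij].
    by rewrite pE row_mxEl !mxE !eqxx mulr1 addr0.
  by rewrite pE row_mxEl !mxE (eq_sym j') (negbTE ij) andbF mulr0.
rewrite row_mxEr mxE; apply: eq_bigr => i _.
by rewrite pE row_mxEr !mxE mulrC.
Qed.

Lemma measurable_graph_map_quadric : measurable_fun setT (graph_map quadric).
Proof.
rewrite (_ : graph_map quadric = fun y => \sum_(i <- index_enum 'I_k) parab c i (y ord0 i)).
  apply: measurable_rV_sum => i.
  exact: (measurableT_comp (measurable_parab c i) (measurable_rV_coord i)).
by apply/funext => y; exact: graph_map_quadric.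
Qed.

Lemma foldr_wop11 s (g : X -> \bar R) : nnm g ->
  foldr (fun i => wop (@I11 R) (parab c i)) g s =
  fun x => ((2 ^+ size s)%:E * foldr (Tp c) g s x)%E.
Proof.
move=> ng; elim: s => [|i s IH]; first by apply/funext => x; rewrite mul1e.
rewrite [LHS]/= IH; apply/funext => x.
have ns : nnm (foldr (Tp c) g s) by apply: nnm_foldr => // *; exact: nnm_Tp.
have n1 := nnm_sub1 (measurable_parab c i) x ns.
rewrite /= /Tp /op (integral_uniform11 n1) /wop muleA -EFinM exprS.
rewrite mulrAC mulfV // mul1r.
have nI : nnm (fun t : TR => (@I11 R t)%:E).
  by split => [|t]; [apply/measurable_EFinP; exact: measurable_I11|rewrite lee_fin I11_ge0].
have h2 : (0 <= 2 ^+ size s :> R)%R by exact: exprn_ge0.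
rewrite -[RHS](ge0_integralZl_EFin _ measurableT) //.
- by apply: eq_integral => t _; rewrite muleCA.
- by move=> t _; apply: mule_ge0; [exact: nI.2|exact: n1.2].
- by apply: emeasurable_funM; [exact: nI.1|exact: n1.1].
Qed.

Lemma prod_I11_cube (y : 'rV[R]_k) : cube 1 y -> \prod_i @I11 R (y ord0 i) = 1.
Proof. by move=> cy; apply: big1 => i _; rewrite I11E cy. Qed.

(** The bound holds at every [x], whether or not the integral converges: a finite right-hand side
    forces absolute convergence. The factor [2 ^+ k] undoes the normalization of the [k] uniform
    laws on [[-1, 1]]. *)
Lemma convolution_le (G : set 'rV[R]_k) (f : X -> R) x :
  measurable G -> G `<=` cube 1 -> measurable_fun setT f ->
  (`|convolution (surface_measure G quadric) f x| <=
   (2 ^+ k)%:E * foldr (Tp c) (fun x => `|f x|%:E) (enum 'I_k) x)%E.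
Proof.
move=> mG Gc mf.
have nf : nnm (fun x : X => `|f x|%:E) by exact: nnm_abs.
have mg := measurable_graph_map_quadric.
pose mu : {measure set X -> \bar R} := pushforward (mrestr (lebesgue_rV R k) mG) (graph_map quadric).
have mh : measurable_fun setT (fun z : X => x - z) by apply: measurable_rV_sub.
have -> : convolution (surface_measure G quadric) f x = (\int[mu mg]_z (f (x - z))%:E)%E by [].
have m1 : measurable_fun setT (fun z : X => (f (x - z))%:E).
  by apply/measurable_EFinP; exact: (measurableT_comp mf mh).
apply: (le_trans (le_abse_integral (mu mg) measurableT m1)).
have n2 : nnm (fun z : X => `|(f (x - z))%:E|%E).
  by have [? ?] := nnm_comp mh nf; split.
rewrite (ge0_integral_pushforward mg (mrestr (lebesgue_rV R k) mG) measurableT n2.1); last first.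
  by move=> z _; exact: n2.2.
rewrite preimage_setT.
have n3 := nnm_comp mg n2.
have := foldr_wop11 (enum 'I_k) nf; rewrite size_enum_ord => /(congr1 (@^~ x)) <-.
rewrite -(integral_rV_chain x (@measurable_I11 R) (@I11_ge0 R) (measurable_parab c) nf).
apply: (@integral_mrestr_le _ _ _ (lebesgue_rV R k) G mG _ _ n3).
  have mP : measurable_fun setT (fun y : 'rV[R]_k => \sum_(i <- index_enum 'I_k) parab c i (y ord0 i)).
    apply: measurable_rV_sum => i.
    exact: (measurableT_comp (measurable_parab c i) (measurable_rV_coord i)).
  have mI : measurable_fun setT (fun y : 'rV[R]_k => \prod_i @I11 R (y ord0 i)).
    apply: measurable_prod => i _.
    exact: (measurableT_comp (@measurable_I11 R) (measurable_rV_coord i)).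
  have [mF F0] := nnm_comp (measurable_rV_sub (measurable_cst x) mP) nf.
  split => [|y]; last by apply: mule_ge0 => //; rewrite lee_fin prodr_ge0.
  by apply: emeasurable_funM => //; exact/measurable_EFinP.
move=> y /Gc cy; rewrite (prod_I11_cube cy) mul1e /= graph_map_quadric.
exact: lexx.
Qed.
End conv.

Section Lnorm.
Context d (T : measurableType d) (R : realType) (mu : {measure set T -> \bar R}).
Variable q : R.
Hypothesis q0 : 0 < q.
Local Open Scope ereal_scope.

Lemma Lnorm_le_abs (g h : T -> \bar R) : (forall x, `|g x| <= h x) ->
  'N[mu]_q%:E[g] <= 'N[mu]_q%:E[h].
Proof.
move=> gh; rewrite unlock; apply: poweR_mono.
- by rewrite invr_ge0 ltW.
- by apply: integral_ge0 => x _; exact: poweR_ge0.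
apply: ge0_integral_subfun => x; first exact: poweR_ge0.
apply: poweR_mono => //; first exact: ltW.
by apply: (le_trans (gh x)); rewrite gee0_abs // (le_trans _ (gh x)).
Qed.
End Lnorm.

(** * The triangle of exponents *)

Section geometry.
Variable R : realType.

(** The three sides of the triangle: in barycentric coordinates the slack in each inequality is a
    nonnegative multiple of one of the three weights. *)
Lemma Delta_ineqs (k l : nat) (s r : R) : (0 < k)%N -> (Delta k (k + l)) (s, r) ->
  [/\ r <= s, l%:R * (s - r) <= k%:R * r & l%:R * (s - r) <= k%:R * (1 - s)].
Proof.
move=> k0 [a [b [e [a0 b0 e0 abe /= [-> ->]]]]].
have k0R : 0 < k%:R :> R by rewrite ltr0n.
have l0R : 0 <= l%:R :> R by rewrite ler0n.
rewrite natrD (_ : 2 * (k%:R + l%:R) - k%:R = k%:R + 2 * l%:R :> R); last by ring.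
rewrite (_ : k%:R + l%:R - k%:R = l%:R :> R); last by ring.
set K : R := k%:R in k0R *; set L : R := l%:R in l0R *.
have D0 : 0 < K + 2 * L by apply: ltr_pwDl => //; exact: mulr_ge0.
have aE : a = 1 - b - e by rewrite -abe; ring.
have Z : 0 <= e / (K + 2 * L) by rewrite divr_ge0 // ltW.
have E : e = (e / (K + 2 * L)) * (K + 2 * L) by rewrite divfK // gt_eqF.
set z := e / (K + 2 * L) in Z E.
rewrite (_ : e * ((K + L) / (K + 2 * L)) = z * (K + L)); last by rewrite /z; ring.
rewrite (_ : e * (L / (K + 2 * L)) = z * L); last by rewrite /z; ring.
rewrite !mulr0 !add0r !mulr1.
have zK : 0 <= z * K by rewrite mulr_ge0 // ltW.
have Kb : 0 <= K * b by rewrite mulr_ge0 // ltW.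
have Ka : 0 <= K * a by rewrite mulr_ge0 // ltW.
split.
- by rewrite -subr_ge0 (_ : _ - _ = z * K) //; ring.
- by rewrite -subr_ge0 (_ : _ - _ = K * b) //; ring.
by rewrite -subr_ge0 (_ : _ - _ = K * a) //; rewrite aE E; ring.
Qed.

(** Only [1/p] is moved, by [h] in both directions with [1/q] fixed. The inequalities at [s + h]
    become strict for smaller abscissae, and [r <= s - h] leaves room for [x = s' - r >= 0] on both
    sides of [s]. *)
Lemma interior_Delta (k l : nat) (s r : R) : (0 < l)%N -> (0 < k)%N ->
  (Delta k (k + l))° (s, r) ->
  exists2 e : R, 0 < e & [/\ 0 < r, r <= 1, 0 < s & forall x, s - e <= x + r <= s + e ->
     [/\ 0 <= x, l%:R * x < k%:R * r & l%:R * x < k%:R * (1 - x - r)]].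
Proof.
move=> l0 k0 /nbhs_ballP[d /= d0 H].
have k0R : 0 < k%:R :> R by rewrite ltr0n.
have l0R : 0 < l%:R :> R by rewrite ltr0n.
pose h := d / 2; have h0 : 0 < h by rewrite divr_gt0.
have hd : h < d by rewrite /h; lra.
have [A1 A2 A3] : [/\ r <= s + h, l%:R * (s + h - r) <= k%:R * r & l%:R * (s + h - r) <= k%:R * (1 - (s + h))].
  apply: Delta_ineqs => //; apply: H; split => /=; last exact: ballxx.
  by rewrite /ball /= opprD addrA subrr sub0r normrN gtr0_norm.
have [B1 B2 B3] : [/\ r <= s - h, l%:R * (s - h - r) <= k%:R * r & l%:R * (s - h - r) <= k%:R * (1 - (s - h))].
  apply: Delta_ineqs => //; apply: H; split => /=; last exact: ballxx.
  by rewrite /ball /= opprB addrC subrK gtr0_norm.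
have lh : 0 < l%:R * h by exact: mulr_gt0.
have A0 : 0 <= l%:R * (s - h - r) by apply: mulr_ge0; [exact: ltW|rewrite subr_ge0].
have r0 : 0 < r.
  rewrite -(pmulr_rgt0 _ k0R); apply: lt_le_trans A2.
  by apply: mulr_gt0 => //; lra.
have s1 : 0 < 1 - (s + h).
  rewrite -(pmulr_rgt0 _ k0R); apply: lt_le_trans A3.
  by apply: mulr_gt0 => //; lra.
exists (h / 2); first by rewrite divr_gt0.
split => //; [lra|lra|] => x /andP[x1 x2].
have lx : l%:R * x < l%:R * (s + h - r) by rewrite ltr_pM2l //; lra.
split; first by lra.
  exact: lt_le_trans A2.
apply: (lt_trans (lt_le_trans lx A3)); rewrite ltr_pM2l //; lra.
Qed.
End geometry.

(** * The Euclidean unit ball *)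

Section unit_ball.
Variables (R : realType) (k : nat).

Lemma euclidean_ball_cube : euclidean_ball (0 : 'rV[R]_k) 1 `<=` cube 1.
Proof.
move=> y /= h i.
have S0 : 0 <= \sum_i (y ord0 i - (0 : 'rV[R]_k) ord0 i) ^+ 2.
  by apply: sumr_ge0 => j _; exact: sqr_ge0.
rewrite -sqrtr_sqr; apply: ltW; apply: le_lt_trans h; rewrite ler_sqrt //.
rewrite (bigD1 i) //= mxE subr0 lerDl.
by apply: sumr_ge0 => j _; exact: sqr_ge0.
Qed.

Lemma open_euclidean_ball : open (euclidean_ball (0 : 'rV[R]_k) 1).
Proof.
have cS (s : seq 'I_k) : continuous (fun y : 'rV[R]_k =>
    \sum_(i <- s) (y ord0 i - (0 : 'rV[R]_k) ord0 i) ^+ 2 : R).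
  elim: s => [|i s IH] y.
    under eq_fun do rewrite big_nil.
    exact: cst_continuous.
  under eq_fun do rewrite big_cons expr2.
  have h : (fun z : 'rV[R]_k => z ord0 i - (0 : 'rV[R]_k) ord0 i) z @[z --> y] -->
      (y ord0 i - (0 : 'rV[R]_k) ord0 i).
    exact: (cvgB (@coord_continuous R 1 k ord0 i y) (cvg_cst _)).
  exact: (cvgD (cvgM h h) (IH y)).
have c1 : continuous (fun y : 'rV[R]_k =>
    Num.sqrt (\sum_i (y ord0 i - (0 : 'rV[R]_k) ord0 i) ^+ 2) : R).
  by move=> y; apply: continuous_comp; [exact: cS|exact: sqrt_continuous].
have := @open_comp _ _ _ _ (fun y _ => c1 y) (@open_lt R 1).
exact.
Qed.

Lemma euclidean_ball0 : euclidean_ball (0 : 'rV[R]_k) 1 0.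
Proof.
rewrite /euclidean_ball /= big1 ?sqrtr0 // => i _.
by rewrite subrr expr0n.
Qed.

End unit_ball.

(** * The estimate for the quadratic surface *)

Section quadric.
Variables (R : realType) (k l : nat) (c : 'M[R]_(k, l)).

Lemma homogeneous_quadric j : homogeneous_polynomial (quadric c j).
Proof.
exists 2, (\sum_(i < k) c i j *: (mpolyX R (mnm1 i)) ^+ 2); split.
  apply: rpred_sum => i _; apply: rpredZ; apply: (@dhomogMn _ _ _ 1).
  by rewrite dhomogX /= mdeg1.
move=> y; rewrite raddf_sum; apply: eq_bigr => i _.
by rewrite /= mevalZ rmorphXn /= mevalXU.
Qed.

Hypotheses (hl : (1 <= l)%N) (hlk : (l <= k)%N).
Hypothesis hc : forall s : 'I_l -> 'I_k, {homo s : i j / (i < j)%N} -> rowsub s c \in unitmx.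
Local Notation X := 'rV[R]_(k + l).
Local Notation lam := (lebesgue_rV R (k + l)).

Let k0 : (0 < k)%N. Proof. exact: leq_trans hlk. Qed.

(** [l <= k] and [1 <= k] give [2 * (k + l) <= 4 * k <= k * (k + 3)], so no truncation of the
    triangle occurs. *)
Lemma calT_Delta : calT k (k + l) = Delta k (k + l) :> set (R * R).
Proof.
rewrite /calT ifT //; apply: (@leq_trans (k * 4)).
  by rewrite mulnC (mulnA k 2 2) leq_mul2r muln2 -addnn leq_add2l hlk orbT.
by rewrite leq_mul2l (leq_add2r 3 1) k0 orbT.
Qed.

Lemma restricted_type (x r : R) : 0 <= x -> r <= 1 -> l%:R * x < k%:R * r ->
  l%:R * x < k%:R * (1 - x - r) ->
  exists2 C : R, 0 <= C & forall (f : X -> R) (a : R), bint f ->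
    (forall x, `|f x| <= 1) -> 0 < a -> (\int[lam]_x `|f x|%:E <= a%:E)%E -> n2 f <= a ->
    ('N[lam]_(r^-1)%:E[EFin \o foldr (rT c) f (enum 'I_k)] <= (C * a `^ (x + r))%:E)%E.
Proof.
move=> x0 r1 h1 h2; have k0R : 0 < k%:R :> R by rewrite ltr0n.
have g1 : l%:R * x / k%:R < r by rewrite ltr_pdivrMr // [_ * k%:R]mulrC.
have g2 : l%:R * x / k%:R < 1 - x - r by rewrite ltr_pdivrMr // [_ * k%:R]mulrC.
(* The interpolation asks for [l * x / k < eta < r] and [eta <= 1 - x - r]; [dl] places [eta] at the
   midpoint between [l * x / k] and the smaller of the two upper limits. *)
pose m := Num.min r (1 - x - r).
have mz : l%:R * x / k%:R < m by rewrite lt_min g1.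
pose dl := (m - l%:R * x / k%:R) / 2.
have dl0 : 0 < dl by rewrite divr_gt0 // subr_gt0.
have em : l%:R * x / k%:R + dl < m by rewrite /dl; move: mz; move: (_ / k%:R) (m) => z m'; lra.
have := em; rewrite lt_min => /andP[e1 e2].
apply: (restricted_le hlk k0 hc x0 dl0 (erefl _) e1 _ r1).
by move: e2; move: (_ + dl) => z; lra.
Qed.

Lemma strong_type (p q : R) : (calT k (k + l))° (p^-1, q^-1) ->
  exists2 K : R, 0 <= K & forall (f : X -> R) (M : R), measurable_fun setT f -> 0 < M ->
  ('N[lam]_p%:E[EFin \o f] <= M%:E)%E ->
  ('N[lam]_q%:E[foldr (Tp c) (fun x => `|f x|%:E) (enum 'I_k)] <= (K * M)%:E)%E.
Proof.
rewrite calT_Delta; move=> /(interior_Delta hl k0)[e e0 [r0 r1 s0 H]].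
set r := q^-1 in r0 r1 H *; set s := p^-1 in s0 H *.
have p0 : 0 < p by rewrite -invr_gt0.
have q1 : 1 <= q by rewrite -[q]invrK invf_ge1.
(* The restricted estimate is taken at the exponents [s + e] for high levels and [s - e] for low
   ones; with [p * s = 1] both geometric series have ratio [2 ^ (- (p * e))]. *)
have hx0 : s - e <= s + e - r + r <= s + e by rewrite subrK lexx andbT; lra.
have hx1 : s - e <= s - e - r + r <= s + e by rewrite subrK lexx /=; lra.
have [x0 g0 g0'] := H _ hx0; have [x1 g1 g1'] := H _ hx1.
have [C0 C00 R0] := restricted_type x0 r1 g0 g0'.
have [C1 C10 R1] := restricted_type x1 r1 g1 g1'.
rewrite /r !subrK invrK in R0 R1.
have pe : 0 < p * e by exact: mulr_gt0.
have ps : p * s = 1 by rewrite mulfV // gt_eqF.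
have E0 : 1 - p * (s + e) = - (p * e) by rewrite mulrDr ps; ring.
have E1 : 1 - p * (s - e) = p * e by rewrite mulrBr ps; ring.
have ps1 : p * (s - e) < 1 by rewrite -subr_gt0 E1.
have /andP[z0 z1] := powR2N_lt1 pe.
have [W W0 HW] := arith_geom_bound z0 z1.
have HW' n : \sum_(j <- iota 0 n) (2 `^ (- (p * e))) ^+ j <= W.
  apply: le_trans (HW n); apply: ler_sum => j _.
  by rewrite ler_peMl ?exprn_ge0 // ler1n.
exists (2 * C0 * W + 2 * C1 * W); first by rewrite addr_ge0 // !mulr_ge0.
move=> f M mf M0 fM.
by apply: (strong_le p0 q1 mf M0 fM C00 C10 ps1 R0 R1) => // n; rewrite ?E0 ?E1.
Qed.

Lemma convolution_bound (G : set 'rV[R]_k) (p q : R) : measurable G -> G `<=` cube 1 ->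
  (calT k (k + l))° (p^-1, q^-1) ->
  exists C : R, forall f : X -> R, f \in Lfun lam p%:E ->
   ('N[lam]_(q%:E) [convolution (surface_measure G (quadric c)) f] <=
             C%:E * 'N[lam]_(p%:E) [EFin \o f])%E.
Proof.
move=> mG Gc pq; have [K K0 HK] := strong_type pq.
have q0 : 0 < q.
  have := pq; rewrite calT_Delta; move=> /(interior_Delta hl k0)[e e0 [r0 r1 s0 H]].
  by rewrite -invr_gt0.
exists (2 ^+ k * K) => f /andP[mf fp].
have {}mf : measurable_fun setT f by rewrite inE in mf.
have {}fp : ('N[lam]_p%:E [EFin \o f] < +oo)%E by rewrite inE in fp.
have fE : ('N[lam]_p%:E [EFin \o f] = (fine ('N[lam]_p%:E [EFin \o f]))%:E)%E.
  by rewrite fineK // ge0_fin_numE // Lnorm_ge0.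
have := Lnorm_ge0 lam p%:E (EFin \o f); rewrite fE lee_fin.
move: (fine _) fE => M fE M0.
have nf : nnm (fun x : X => `|f x|%:E) by exact: nnm_abs.
have k2 : 0 <= 2 ^+ k :> R by exact: exprn_ge0.
apply: (le_trans (Lnorm_le_abs lam q0 (fun x => convolution_le c x mG Gc mf))).
rewrite (LnormZ_EFin lam q0 k2 (nnm_foldr_Tp c _ nf).1).
rewrite -EFinM -mulrA EFinM; apply: lee_wpmul2l; first by rewrite lee_fin.
(* The norm [M] may be 0, whereas the level sets are scaled by a positive number: [M] is enlarged to
   [M'] so that the bound grows by at most [e]. *)
apply/lee_addgt0Pr => e e0.
have K1 : 0 < K + 1 by rewrite ltr_wpDl.
pose M' := M + e / (K + 1).
have eK : 0 < e / (K + 1) by exact: divr_gt0.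
have M'0 : 0 < M' by rewrite ltr_wpDl.
have fM' : ('N[lam]_p%:E [EFin \o f] <= M'%:E)%E by rewrite fE lee_fin lerDl ltW.
apply: (le_trans (HK f M' mf M'0 fM')); rewrite -EFinD lee_fin mulrDr lerD2l.
rewrite mulrC mulrAC ler_pdivrMr //; apply: ler_wpM2l; first exact: ltW.
by rewrite lerDl.
Qed.

End quadric.

Theorem mainTheorem1 (R : realType) (k l : nat) (hl : (1 <= l)%N)
    (hlk : (l <= k)%N) (c : 'M[R]_(k, l))
    (hc : forall s : 'I_l -> 'I_k, {homo s : i j / (i < j)%N} ->
      rowsub s c \in unitmx) :
  model_surface (graph_surface (euclidean_ball (0 : 'rV[R]_k) 1)
    (fun (j : 'I_l) (y : 'rV[R]_k) => \sum_(i < k) c i j * y ord0 i ^+ 2)).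
Proof.
exists (euclidean_ball 0 1), (quadric c); split => //.
- exact: open_euclidean_ball.
- by exists 0; exact: euclidean_ball0.
- exact: homogeneous_quadric.
move=> p q pq; apply: (convolution_bound hl hlk hc _ _ pq).
  by apply: open_measurable_rV; exact: open_euclidean_ball.
exact: euclidean_ball_cube.
Qed.
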